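(* Let $X$ be a continuum and let $T$ be its cut point tree. There is a path metric $d$ on $T$, which preserves the pretree structure of $T$, such that $(T,d)$ is a metric $\mathbb{R}$-tree. The topology so defined on $T$ is canonical (and may be different from the topology on $T$ with basis $\{U(s,A)\}$). Any homeomorphism $\phi$ of $X$ induces a homeomorphism $\hat\phi$ of $T$ equipped with this metric.
   Context: A continuum is a compact connected metric space. A set $C\subset X$ separates nonempty sets $A,B\subset X$ if there are disjoint open subsets $U,V$ of $X\setminus C$ with $A\subset U$, $B\subset V$ and $U\cup V=X\setminus C$; it separates points $a,b$ if it separates $\{a\}$ and $\{b\}$. A point $c\in X$ is a cut point if $\{c\}$ separates two points of $X$. Cut point pretree. For $a,b\in X$ let $(a,b)$ be the set of cut points $c$ of $X$ such that $\{c\}$ separates $a$ from $b$. For $a\neq b$ put $[a,b)=\{a\}\cup(a,b)$, $(a,b]=(a,b)\cup\{b\}$, $[a,b]=\{a,b\}\cup(a,b)$, and put $[a,a)=(a,a]=\emptyset$, $[a,a]=\{a\}$. Define an equivalence relation on $X$: each cut point is equivalent only to itself, and two points $a,b$ that are not cut points are equivalent if $(a,b)=\emptyset$. Let $\mathcal{P}$ be the set of equivalence classes (a cut point is identified with its class). For $x,y\in\mathcal{P}$: a cut point $c$ lies in $(x,y)$ if for some (equivalently any) $a\in x$, $b\in y$ we have $c\in(a,b)$; a class $z\in\mathcal{P}$ that is not a cut point and is distinct from $x,y$ lies in $(x,y)$ if for some (equivalently any) $a\in x$, $b\in y$, $c\in z$ we have $[a,c)\cap(c,b]=\emptyset$.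 ''$z$ is between $x$ and $y$'' means $z\in(x,y)$. With this relation $\mathcal{P}$ is a pretree: a set with a betweenness relation (written $xyz$ for ''$y$ is between $x$ and $z$'') such that (1) $xyx$ never holds; (2) $xzy\Leftrightarrow yzx$; (3) if $y$ is between $x$ and $z$ then $z$ is not between $x$ and $y$; (4) if $xzy$ and $z\neq w$ then $xzw$ or $yzw$. In any pretree, $(x,y)$ denotes the set of elements between $x$ and $y$, and $[x,y]=(x,y)\cup\{x,y\}$. Cut point tree. Distinct $x,y\in\mathcal{P}$ are adjacent if $(x,y)=\emptyset$. Let $T$ be the disjoint union of $\mathcal{P}$ and one copy $I_{x,y}$ of the real open interval $(0,1)$ for each adjacent pair $x,y$ of $\mathcal{P}$, glued in between $x$ and $y$. The betweenness relation of $\mathcal{P}$ is extended to $T$ in the obvious way, so that in $T$ one has $(x,y)=I_{x,y}$ for $x,y$ adjacent in $\mathcal{P}$ (with the usual order on $I_{x,y}$); for $u,v\in\mathcal{P}$, the interval $(u,v)$ of $T$ is the interval $(u,v)$ of $\mathcal{P}$ together with all $I_{x,y}$ for adjacent $x,y\in[u,v]$; and an interval with an endpoint inside some $I_{x,y}$ and the other endpoint outside $I_{x,y}$ passes from the first endpoint along $I_{x,y}$ to the endpoint $x$ or $y$ that lies on the side of the second one and continues from there. For $s\in T$ and $A\subset T$ finite let $U(s,A)=\{t\in T:[s,t]\cap A=\emptyset\}$. Terminology. A real tree is a uniquely arcwise connected space in the following sense: a big arc is a homeomorphic image of a compact connected linearly ordered topological space with more than one point, an arc is a separable big arc, a big tree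 is a uniquely big-arcwise connected topological space, and a real tree is a big tree all of whose big arcs are arcs. An $\mathbb{R}$-tree is a metrizable real tree. That $d$ preserves the pretree structure means that the arcs of $(T,d)$ joining two points are the pretree intervals between them. ''Canonical'' is meant in the sense that any homeomorphism of $X$ induces a homeomorphism of $T$; here a homeomorphism $\phi$ of $X$ induces a pretree isomorphism of $\mathcal{P}$, and $\hat\phi$ is an extension of it to $T$. *)

(* Defs.v *)
From HB Require Import structures.
From mathcomp Require Import all_boot all_order all_algebra.
From mathcomp Require Import all_classical all_reals all_analysis.

Set Implicit Arguments.
Unset Strict Implicit.
Unset Printing Implicit Defensive.

Import Order.TTheory GRing.Theory Num.Theory.
Import numFieldNormedType.Exports.

Local Open Scope classical_set_scope.
Local Open Scope ring_scope.

Definition continuum (R : realType) (X : metricType R) : Prop :=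
  compact [set: X] /\ connected [set: X].

Definition homeomorphism (S S' : topologicalType) (f : S -> S') : Prop :=
  continuous f /\
  exists g : S' -> S, [/\ cancel f g, cancel g f & continuous g].

Section CutPoints.
Variable X : topologicalType.

Definition rel_open (D U : set X) : Prop :=
  exists2 W : set X, open W & U = W `&` D.

Definition separates (C A B : set X) : Prop :=
  exists U V : set X,
    [/\ rel_open (~` C) U /\ rel_open (~` C) V,
        U `&` V = set0, U `|` V = ~` C, A `<=` U & B `<=` V].

Definition cut_point (c : X) : Prop :=
  exists a b : X, separates [set c] [set a] [set b].

Definition pt_oo (a b : X) : set X :=
  [set c | cut_point c /\ separates [set c] [set a] [set b]].

(* The convention [a,a) = (a,a] = set0 is the reason for the a <> b. *)
Definition pt_co (a b : X) : set X :=
  [set c | a <> b /\ (c = a \/ pt_oo a b c)].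

Definition pt_oc (a b : X) : set X :=
  [set c | a <> b /\ (c = b \/ pt_oo a b c)].

Definition cp_equiv (a b : X) : Prop :=
  a = b \/ [/\ ~ cut_point a, ~ cut_point b & pt_oo a b = set0].

Definition cp_class_set : set (set X) :=
  [set cp_equiv a | a in [set: X]].

Definition cp_class : choiceType := set_type cp_class_set.

Definition pts (x : cp_class) : set X := val x.

(* [P_oo x y z]: z lies in (x,y).  The class of a cut point c is [set c]. *)
Definition P_oo (x y : cp_class) : set cp_class :=
  [set z | exists a b c : X, [/\ pts x a, pts y b, pts z c &
     (cut_point c /\ pt_oo a b c) \/
     [/\ ~ cut_point c, z <> x, z <> y & pt_co a c `&` pt_oc c b = set0]]].

Definition P_cc (x y : cp_class) : set cp_class :=
  P_oo x y `|` [set x; y].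

Definition adjacent (x y : cp_class) : Prop :=
  x <> y /\ P_oo x y = set0.

(* Unordered adjacent pairs, so that I_{x,y} and I_{y,x} are the same. *)
Definition edge_set : set (set cp_class) :=
  [set E | exists xy : cp_class * cp_class,
     adjacent xy.1 xy.2 /\ E = [set xy.1; xy.2]].

Definition edge : choiceType := set_type edge_set.

Lemma edge_endsP (E : edge) : exists xy : cp_class * cp_class,
  adjacent xy.1 xy.2 /\ val E = [set xy.1; xy.2].
Proof. by have := valP E; rewrite inE. Qed.

(* An arbitrary orientation of each edge: the parameter in (0,1) on the copy
   of the interval runs from [edge_src] (at 0) to [edge_tgt] (at 1). *)
Definition edge_src (E : edge) : cp_class := (projT1 (cid (edge_endsP E))).1.
Definition edge_tgt (E : edge) : cp_class := (projT1 (cid (edge_endsP E))).2.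

End CutPoints.

Section CutPointTree.
Variables (R : realType) (X : topologicalType).

Definition cp_tree : choiceType :=
  (cp_class X + edge X * {t : R | 0 < t < 1})%type.

Definition vtx (x : cp_class X) : cp_tree := inl x.

(* The elements of P at which s is attached: s itself if s is in P, the two
   endpoints of the edge if s is inside an edge. *)
Definition ends (s : cp_tree) : set (cp_class X) :=
  match s with
  | inl x => [set x]
  | inr (E, _) => val E
  end.

Definition same_edge (s t : cp_tree) : Prop :=
  match s, t with
  | inr (E, _), inr (F, _) => E = F
  | _, _ => False
  end.

(* Points strictly between s and t on a common edge. *)
Definition edge_oo (s t : cp_tree) : set cp_tree :=
  match s, t with
  | inr (E, a), inr (F, b) =>
      [set inr (E, c) | c in [set c : {t : R | 0 < t < 1} |
         E = F /\ (val a < val c < val b \/ val b < val c < val a)]]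
  | _, _ => set0
  end.

(* Points strictly between s and the end p of s, on the edge of s. *)
Definition edge_to (s : cp_tree) (p : cp_class X) : set cp_tree :=
  match s with
  | inl _ => set0
  | inr (E, a) =>
      [set inr (E, c) | c in [set c : {t : R | 0 < t < 1} |
         (p = edge_src E /\ val c < val a) \/
         (p = edge_tgt E /\ val a < val c)]]
  end.

(* p is the end of s on the side of t, and q the end of t on the side of s:
   the interval [p,q] contains no further end of s or t. *)
Definition facing (s t : cp_tree) (p q : cp_class X) : Prop :=
  ends s `&` P_cc p q = [set p] /\ ends t `&` P_cc p q = [set q].

(* [u,v] in T for u, v in P: the P-interval and the edges with both ends in it *)
Definition P_span (u v : cp_class X) : set cp_tree :=
  [set r | ends r `<=` P_cc u v].

Definition T_oo (s t : cp_tree) : set cp_tree :=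
  [set r | (same_edge s t /\ edge_oo s t r) \/
    (~ same_edge s t /\ exists p q, facing s t p q /\
       [\/ edge_to s p r, edge_to t q r | [/\ P_span p q r, r <> s & r <> t]])].

Definition T_cc (s t : cp_tree) : set cp_tree := T_oo s t `|` [set s; t].

Definition U_basic (s : cp_tree) (A : set cp_tree) : set cp_tree :=
  [set t | T_cc s t `&` A = set0].

Definition U_open (O : set cp_tree) : Prop :=
  forall t, O t -> exists s A,
    [/\ finite_set A, U_basic s A t & U_basic s A `<=` O].

End CutPointTree.

Section Metrics.
Variable R : realType.

Record metric_on (M : choiceType) := MetricOn {
  dist_of :> M -> M -> R ;
  dist_xx : forall x, dist_of x x = 0 ;
  dist_eq0 : forall x y, dist_of x y = 0 -> x = y ;
  dist_sym : forall x y, dist_of x y = dist_of y x ;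
  dist_triangle : forall y x z, dist_of x z <= dist_of x y + dist_of y z
}.

(* Carries the metric d, and through it the topology of d. *)
Definition metrized (M : choiceType) (d : metric_on M) : Type := M.

HB.instance Definition _ (M : choiceType) (d : metric_on M) :=
  Choice.on (metrized d).
HB.instance Definition _ (M : choiceType) (d : metric_on M) :=
  @isMetric.Build R (metrized d) d (dist_xx d) (@dist_eq0 M d) (dist_sym d)
    (dist_triangle d).

Definition curve_length (M : metricType R) (g : R -> M) : \bar R :=
  ereal_sup [set (\sum_(i < size s)
      mdist (g (nth 0 (0 :: s) i)) (g (nth 0 (0 :: s) i.+1)))%:E
    | s in itv_partition 0 1].

Definition path_metric (M : metricType R) : Prop :=
  forall x y : M, (mdist x y)%:E =
    ereal_inf [set curve_length g | g in [set g : R -> M |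
      [/\ {within `[0, 1], continuous g}, g 0 = x & g 1 = y]]].

Definition metrizable (S : topologicalType) : Prop :=
  exists d : metric_on S,
    forall A : set S, open A <-> open (A : set (metrized d)).

End Metrics.

Section RealTrees.
Variable S : topologicalType.

Definition embedding (L : topologicalType) (f : L -> S) : Prop :=
  [/\ injective f, continuous f &
      forall U : set L, open U ->
        exists2 V : set S, open V & f @` U = V `&` range f].

(* A is a big arc from x to y *)
Definition big_arc (x y : S) (A : set S) : Prop :=
  exists (disp : Order.disp_t) (L : orderTopologicalType disp) (f : L -> S)
         (lo hi : L),
    [/\ compact [set: L] /\ connected [set: L],
        lo <> hi /\ (forall l : L, (lo <= l <= hi)%O),
        embedding f, range f = A & f lo = x /\ f hi = y].

Definition is_separable (A : set S) : Prop :=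
  exists D : set S, [/\ countable D, D `<=` A & A `<=` closure D].

Definition is_arc (x y : S) (A : set S) : Prop := big_arc x y A /\ is_separable A.

Definition big_tree : Prop :=
  forall x y : S, x <> y -> exists! A : set S, big_arc x y A.

Definition real_tree : Prop :=
  big_tree /\ forall x y A, big_arc x y A -> is_arc x y A.

Definition R_tree (R : realType) : Prop := metrizable R S /\ real_tree.

End RealTrees.

Section Canonicity.
Variables (R : realType) (X : topologicalType).
Variable d : metric_on R (cp_tree R X).

Definition preserves_pretree : Prop :=
  forall s t : metrized d, s <> t ->
    forall A : set (metrized d), is_arc s t A <-> A = T_cc s t.

(* phiP is the isomorphism of the pretree P induced by phi. *)
Definition induced_pretree_iso (phi : X -> X) (phiP : cp_class X -> cp_class X)
    : Prop :=
  [/\ forall x, pts (phiP x) = phi @` pts x,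
      bijective phiP &
      forall x y z, P_oo (phiP x) (phiP y) (phiP z) <-> P_oo x y z].

Definition induces_homeomorphism (phi : X -> X) : Prop :=
  exists (phiP : cp_class X -> cp_class X) (phiT : metrized d -> metrized d),
    [/\ induced_pretree_iso phi phiP,
        homeomorphism phiT &
        forall x, phiT (vtx R x) = vtx R (phiP x)].

Definition metric_topology_differs : Prop :=
  ~ (forall O : set (metrized d), open O <-> @U_open R X O).

End Canonicity.

(* Main.v *)
Require Import Defs.
From HB Require Import structures.
From mathcomp Require Import all_boot all_order all_algebra.
From mathcomp Require Import finmap all_classical all_reals all_analysis.
From mathcomp Require Import lra.

(** The metric.  Let T be the cut point tree of the continuum X.  A leaf edge
    joins a cut point c to a class z such that c separates z from every other
    class.  A point c may carry uncountably many leaf edges, but only countably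
    many cut points carry one ([countable_leaf_bases]), and the edges that are
    not leaf edges are countably many ([countable_core_edges]); both hold
    because X is second countable.  Apart from the leaf edges, T has a countable
    dense set ([tree_dense_set]), and [urysohn_scale] gives for two points p, q
    of it a function T -> [0, 1] that is monotone along segments, is 0 at p and
    1 at q, and has a dense set of levels each of which is attained at a point
    that separates all lower values from all higher ones.  With Phi_i an
    enumeration of these functions, put
      d(s, t) = sum_i 2^-(i+1) |Phi_i s - Phi_i t|
                + sum_E 2^-n(E) |height_E s - height_E t|,
    where E runs through the leaf edges and n(E) is the index of the cut point at
    the base of E in an enumeration of these points.  Both sums are additive
    along segments.

    Completeness.  That segments of T are isometric to intervals amounts, next
    to additivity, to the absence of gaps in segments ([T_gap]).  This is where
    the topology of X enters: removing a family of caps from X, a cap being an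
    open set with only one boundary point, leaves a connected set
    ([connected_caps]), and if each point that is left is the apex of a
    removed cap then at most one point is left, since the caps at different
    points of the remainder are disjoint and a connected countable set is a point
    ([caps_apex_uniq]).  This shows that no two cut points are adjacent
    ([cut_nonadjacent]) and that a partition of a chain of cut points into a
    lower part without last element and an upper part without first element is
    always realised by some class ([cut_gap]).

    Tree topology.  Any metric that is additive along segments and takes all
    intermediate values there makes T a real tree whose arcs are the segments
    ([tree_path_metric], [tree_is_arc], [tree_R_tree]).

    Canonicity.  The balls of d have a description without d: near s, the point
    t is close to s as soon as [s, t] avoids a certain finite set and t is not
    high on a leaf edge based at s.  A homeomorphism of X induces an automorphism
    of the betweenness on T that permutes the leaf edges and preserves heights
    (edges being mapped affinely), so it is continuous for d
    ([tree_map_continuous]).  The equal length of all leaf edges at one point is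
    what makes this work.

    Comparison with the basis U(s, A).  In the fan over an uncountable compact
    set of irrational slopes, the apex has uncountably many branches.  For any
    metric whatsoever, infinitely many branch tips stay at a positive distance
    from the apex, while a set U(s, A) around the apex contains all but finitely
    many of them ([fan_metric_topology]). *)

Set Implicit Arguments.
Unset Strict Implicit.
Unset Printing Implicit Defensive.

Import Order.TTheory GRing.Theory Num.Theory.
Import numFieldNormedType.Exports.

Local Open Scope classical_set_scope.
Local Open Scope ring_scope.

(** * Caps: open sets with one boundary point *)
Lemma compact_subcover (T : topologicalType) (A : set T) :
  compact A -> cover_compact A.
Proof.
move=> cA; have [[x _]|A0] := pselect (A !=set0); last first.
  move=> I D f _ _; exists fset0 => // y Ay.
  by exfalso; apply: A0; exists y.
pose Y : ptopologicalType := HB.pack T (isPointed.Build T x).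
by have : @compact Y A by []; rewrite compact_cover.
Qed.

Lemma continuum_basis (R : realType) (X : metricType R) :
  compact [set: X] -> exists B : nat -> set X, forall (x : X) (U : set X),
    open U -> U x -> exists n, [/\ open (B n), B n x & B n `<=` U].
Proof.
move=> cX; have [[x _]|X0] := pselect ([set: X] !=set0); last first.
  by exists (fun=> set0) => x; exfalso; apply: X0; exists x.
pose Y : pseudoPMetricType R := HB.pack X (isPointed.Build X x).
have [F cF [oF bF]] : @second_countable X.
  exact: (@compact_second_countable R Y cX).
have /pfcard_geP[F0|[g]] : (F #<= [set: nat])%card by [].
  have [V [+ _] _] := bF x setT filterT.
  by rewrite F0.
exists g => y U oU Uy; have [V [FV Vy] VU] := bF y U (open_nbhs_nbhs (conj oU Uy)).
have [n _ gn] := 'surj_g FV; exists n; rewrite gn; split => //; exact: oF.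
Qed.

Section Caps.
Variable X : topologicalType.

(** A cap with apex c is one side of a separation of X by c.  Working with one
    side at a time turns statements about separation into statements about
    connected sets. *)
Definition cap (c : X) (V : set X) : Prop :=
  [/\ open V, ~ V c & closed (V `|` [set c])].

Definition sep (c a b : X) : Prop :=
  exists V, [/\ cap c V, V a, ~ V b & b <> c].

Definition cutp (z : X) := exists a b, sep z a b.

(** For z that is not a cut point: no cut point lies in both half-open
    intervals (z, a] and (z, b]. *)
Definition pt_between (a b z : X) := sep z a b \/
  (~ cutp z /\ forall g, g = a \/ sep g z a -> g = b \/ sep g z b -> False).

Definition avoid (V : set X) a b := ~ V a /\ ~ V b.

Lemma capC c V : cap c V -> cap c (~` (V `|` [set c])).
Proof.
case=> oV Vc cV; split; first by rewrite openC.
  by apply; right.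
suff -> : ~` (V `|` [set c]) `|` [set c] = ~` V by rewrite closedC.
apply/seteqP; split=> x /=; first by case=> [/not_orP[]|-> //].
by move=> nV; have [->|xc] := pselect (x = c); [right|left; apply/not_orP].
Qed.

Lemma capI c V W : cap c V -> cap c W -> cap c (V `&` W).
Proof.
move=> [oV Vc cV] [oW Wc cW]; split; first exact: openI.
  by case.
by rewrite setUIl; exact: closedI.
Qed.

Lemma sep_neql c a b : sep c a b -> a <> c.
Proof. by move=> [V [[_ Vc _] Va _ _]] ac; apply: Vc; rewrite -ac. Qed.

Lemma sep_neqr c a b : sep c a b -> b <> c.
Proof. by case=> V []. Qed.

Lemma sepC c a b : sep c a b -> sep c b a.
Proof.
move=> [V [cV Va Vb bc]]; exists (~` (V `|` [set c])); split.
- exact: capC.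
- by move=> [].
- by move=> /not_orP[].
- by move=> ac; case: cV => _ + _; rewrite -ac.
Qed.

Lemma sep_neq c a b : sep c a b -> a <> b.
Proof. by move=> [V [_ Va Vb _]] ab; apply: Vb; rewrite -ab. Qed.

(** The point x lies in the cap of a or outside it. *)
Lemma sep_or c a b x : sep c a b -> x <> c -> sep c a x \/ sep c x b.
Proof.
move=> [V [cV Va Vb bc]] xc; have [Vx|Vx] := pselect (V x).
  by right; exists V.
by left; exists V.
Qed.

Lemma open_sepr c a : open [set x | sep c a x].
Proof.
have -> : [set x | sep c a x] =
    \bigcup_(V in [set V | cap c V /\ V a]) (~` (V `|` [set c])).
  apply/seteqP; split=> x /=.
    by move=> [V [cV Va Vx xc]]; exists V => //; apply/not_orP.
  by move=> [V [cV Va]] /not_orP[Vx xc]; exists V.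
by apply: bigcup_open => V [[_ _ cV] _]; rewrite openC.
Qed.

Lemma open_sepl c a : open [set x | sep c x a].
Proof.
have -> : [set x | sep c x a] = [set x | sep c a x].
  by apply/seteqP; split=> x; exact: sepC.
exact: open_sepr.
Qed.

Lemma connected_clopen (K O : set X) (C : set X) x : connected K -> open O ->
  closed C -> K `&` O = K `&` C -> K x -> O x -> K `<=` O.
Proof.
move=> cK oO cC OC Kx Ox y Ky.
have KOK : K `&` O = K.
  by apply: cK; [exists x | exists O | exists C].
by have [] : (K `&` O) y by rewrite KOK.
Qed.

Lemma connected_sub_cap (K : set X) e V x : connected K -> ~ K e -> cap e V ->
  K x -> V x -> K `<=` V.
Proof.
move=> cK Ke [oV Ve cV] Kx Vx.
apply: (connected_clopen cK oV cV _ Kx Vx).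
apply/seteqP; split=> y /= [Ky]; first by split => //; left.
by move=> [Vy //|ye]; exfalso; apply: Ke; rewrite -ye.
Qed.

(** A clopen part of Y minus V that contains the apex becomes clopen in Y when
    the part of Y in V is added; one that does not contain the apex is already
    clopen in Y. *)
Lemma connected_setD_cap (Y : set X) e V : connected Y -> cap e V ->
  connected (Y `\` V).
Proof.
move=> cY ceV; have [oV Ve cV] := ceV.
have [Ye|Ye] := pselect (Y e); last first.
  have [[x [Yx Vx]]|YV] := pselect (exists x, Y x /\ V x).
    suff -> : Y `\` V = set0 by exact: connected0.
    have YV := connected_sub_cap cY Ye ceV Yx Vx.
    by apply/seteqP; split=> y // -[/YV].
  suff -> : Y `\` V = Y by [].
  apply/seteqP; split=> y; first by case.
  by move=> Yy; split => // Vy; apply: YV; exists y.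
move=> B [b Bb] [C oC BC] [D cD BD].
have [Be|Be] := pselect (B e).
  have YB : B `|` (Y `&` V) = Y.
    apply: cY; first by exists b; left.
      exists (C `|` V); first exact: openU.
      rewrite BC; apply/seteqP; split=> x /=.
        by move=> [[[Yx _] Cx]|[Yx Vx]]; (split; first by []); [left|right].
      move=> [Yx [Cx|Vx]]; last by right.
      by have [Vx|Vx] := pselect (V x); [right|left].
    exists (D `|` (V `|` [set e])); first exact: closedU.
    apply/seteqP; split=> x /=.
      rewrite BD => -[[[Yx _] Dx]|[Yx Vx]]; first by (split; first by []); left.
      by split => //; right; left.
    move=> [Yx [Dx|[Vx|->]]]; [|by right|by left].
    by have [Vx|Vx] := pselect (V x); [right|left; rewrite BD].
  apply/seteqP; split=> x; first by rewrite BC => -[].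
  move=> [Yx Vx]; have : (B `|` Y `&` V) x by rewrite YB.
  by case=> // -[].
exfalso; suff YB : B = Y by apply: Be; rewrite YB.
apply: cY; first by exists b.
  exists (C `&` ~` (V `|` [set e])).
    by apply: openI => //; rewrite openC.
  apply/seteqP; split=> x /=.
    move=> Bx; have := Bx; rewrite {1}BC => -[[Yx Vx] Cx].
    split => //; split => //; case=> // xe; apply: Be; rewrite -xe; exact: Bx.
  by move=> [Yx [Cx /not_orP[Vx xe]]]; rewrite BC.
exists (D `&` ~` V).
  by apply: closedI => //; rewrite closedC.
apply/seteqP; split=> x /=; first by rewrite BD => -[[]].
by move=> [Yx [Dx Vx]]; rewrite BD.
Qed.

Hypothesis cX : connected [set: X].

Lemma connected_cap c V : cap c V -> connected (V `|` [set c]).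
Proof.
move=> cV; have := connected_setD_cap cX (capC cV).
by rewrite setTD setCK.
Qed.

Lemma connected_capC c V : cap c V -> connected (~` V).
Proof. by move=> cV; have := connected_setD_cap cX cV; rewrite setTD. Qed.

(** If c separates a from b then a and its side of c form a connected set that
    misses b, so b cannot separate a from c. *)
Lemma sep_anti c a b : sep c a b -> sep b a c -> False.
Proof.
move=> [V [cV Va Vb bc]] [W [cW Wa Wc _]].
apply: Wc; apply: (connected_sub_cap (connected_cap cV) _ cW _ Wa).
- by move=> -[].
- by left.
- by right.
Qed.

(** The cut points that separate a from b are linearly ordered from a to b. *)
Lemma sep_total c e a b : sep c a b -> sep e a b -> c = e \/ sep c a e \/ sep e a c.
Proof.
move=> cab eab; have [->|ce] := pselect (c = e); first by left.
right; have [//|ceb] := sep_or cab (fun ec => ce (esym ec)); first by left.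
have [//|ecb] := sep_or eab ce; first by right.
by case: (sep_anti (sepC ceb) (sepC ecb)).
Qed.

Hypothesis compactX : compact [set: X].
Hypothesis hX : hausdorff_space X.
Variable R : realType.

(** For finitely many caps this is [connected_setD_cap].  In general, separate
    the remainder by two disjoint open sets of the normal space X; the compact
    set outside them is covered by finitely many of the caps, and the complement
    of these is connected and lies in the two open sets. *)
Lemma connected_caps (F : set (set X)) :
  (forall V, F V -> exists c, cap c V) -> connected (~` \bigcup_(V in F) V).
Proof.
move=> Fcap; set K := ~` _.
have cK : closed K.
  by rewrite closedC; apply: bigcup_open => V /Fcap[c []].
have fin (s : seq (set X)) : (forall V, V \in s -> F V) ->
    connected (~` \bigcup_(V in [set` s]) V).
  elim: s => [|V s IH] Fs.
    suff -> : ~` (\bigcup_(V in [set` Nil (set X)]) V) = setT by [].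
    by apply/seteqP; split=> x // _ [V].
  have [|c cV] := Fcap V; first by apply: Fs; rewrite mem_head.
  have /IH/connected_setD_cap/(_ cV) : forall V, V \in s -> F V.
    by move=> W Ws; apply: Fs; rewrite inE Ws orbT.
  congr connected; apply/seteqP; split=> x /=.
    move=> [nx Vx] [W /=]; rewrite inE => /orP[/eqP -> //|Ws Wx].
    by apply: nx; exists W.
  move=> nx; split; last first.
    by move=> Vx; apply: nx; exists V => //=; rewrite mem_head.
  by move=> [W /= Ws Wx]; apply: nx; exists W => //=; rewrite inE Ws orbT.
move=> B [b Bb] [C oC BC] [D cD BD].
have cB : closed B by rewrite BD; exact: closedI.
have cB' : closed (K `\` B).
  have -> : K `\` B = K `&` ~` C.
    rewrite BC; apply/seteqP; split=> x /= [Kx].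
      by move=> nx; split => // Cx; apply: nx.
    by move=> Cx; split => // -[].
  by apply: closedI => //; rewrite closedC.
apply/seteqP; split=> x; first by rewrite BC => -[].
move=> Kx; apply: contrapT => Bx.
have normX := compact_normal hX compactX.
have [U1 [U2 [oU1 oU2 BU1 KU2 U12]]] : exists U1 U2 : set X,
   [/\ open U1, open U2, B `<=` U1, K `\` B `<=` U2 & U1 `&` U2 = set0].
  have /(@normal_openP R) := normX.
  move=> /(_ _ _ cB cB') [|U1 [U2 [? ? ? ? ?]]].
    by apply/seteqP; split=> y // -[By] [].
  by exists U1, U2.
have cZ : compact (~` (U1 `|` U2)).
  apply: (subclosed_compact _ compactX) => //.
  by rewrite closedC; exact: openU.
have [||s sF Zs] := compact_subcover cZ (I := set X) (D := F) (f := id).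
- by move=> V /Fcap[c []].
- move=> y /not_orP[yO1 yO2]; apply: contrapT => nF.
  have Ky : K y by [].
  have [By|By] := pselect (B y); first by apply: yO1; exact: BU1.
  by apply: yO2; exact: KU2.
have cL : connected (~` \bigcup_(V in [set` s]) V).
  by apply: (fin s) => V /sF; rewrite inE.
set L := ~` _ in cL.
have KL : K `<=` L.
  move=> y Ky [V /= Vs Vy]; apply: Ky; exists V => //.
  by have := sF V Vs; rewrite inE.
have LO y : L y -> U1 y \/ U2 y.
  move=> Ly; apply: contrapT => /not_orP[y1 y2]; apply: Ly.
  by have [|V Vs Vy] := Zs y; [apply/not_orP | exists V].
have LO1 : L `<=` U1.
  apply: (connected_clopen cL oU1 (open_closedC oU2) _ (KL _ _) (BU1 _ Bb)).
    apply/seteqP; split=> y /= [Ly].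
      move=> y1; split => // y2.
      by have : (U1 `&` U2) y by []; rewrite U12.
    by move=> y2; split => //; case: (LO _ Ly).
  by move: Bb; rewrite BC => -[].
have : (U1 `&` U2) x; last by rewrite U12.
by split; [exact/LO1/KL|exact: KU2].
Qed.

End Caps.

(** * Segments of a tree as a ternary relation *)
(** cc s t u says that u lies in the closed segment [s, t].  The pretree of X
    and the tree T are both used through these axioms only; [bt_tri] is the
    axiom that makes every triangle a tripod. *)
Record betweenness (T : Type) (cc : T -> T -> T -> Prop) : Prop := Betweenness {
  bt_l : forall s t, cc s t s ;
  bt_sym : forall s t u, cc s t u -> cc t s u ;
  bt_xx : forall s u, cc s s u -> u = s ;
  bt_tri : forall s t u v, cc s t u -> cc s v u \/ cc v t u ;
  bt_anti : forall s t u, cc s t u -> cc s u t -> u = t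
}.

Section Betweenness.
Variables (T : Type) (cc : T -> T -> T -> Prop).
Hypothesis bt : betweenness cc.
Implicit Types s t u v w : T.

Lemma bt_r s t : cc s t t.
Proof. exact/(bt_sym bt)/(bt_l bt). Qed.

(** Two segments that start at u, towards s and towards t, have only u in
    common when u lies between s and t. *)
Lemma bt_meet s t u x : cc s t u -> cc s u x -> cc u t x -> x = u.
Proof.
move=> stu sux utx; have [sxu|xtu] := bt_tri bt x stu.
  exact: (bt_anti bt sux).
by apply: (bt_anti bt (s := t)); apply: (bt_sym bt).
Qed.

Lemma bt_trans s t u v : cc s t u -> cc s u v -> cc s t v.
Proof.
move=> stu suv; have [//|tuv] := bt_tri bt t suv.
by rewrite (bt_meet stu suv (bt_sym bt tuv)).
Qed.

Lemma bt_order s t u v : cc s t u -> cc s u v -> cc v t u.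
Proof.
move=> stu suv; have [svu|//] := bt_tri bt v stu.
by rewrite (bt_anti bt svu suv); exact: (bt_l bt).
Qed.

Lemma bt_total s t u v : cc s t u -> cc s t v -> cc s u v \/ cc s v u.
Proof.
move=> stu stv; have [svu|vtu] := bt_tri bt v stu; first by right.
have [suv|utv] := bt_tri bt u stv; first by left.
left; suff -> : u = v by exact: bt_r.
by apply: (bt_anti bt (s := t)); apply: (bt_sym bt).
Qed.

Lemma bt_sub s t u v w : cc s t u -> cc s t v -> cc u v w -> cc s t w.
Proof.
move=> stu stv uvw; have [suv|svu] := bt_total stu stv.
  by apply: (bt_trans stu); apply: (bt_sym bt); apply: bt_trans (bt_sym bt suv) uvw.
apply: (bt_trans stv); apply: (bt_sym bt).
by apply: bt_trans (bt_sym bt svu) (bt_sym bt uvw).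
Qed.

End Betweenness.

(** * Cut points of a continuum leave no gaps *)
Section ContinuumCaps.
Variables (R : realType) (X : metricType R).
Hypothesis contX : continuum X.

Let compactX : compact [set: X] := contX.1.
Let cX : connected [set: X] := contX.2.
Let hX : hausdorff_space X := @metric_hausdorff R X.

Lemma closed_pt (c : X) : closed [set c].
Proof. exact: accessible_closed_set1 (hausdorff_accessible hX) c. Qed.

Lemma separates_sep (c a b : X) :
  separates [set c] [set a] [set b] <-> sep c a b.
Proof.
have oc : open (~` [set c]) by rewrite openC; exact: closed_pt.
split.
  move=> [U [V [[[U' oU' UU'] [V' oV' VV']] UV0 UVc aU bV]]].
  have Ua : U a by exact: aU.
  have Vb : V b by exact: bV.
  have UVx x : U x -> V x -> False.
    by move=> Ux Vx; have : (U `&` V) x by []; rewrite UV0.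
  have Uc x : U x \/ V x -> x <> c by move=> h; have : (~` [set c]) x by rewrite -UVc.
  have cU x : x <> c -> U x \/ V x by move=> h; have : (~` [set c]) x by []; rewrite -UVc.
  exists U; split => //.
  - split; first by rewrite UU'; exact: openI.
      by move=> Uc0; apply: (Uc c) => //; left.
    suff -> : U `|` [set c] = ~` V.
      by rewrite closedC VV'; exact: openI.
    apply/seteqP; split=> x /=.
      move=> [Ux Vx|->{x} Vc]; first exact: UVx Ux Vx.
      by apply: (Uc c) => //; right.
    move=> Vx; have [->|xc] := pselect (x = c); first by right.
    by left; have [] := cU _ xc.
  - by move=> Ub; exact: UVx Ub Vb.
  - by apply: Uc; right.
move=> [V [[oV Vc cV] Va Vb bc]].
exists V, (~` (V `|` [set c])); split.
- split.
    exists V => //; apply/seteqP; split=> x /=; last by case.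
    by move=> Vx; split => // xc; apply: Vc; rewrite -xc.
  exists (~` (V `|` [set c])); first by rewrite openC.
  apply/seteqP; split=> x /=; last by case.
  by move=> Vx; split => // xc; apply: Vx; right.
- by apply/seteqP; split=> x //= [Vx]; apply; left.
- apply/seteqP; split=> x /=.
    by move=> [Vx xc|/not_orP[]//]; apply: Vc; rewrite -xc.
  by move=> xc; have [Vx|Vx] := pselect (V x); [left|right=> -[]].
- by move=> x ->.
- by move=> x ->; apply/not_orP.
Qed.

Lemma continuous_mdist (x : X) : continuous (mdist x : X -> R).
Proof.
move=> y; apply/cvgrPdist_lt => e e0.
near=> z; have : mdist y z < e.
  near: z; apply/nbhs_ballP; exists e => //= z.
  by rewrite ballEmdist.
apply: le_lt_trans; rewrite ler_norml.
have xz := metric_triangle x y z.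
have xy := metric_triangle x z y.
by rewrite (metric_sym z y) in xy; apply/andP; split; lra.
Unshelve. all: by end_near. Qed.

(** The distances to x form an interval, which is uncountable unless it is a
    point. *)
Lemma connected_countable (K : set X) x y :
  connected K -> countable K -> K x -> K y -> x = y.
Proof.
move=> cK /countable_injP[n nK] Kx Ky; apply: contrapT => /eqP xy.
have d0 : 0 < mdist x y by rewrite mdist_gt0.
have cfK : connected [set mdist x z | z in K].
  apply: connected_continuous_connected => //.
  exact/continuous_subspaceT/continuous_mdist.
have countK : countable [set mdist x z | z in K].
  by apply: card_le_trans (card_image_le _ _) _; apply/countable_injP; exists n.
have sub : `[0, mdist x y]%classic `<=` [set mdist x z | z in K].
  move/connected_intervalP : cfK => iK r /=; rewrite in_itv /= => rI.
  apply: (iK 0 (mdist x y)) => //; last by exists y.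
  by exists x => //; exact: mdistxx.
have := countable_lebesgue_measure0 (sub_countable (subset_card_le sub) countK).
rewrite lebesgue_measure_itv/= lte_fin d0 EFinN sube0 => -[] d00.
by rewrite d00 ltxx in d0.
Qed.

(** Nonempty caps of F with distinct apexes in the remainder are disjoint: if
    they met, one of them with its apex would be a connected set that meets the
    other cap and misses its apex, hence would lie in it.  By second
    countability there are countably many such apexes, so the remainder is
    countable; it is connected by [connected_caps]. *)
Lemma caps_apex_uniq (F : set (set X)) :
  (forall V, F V -> exists c, cap c V) ->
  (forall x, ~ (\bigcup_(V in F) V) x -> exists V, [/\ F V, cap x V & V !=set0]) ->
  forall x y, ~ (\bigcup_(V in F) V) x -> ~ (\bigcup_(V in F) V) y -> x = y.
Proof.
move=> Fcap FK x y Kx Ky.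
have cK := connected_caps cX compactX hX R Fcap.
apply: (connected_countable cK _ Kx Ky).
have [B bB] := continuum_basis compactX.
(* x is encoded by a basic open set inside a cap with apex x *)
pose P x n := exists V, [/\ F V, cap x V & B n !=set0 /\ B n `<=` V].
have exP z : (~` \bigcup_(V in F) V) z -> exists n, P z n.
  move=> /FK[V [FV [oV Vz cV] [v Vv]]].
  have [n [_ Bv BV]] := bB v V oV Vv.
  by exists n, V; split => //; split => //; exists v.
pose n z := if pselect (exists n, P z n) is left h then projT1 (cid h) else 0%N.
have nP z : (~` \bigcup_(V in F) V) z -> P z (n z).
  move=> /exP h; rewrite /n; case: pselect => // h'.
  exact: (projT2 (cid h')).
apply/countable_injP; exists n => u v; rewrite !inE => Ku Kv nuv.
apply: contrapT => uv.
have [V [FV cV [[w Bw] BV]]] := nP _ Ku.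
have [W [FW cW [_ BW]]] := nP _ Kv.
have Vw : V w by exact: BV.
have Ww : W w by apply: BW; rewrite -nuv.
have VW : V `|` [set u] `<=` W.
  apply: (connected_sub_cap (connected_cap cX cV) _ cW _ Ww); last by left.
  move=> [Vv|/= vu]; last by apply: uv; rewrite vu.
  by apply: Kv; exists V.
by apply: Ku; exists W => //; apply: VW; right.
Qed.

(** The complement of the cap V is connected and contains a and b. *)
Lemma avoid_sep (g a b e : X) V : cap g V -> avoid V a b -> sep e a b -> ~ V e.
Proof.
move=> cV [Va Vb] [W [cW Wa Wb _]] Ve; apply: Wb.
apply: (connected_sub_cap (connected_capC cX cV) _ cW _ Wa Vb) => //.
Qed.

Lemma cut_cap (x a b : X) : cutp x -> a <> x -> b <> x -> ~ sep x a b ->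
  exists V, [/\ cap x V, avoid V a b & V !=set0].
Proof.
move=> [u [v [V [cV Vu Vv vx]]]] ax bx xab.
have [Va|Va] := pselect (V a).
  exists (~` (V `|` [set x])); split; first exact: capC.
  - split; first by apply; left.
    by move=> /not_orP[Vb _]; apply: xab; exists V.
  - by exists v; apply/not_orP.
exists V; split => //; last by exists u.
split => // Vb; apply: xab; apply: sepC; by exists V.
Qed.

(** A cut point g in (z, a] and (z, b] would give a cap that contains z and
    misses a and b. *)
Lemma outside_nocut (z a b : X) (F : set (set X)) : a <> b ->
  (forall g V, cap g V -> avoid V a b -> F V) ->
  ~ (\bigcup_(V in F) V) z ->
  forall g, g = a \/ sep g z a -> g = b \/ sep g z b -> False.
Proof.
move=> ab Fab Kz g [->|gza] [gb|gzb] //.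
- have [V [cV Vz Vb _]] := gzb; apply: Kz; exists V => //.
  by apply: (Fab a) => //; split => //; case: cV.
- rewrite gb in gza; have [V [cV Vz Va _]] := gza; apply: Kz; exists V => //.
  by apply: (Fab b) => //; split => //; case: cV.
- have [V [cV Vz Va _]] := gza; have [W [cW Wz Wb _]] := gzb.
  apply: Kz; exists (V `&` W) => //.
  by apply: (Fab g); [exact: capI | split=> -[]].
Qed.

(** Remove from X all caps that miss both a and b.  Unless something lies
    between a and b, every remaining point is the apex of a removed cap, and
    [caps_apex_uniq] gives a = b. *)
Lemma cut_nonadjacent (a b : X) : a <> b -> cutp a -> cutp b ->
  exists z, pt_between a b z /\ z <> a /\ z <> b.
Proof.
move=> ab cuta cutb; apply: contrapT => nz.
pose F := [set V | (exists g, cap g V) /\ avoid V a b].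
have Fcap V : F V -> exists c, cap c V by case.
have Ka : ~ (\bigcup_(V in F) V) a by move=> [V [_ [? ?]]].
have Kb : ~ (\bigcup_(V in F) V) b by move=> [V [_ [? ?]]].
apply: (ab); apply: (caps_apex_uniq Fcap _ Ka Kb) => x Kx.
have [->|xa] := pselect (x = a).
  have [u [v [V [cV Vu Vv va]]]] := cuta.
  have [Vb|Vb] := pselect (V b).
    exists (~` (V `|` [set a])); split.
    - split; first by exists a; exact: capC.
      by split; apply; [right|left].
    - exact: capC.
    - by exists v; apply/not_orP.
  exists V; split => //; last by exists u.
  by split; [exists a|split=> //; case: cV].
have [->|xb] := pselect (x = b).
  have [u [v [V [cV Vu Vv va]]]] := cutb.
  have [Va|Va] := pselect (V a).
    exists (~` (V `|` [set b])); split.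
    - split; first by exists b; exact: capC.
      by split; apply; [left|right].
    - exact: capC.
    - by exists v; apply/not_orP.
  exists V; split => //; last by exists u.
  by split; [exists b|split=> //; case: cV].
have [cx|ncx] := pselect (cutp x); last first.
  exfalso; apply: nz; exists x; split; last by split.
  right; split => //; apply: outside_nocut Kx => //.
  by move=> g V cV; split => //; exists g.
have [xab|xab] := pselect (sep x a b).
  by exfalso; apply: nz; exists x; split; [left|split].
have [||V [cV aV V0]] := cut_cap cx _ _ xab; [exact: nesym|exact: nesym|].
by exists V; split => //; split => //; exists x.
Qed.

(** L and U are chains of cut points facing each other, L increasing towards U
    without last element, U decreasing towards L without first element.  The
    relation lt e e' puts e' between e and U, and gt f f' puts f' between f and
    L. *)
Section Gap.
Variables (L U : set X).
Let lt e e' := forall f, U f -> sep e' e f.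
Let gt f f' := forall e, L e -> sep f' e f.
Hypothesis L_nomax : forall e, L e -> exists2 e', L e' & lt e e'.
Hypothesis U_nomin : forall f, U f -> exists2 f', U f' & gt f f'.
Hypothesis L_total : forall e e', L e -> L e' -> e = e' \/ lt e' e \/ lt e e'.
Hypothesis U_total : forall f f', U f -> U f' -> f = f' \/ gt f' f \/ gt f f'.
Variables e0 f0 : X.
Hypotheses (Le0 : L e0) (Uf0 : U f0).

Let F := [set V | (exists g, cap g V) /\ exists e f, [/\ L e, U f & avoid V e f]].
Let Kc := \bigcup_(V in F) V.

Let Fcap V : F V -> exists c, cap c V. Proof. by case. Qed.

(** Finitely many removed caps miss a common pair e in L, f in U, because L
    and U are chains; compactness does the rest. *)
Let K_nonempty : exists x, ~ Kc x.
Proof.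
apply: contrapT => /forallNP nK.
have fin (s : seq (set X)) : (forall V, V \in s -> F V) ->
    exists e f, [/\ L e, U f & forall V, V \in s -> avoid V e f].
  elim: s => [|V s IH] Fs; first by exists e0, f0.
  have [|[g cV] [e [f [Le Uf aV]]]] := Fs V; first by rewrite mem_head.
  have [|e1 [f1 [Le1 Uf1 a1]]] := IH.
    by move=> W Ws; apply: Fs; rewrite inE Ws orbT.
  have [e2 [Le2 H2]] : exists e2, L e2 /\ (e2 = e \/ lt e e2) /\ (e2 = e1 \/ lt e1 e2) .
    have [ee|[ee|ee]] := L_total Le Le1.
    - by exists e; split => //; split; left.
    - by exists e; split => //; split; [left|right].
    - by exists e1; split => //; split; [right|left].
  have [f2 [Uf2 G2]] : exists f2, U f2 /\ (f2 = f \/ gt f f2) /\ (f2 = f1 \/ gt f1 f2) .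
    have [ff|[ff|ff]] := U_total Uf Uf1.
    - by exists f; split => //; split; left.
    - by exists f; split => //; split; [left|right].
    - by exists f1; split => //; split; [right|left].
  have mono W c e' f' : cap c W -> L e' -> U f' -> avoid W e' f' ->
      e2 = e' \/ lt e' e2 -> f2 = f' \/ gt f' f2 -> avoid W e2 f2.
    move=> cW Le' Uf' aW He Hf.
    have We2 : ~ W e2.
      case: He => [-> //|/(_ _ Uf') He]; first by case: aW.
      exact: avoid_sep cW aW He.
    split => //; case: Hf => [-> //|/(_ _ Le2) Hf]; first by case: aW.
    by apply: avoid_sep cW _ Hf; split => //; case: aW.
  exists e2, f2; split => // W; rewrite inE => /orP[/eqP ->|Ws].
    by case: H2 => ? _; case: G2 => ? _; exact: mono cV Le Uf aV _ _.
  have [|[c cW] _] := Fs W; first by rewrite inE Ws orbT.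
  by case: H2 => _ ?; case: G2 => _ ?; exact: mono cW Le1 Uf1 (a1 _ Ws) _ _.
have [V /Fcap[c []] //||s sF sX] :=
    compact_subcover compactX (I := set X) (D := F) (f := id).
  by move=> x _; apply: contrapT => /nK.
have [|e [f [Le Uf aV]]] := fin s; first by move=> V /sF; rewrite inE.
by have [//|V /= Vs Ve] := sX e; have [] := aV V Vs.
Qed.

Let K1 z e f : ~ Kc z -> L e -> U f -> ~ sep e z f.
Proof.
move=> Kz Le Uf [V [cV Vz Vf _]]; apply: Kz; exists V => //.
by split; [exists e | exists e, f; split=> //; split=> //; case: cV].
Qed.

Let K1' z e f : ~ Kc z -> L e -> U f -> ~ sep f z e.
Proof.
move=> Kz Le Uf [V [cV Vz Ve _]]; apply: Kz; exists V => //.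
by split; [exists f | exists e, f; split=> //; split=> //; case: cV].
Qed.

Let K2 z e : ~ Kc z -> L e -> z <> e.
Proof.
move=> Kz Le ze; have [e' Le' /(_ f0 Uf0)] := L_nomax Le.
by rewrite -ze; exact: K1.
Qed.

Let K2' z f : ~ Kc z -> U f -> z <> f.
Proof.
move=> Kz Uf zf; have [f' Uf' /(_ e0 Le0)/sepC] := U_nomin Uf.
by rewrite -zf; exact: K1'.
Qed.

Let lt_asym e e' f : U f -> lt e e' -> ~ sep e e' f.
Proof. by move=> Uf /(_ _ Uf)/sepC H1 /sepC H2; exact: (sep_anti cX H1 H2). Qed.

Let U_nosep e f f' : L e -> U f -> U f' -> ~ sep e f f'.
Proof.
move=> Le Uf Uf' eff'; have [ff'|[H|H]] := U_total Uf Uf'.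
- exact: (sep_neq eff').
- exact: (sep_anti cX (sepC eff') (sepC (H _ Le))).
- exact: (sep_anti cX eff' (sepC (H _ Le))).
Qed.

(** A remaining point is separated from the points of U by no point of L and
    from the points of L by no point of U.  So if it separates one pair it
    separates all pairs. *)
Let K_all z : ~ Kc z -> sep z e0 f0 -> forall e f, L e -> U f -> sep z e f.
Proof.
move=> Kz z0; have z1 e : L e -> sep z e f0.
  move=> Le; have [|zee|//] := sep_or z0 (x := e).
    by move=> ez; exact: (K2 Kz Le).
  exfalso; have [ee|[H|H]] := L_total Le0 Le.
  - exact: (sep_neq zee ee).
  - have [|H1|H1] := sep_or (H _ Uf0) (x := z); first exact: K2.
      exact: (sep_anti cX (sepC zee) H1).
    exact: K1 H1.
  - have [|H1|H1] := sep_or (H _ Uf0) (x := z); first exact: K2.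
      exact: (sep_anti cX zee H1).
    exact: K1 H1.
move=> e f Le Uf; have [|//|zff] := sep_or (z1 e Le) (x := f).
  by move=> fz; exact: (K2' Kz Uf).
exfalso; have [ff|[H|H]] := U_total Uf0 Uf.
- exact: (sep_neq zff (esym ff)).
- have [|H1|H1] := sep_or (H _ Le) (x := z); first exact: K2'.
    exact: K1' (sepC H1).
  exact: (sep_anti cX zff (sepC H1)).
- have [|H1|H1] := sep_or (H _ Le) (x := z); first exact: K2'.
    exact: K1' (sepC H1).
  exact: (sep_anti cX (sepC zff) (sepC H1)).
Qed.

Let sep_lt e e' w f : U f -> lt e e' -> sep e w f -> sep e' w f.
Proof.
move=> Uf ee' ewf; have [we|we] := pselect (w = e').
  by subst w; case: (lt_asym Uf ee').
have [H1|//] := sep_or (ee' _ Uf) we; exfalso.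
have e'e : e' <> e by exact: nesym (sep_neql (ee' _ Uf)).
have [H2|H2] := sep_or ewf e'e; last exact: lt_asym H2.
exact: (sep_anti cX H2 (sepC H1)).
Qed.

Let W := \bigcup_(ef in [set ef : X * X | L ef.1 /\ U ef.2])
   [set y | sep ef.1 y ef.2].

(** W consists of the points that some e in L cuts off from U.  If x is the
    only remaining point then a point y outside W and different from x has a
    removed cap V as a neighbourhood, and V misses W: a point of V in W would
    make V a part of the side of some m in L that faces away from U. *)
Let W_cap x : ~ Kc x -> (forall y, ~ Kc y -> y = x) -> cap x W.
Proof.
move=> Kx Kun; split.
- by apply: bigcup_open => -[e f] /= _; exact: open_sepl.
- by move=> [[e f] /= [Le Uf]]; exact: K1.
rewrite -openC openE => y /= /not_orP[Wy yx].
have /contrapT[V FV Vy] : ~ ~ Kc y by move=> /Kun.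
have [[g cV] [e [f [Le Uf aV]]]] := FV.
apply: filterS (open_nbhs_nbhs (conj _ Vy)); last by case: cV.
move=> w Vw [[[e' f'] /= [Le' Uf'] Hw]|wx]; last first.
  by apply: Kx; exists V => //; rewrite -wx.
apply: Wy.
have {Hw}Hw : sep e' w f.
  have [|//|H] := sep_or Hw (x := f); last by case: (U_nosep Le' Uf Uf').
  move=> fe'; have [e2 Le2 H2] := L_nomax Le'.
  by apply: (sep_neq (H2 _ Uf)); rewrite fe'.
have [m [Lm am Hm]] : exists m, [/\ L m, avoid V m f & sep m w f].
  have [ee|[H|H]] := L_total Le Le'.
  - by exists e; split => //; rewrite ee.
  - by exists e; split => //; exact: sep_lt H Hw.
  - exists e'; split => //; split; last by case: aV.
    exact: avoid_sep cV aV (H _ Uf).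
have [m1 [Lm1 am1 Hm1 gm1]] :
    exists m, [/\ L m, avoid V m f, sep m w f & m <> g].
  have [mg|mg] := pselect (m = g); last by exists m.
  have [m' Lm' mm'] := L_nomax Lm.
  exists m'; split => //; last 1 first.
  - move=> m'g; apply: (sep_neql (mm' _ Uf)); by rewrite m'g.
  - split; last by case: am.
    exact: avoid_sep cV am (mm' _ Uf).
  - exact: sep_lt mm' Hm.
exists (m1, f) => //=; have [Z [cZ Zw Zf fm]] := Hm1; exists Z; split => //.
apply: (connected_sub_cap (connected_cap cX cV) _ cZ _ Zw).
- by case=> [|/= mg]; [case: am1|exact: gm1].
- by left.
- by left.
Qed.

(** Remove all caps that miss a point of L and a point of U.  A remaining
    point that is not a cut point, or that separates e0 from f0, lies between L
    and U.  If there is none, every remaining point is a cut point with both e0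
    and f0 on one side, hence the apex of a removed cap, and only one point x
    remains; then W is a cap at x, and x separates e0 from f0 after all. *)
Lemma cut_gap : exists z, forall e f, L e -> U f -> pt_between e f z /\ z <> e /\ z <> f.
Proof.
have neq e f : L e -> U f -> e <> f.
  by move=> Le Uf; have [e2 Le2 H2] := L_nomax Le; exact: (sep_neq (H2 _ Uf)).
have [[z [Kz ncz]]|allcut] := pselect (exists z, ~ Kc z /\ ~ cutp z).
  exists z => e f Le Uf; split; last by split; [exact: K2|exact: K2'].
  right; split => //; apply: outside_nocut Kz; first exact: neq.
  by move=> g V cV aV; split; [exists g|exists e, f].
have [[z [Kz z0]]|nsep] := pselect (exists z, ~ Kc z /\ sep z e0 f0).
  exists z => e f Le Uf; split; last by split; [exact: K2|exact: K2'].
  by left; exact: K_all.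
exfalso; have [x Kx] := K_nonempty.
have Kun y : ~ Kc y -> y = x.
  move=> Ky; apply: (caps_apex_uniq Fcap _ Ky Kx) => z Kz.
  have cz : cutp z by apply: contrapT => ncz; apply: allcut; exists z.
  have [|||V [cV aV V0]] := @cut_cap z e0 f0 cz.
  - exact/nesym/K2.
  - exact/nesym/K2'.
  - by move=> h; apply: nsep; exists z.
  exists V; split => //; split; first by exists z.
  by exists e0, f0.
apply: nsep; exists x; split => //; exists W; split.
- exact: W_cap.
- have [e1 Le1 H1] := L_nomax Le0; exists (e1, f0) => //=; exact: H1.
- by move=> [[e f] /= [Le Uf] H]; exact: (U_nosep Le Uf0 Uf H).
- exact/nesym/K2'.
Qed.

End Gap.
End ContinuumCaps.

(** * The pretree of a continuum *)
Section Classes.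
Variable X : topologicalType.
Local Notation P := (cp_class X).

Lemma cls_subproof (a : X) : cp_equiv a \in @cp_class_set X.
Proof. exact/mem_set/imageT. Qed.

Definition cls (a : X) : P := exist _ (cp_equiv a) (cls_subproof a).

Lemma pts_cls (a : X) : pts (cls a) = cp_equiv a. Proof. by []. Qed.

Lemma pts_nonempty (x : P) : exists a, pts x a.
Proof.
by have /set_mem[b _ bx] := valP x; exists b; rewrite /pts -bx; left.
Qed.

(** A chosen point of a class; for a cut point it is the point itself. *)
Definition rep (x : P) : X := projT1 (cid (pts_nonempty x)).

Lemma pts_rep x : pts x (rep x). Proof. exact: projT2 (cid _). Qed.

Definition cut (e : P) := cutp (rep e).
Definition cls_sep (e x y : P) := sep (rep e) (rep x) (rep y).

(** The cut points in (z, x].  For z that is not a cut point they determine on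
    which side of z the class x lies. *)
Definition cut_toward (z x e : P) := cut e /\ (e = x \/ cls_sep e z x).

(** The class z hangs at the cut point c: seen from z, everything else lies
    beyond c. *)
Definition leaf (c z : P) :=
  [/\ cut c, z <> c & forall x, x <> c -> x <> z -> cls_sep c x z].

(** An edge that is not a leaf edge, as a pair with its cut point first. *)
Definition core_edge (cz : P * P) :=
  [/\ Defs.adjacent cz.1 cz.2, cut cz.1 & ~ leaf cz.1 cz.2].

End Classes.

Section Pretree.
Variables (R : realType) (X : metricType R).
Hypothesis contX : continuum X.
Let cX : connected [set: X] := contX.2.
Local Notation P := (cp_class X).
Implicit Types x y z w s : P.

Lemma cut_pointE (c : X) : cut_point c <-> cutp c.
Proof.
by split=> -[a [b h]]; exists a, b; apply/separates_sep.
Qed.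

Lemma pt_ooE (a b c : X) : pt_oo a b c <-> sep c a b.
Proof.
split; first by case=> _ /separates_sep.
move=> h; split; last exact/separates_sep.
by apply/cut_pointE; exists a, b.
Qed.

Lemma cp_equivE (a b : X) : cp_equiv a b <->
  a = b \/ [/\ ~ cutp a, ~ cutp b & forall e, ~ sep e a b].
Proof.
split=> -[->|[ca cb ab]]; (try by left); right; split.
- by move/cut_pointE.
- by move/cut_pointE.
- by move=> e /pt_ooE; rewrite ab.
- by move/cut_pointE.
- by move/cut_pointE.
- by apply/seteqP; split=> // e /pt_ooE /ab.
Qed.

Lemma cp_equivC (a b : X) : cp_equiv a b -> cp_equiv b a.
Proof.
move=> /cp_equivE[->|[ca cb ab]]; apply/cp_equivE; first by left.
by right; split => // e /sepC; exact: ab.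
Qed.

(** A cut point that separated a from a' would make them inequivalent. *)
Lemma cp_equiv_sep (a a' e b : X) : cp_equiv a a' -> sep e a b -> sep e a' b.
Proof.
move=> /cp_equivE[-> //|[ca ca' aa']] eab.
have [|/aa' //|//] := sep_or eab (x := a').
by move=> a'e; apply: ca'; rewrite a'e; exists a, b.
Qed.

Lemma cp_equiv_trans (a b c : X) : cp_equiv a b -> cp_equiv b c -> cp_equiv a c.
Proof.
move=> ab bc; have := ab; have := bc.
move=> /cp_equivE[<- //|[cb cc H1]] /cp_equivE[-> //|[ca _ H2]].
apply/cp_equivE; right; split => // e /(cp_equiv_sep ab).
exact: H1.
Qed.

Lemma pts_clsP (x : P) (a : X) : pts x a -> x = cls a.
Proof.
move=> xa; apply: val_inj => /=; have /set_mem[b _ bx] := valP x.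
rewrite /pts -bx in xa; rewrite -bx; apply/seteqP; split=> c.
  exact/cp_equiv_trans/cp_equivC.
exact: cp_equiv_trans.
Qed.

Lemma cls_rep x : cls (rep x) = x. Proof. exact/esym/pts_clsP/pts_rep. Qed.

Lemma rep_inj : injective (@rep X).
Proof. by move=> x y xy; rewrite -(cls_rep x) xy cls_rep. Qed.

Lemma cp_equiv_rep (a : X) : cp_equiv a (rep (cls a)). Proof. exact: (pts_rep (cls a)). Qed.

Lemma rep_cls_cut (a : X) : cutp a -> rep (cls a) = a.
Proof. by move=> ca; have /cp_equivE[<-|[]] := cp_equiv_rep a. Qed.

Lemma cp_equiv_cut (a b : X) : cp_equiv a b -> cutp a -> a = b.
Proof. by move=> /cp_equivE[|[]]. Qed.

Lemma cutp_rep_cls (a : X) : cutp (rep (cls a)) -> cutp a.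
Proof.
by move=> h; rewrite -(cp_equiv_cut (cp_equivC (cp_equiv_rep a)) h).
Qed.

Lemma cls_sep_sym (e x y : P) : cls_sep e x y -> cls_sep e y x. Proof. exact: sepC. Qed.
Lemma cls_sep_cut (e x y : P) : cls_sep e x y -> cut e. Proof. by move=> h; exists (rep x), (rep y). Qed.
Lemma cls_sep_neql (e x y : P) : cls_sep e x y -> x <> e.
Proof. by move=> /sep_neql + xe; rewrite xe. Qed.
Lemma cls_sep_neqr (e x y : P) : cls_sep e x y -> y <> e.
Proof. by move=> /sep_neqr + ye; rewrite ye. Qed.
Lemma cls_sep_neq (e x y : P) : cls_sep e x y -> x <> y.
Proof. by move=> /sep_neq + xy; rewrite xy. Qed.
Lemma cls_sep_or (e x y w : P) : cls_sep e x y -> w <> e -> cls_sep e x w \/ cls_sep e w y.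
Proof. by move=> exy we; apply: sep_or => // /rep_inj. Qed.
Lemma cls_sep_anti (c a b : P) : cls_sep c a b -> cls_sep b a c -> False.
Proof. exact: sep_anti. Qed.
Lemma cls_sep_total (c e a b : P) : cls_sep c a b -> cls_sep e a b -> c = e \/ cls_sep c a e \/ cls_sep e a c.
Proof. by move=> h1 h2; have [/rep_inj|] := sep_total cX h1 h2; [left|right]. Qed.

(** Classes that are not cut points are distinct only because some cut point
    separates their points. *)
Lemma noncut_cls_sep (x y : P) : ~ cut x -> ~ cut y -> x <> y -> exists e, cls_sep e x y.
Proof.
move=> cx cy xy; apply: contrapT => nS; apply: xy.
rewrite -(cls_rep x); apply/esym/pts_clsP.
rewrite -[in pts y _](cls_rep y) pts_cls; apply: cp_equivC.
apply/cp_equivE; right; split => // e exy; apply: nS; exists (cls e).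
by rewrite /cls_sep rep_cls_cut //; exists (rep x), (rep y).
Qed.

(** Betweenness in P in terms of representatives: a class z that is not a cut
    point lies between x and y when they lie on different sides of z. *)
Lemma P_ooE x y z : P_oo x y z <-> cls_sep z x y \/
  [/\ ~ cut z, z <> x, z <> y & forall e, cut_toward z x e -> cut_toward z y e -> False].
Proof.
split.
  move=> [a [b [c [xa yb zc]]]].
  have -> : z = cls c by exact: pts_clsP.
  have -> : x = cls a by exact: pts_clsP.
  have -> : y = cls b by exact: pts_clsP.
  have ea := cp_equiv_rep a; have eb := cp_equiv_rep b; have ec := cp_equiv_rep c.
  move=> [[/cut_pointE cc /pt_ooE cab]|[/cut_pointE cc ca cb ab0]].
    left; rewrite /cls_sep rep_cls_cut //.
    exact/(cp_equiv_sep ea)/sepC/(cp_equiv_sep eb)/sepC.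
  right; split => //; first by move=> /cutp_rep_cls.
  have ac : a <> c by move=> h; apply: ca; rewrite h.
  have cb' : c <> b by move=> h; apply: cb; rewrite h.
  move=> e [ce ae] [_ be].
  have : (pt_co a c `&` pt_oc c b) (rep e); last by rewrite ab0.
  split; split => //.
    case: ae => [ee|h].
      left; apply: (cp_equiv_cut _ ce); rewrite ee; exact: cp_equivC.
    right; apply/pt_ooE/sepC; apply: (cp_equiv_sep (cp_equivC ec)).
    apply: sepC; apply: (cp_equiv_sep (cp_equivC ea)); exact: sepC.
  case: be => [ee|h].
    left; apply: (cp_equiv_cut _ ce); rewrite ee; exact: cp_equivC.
  right; apply/pt_ooE; apply: (cp_equiv_sep (cp_equivC ec)).
  apply: sepC; apply: (cp_equiv_sep (cp_equivC eb)); exact: sepC.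
move=> h; exists (rep x), (rep y), (rep z); split; try exact: pts_rep.
case: h => [h|[cz zx zy H]].
  left; split; last exact/pt_ooE.
  by apply/cut_pointE; exists (rep x), (rep y).
right; split => //; first by move=> /cut_pointE.
apply/seteqP; split=> // e [[az ae] [zb be]].
have [ce|ce] := pselect (cutp e).
  apply: (H (cls e)); (split; first by rewrite /cut rep_cls_cut).
    case: ae => [->|/pt_ooE/sepC h]; first by left; rewrite cls_rep.
    by right; rewrite /cls_sep rep_cls_cut.
  case: be => [->|/pt_ooE h]; first by left; rewrite cls_rep.
  by right; rewrite /cls_sep rep_cls_cut.
have xy : x = y.
  case: ae => [ex|/pt_ooE h]; last by case: ce; exists (rep x), (rep z).
  case: be => [ey|/pt_ooE h]; last by case: ce; exists (rep z), (rep y).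
  by apply: rep_inj; rewrite -ex -ey.
have cx : ~ cut x.
  by rewrite /cut; case: ae => [<- //|/pt_ooE h]; case: ce; exists (rep x), (rep z).
have [g gzx] := noncut_cls_sep cz cx zx.
by apply: (H g); (split; [exact: cls_sep_cut gzx | right]); rewrite -?xy.
Qed.

Lemma P_oo_cut (x y z : P) : cut z -> P_oo x y z -> cls_sep z x y.
Proof. by move=> cz /P_ooE[|[]]. Qed.

Lemma cls_sep_oo (x y z : P) : cls_sep z x y -> P_oo x y z.
Proof. by move=> h; apply/P_ooE; left. Qed.

(** Lying on the same side of z is a transitive relation: the cut points of
    (z, w) are linearly ordered, and of e and f the one that is closer to z lies
    in (z, x] and in (z, y]. *)
Lemma cut_toward_trans (z x w y e f : P) : cut_toward z x e -> cut_toward z w e -> cut_toward z w f -> cut_toward z y f ->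
  exists g, cut_toward z x g /\ cut_toward z y g.
Proof.
have step e' f' w' : cls_sep e' z f' -> cut_toward z w' f' -> cut e' -> cut_toward z w' e'.
  move=> ezf [cf wf] ce; split => //; case: wf => [<-|fzw]; first by right.
  have [we|we] := pselect (w' = e'); first by left.
  have [?|wf] := cls_sep_or ezf we; first by right.
  exfalso; have [|h|h] := cls_sep_or fzw (w := e'); first exact/nesym/cls_sep_neqr/ezf.
    exact: cls_sep_anti ezf h.
  exact: cls_sep_anti wf (cls_sep_sym h).
move=> [ce xe] [_ we] [cf wf] yf.
have [ef|[h|h]] : e = f \/ cls_sep e z f \/ cls_sep f z e.
  case: we => [ew|ezw]; case: wf => [fw|fzw].
  - by left; rewrite ew fw.
  - by right; right; rewrite ew.
  - by right; left; rewrite fw.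
  - exact: cls_sep_total ezw fzw.
- by exists f; split => //; split => //; rewrite -ef.
- by exists e; split; [split|exact: step h yf ce].
- by exists f; split => //; apply: step h _ cf.
Qed.

Lemma cut_toward_nonempty (z x : P) : ~ cut z -> z <> x -> exists e, cut_toward z x e.
Proof.
move=> cz zx; have [cx|cx] := pselect (cut x); first by exists x; split=> //; left.
by have [e h] := noncut_cls_sep cz cx zx; exists e; split; [exact: cls_sep_cut h|right].
Qed.

Lemma P_oo_sym x y z : P_oo x y z -> P_oo y x z.
Proof.
move=> /P_ooE[h|[cz zx zy H]]; apply/P_ooE; first by left; exact: cls_sep_sym.
by right; split => // e ? ?; exact: (H e).
Qed.

Lemma P_oo_neq x y z : P_oo x y z -> [/\ z <> x, z <> y & x <> y].
Proof.
move=> /P_ooE[h|[cz zx zy H]].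
  by split; [exact/nesym/cls_sep_neql/h | exact/nesym/cls_sep_neqr/h | exact: cls_sep_neq h].
split => // xy; have [e De] := cut_toward_nonempty cz zx.
by apply: (H e) => //; rewrite -xy.
Qed.

Lemma P_oo_or x y z w : P_oo x y z -> w <> z -> P_oo x w z \/ P_oo w y z.
Proof.
move=> /P_ooE[h|[cz zx zy H]] wz.
  by have [|] := cls_sep_or h wz; [left|right]; exact: cls_sep_oo.
apply: contrapT => /not_orP[h1 h2].
have nP a b : z <> a -> z <> b -> ~ P_oo a b z -> exists e, cut_toward z a e /\ cut_toward z b e.
  move=> za zb nP; apply: contrapT => nD; apply: nP; apply/P_ooE; right.
  by split => // e De De'; apply: nD; exists e.
have [||e [De De']] := nP _ _ _ _ h1 => //; first exact: nesym.
have [||f [Df Df']] := nP _ _ _ _ h2 => //; first exact: nesym.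
have [g [Dg Dg']] := cut_toward_trans De De' Df Df'.
exact: H Dg Dg'.
Qed.

Lemma P_oo_anti x y z : P_oo x y z -> P_oo x z y -> False.
Proof.
move=> h1 h2; have [zx zy xy] := P_oo_neq h1.
move: h1 h2 => /P_ooE[h|[cz _ _ H]] /P_ooE[h'|[cy _ _ H']].
- exact: cls_sep_anti h h'.
- by apply: (H' z); split; try exact: cls_sep_cut h; [right; exact: cls_sep_sym|left].
- by apply: (H y); split; try exact: cls_sep_cut h'; [right; exact: cls_sep_sym|left].
- have [e h] := noncut_cls_sep cy cz (nesym zy); have ce := cls_sep_cut h.
  have [ex|ex] := pselect (e = x).
    by apply: (H e); (split => //); [left|right; exact: cls_sep_sym].
  have [hx|hx] := cls_sep_or h (nesym ex).
    by apply: (H' e); split => //; right.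
  by apply: (H e); split => //; right; exact: cls_sep_sym.
Qed.

Lemma P_ccP x y z : P_cc x y z <-> [\/ P_oo x y z, z = x | z = y].
Proof.
split=> [[?|[?|?]]|[?|->|->]]; [by constructor 1|by constructor 2|by constructor 3|..].
- by left.
- by right; left.
- by right; right.
Qed.

Lemma P_betweenness : betweenness (@P_cc X).
Proof.
split.
- by move=> s t; apply/P_ccP; constructor 2.
- move=> s t u /P_ccP[/P_oo_sym ?|?|?]; apply/P_ccP;
    by [constructor 1|constructor 3|constructor 2].
- by move=> s u /P_ccP[/P_oo_neq[]|?|?].
- move=> s t u v /P_ccP[h|->|->]; last 2 first.
  + by left; apply/P_ccP; constructor 2.
  + by right; apply/P_ccP; constructor 3.
  have [->|vu] := pselect (v = u); first by left; apply/P_ccP; constructor 3.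
  have [?|?] := P_oo_or h vu; [left|right]; by apply/P_ccP; constructor 1.
- move=> s t u /P_ccP[h|us|//] /P_ccP[h'|ts|//].
  + by case: (P_oo_anti h h').
  + by case: (P_oo_neq h) => _ _; rewrite ts.
  + by case: (P_oo_neq h') => _ _; rewrite us.
  + by rewrite us ts.
Qed.

Lemma P_oo_cc x y z : P_oo x y z <-> [/\ P_cc x y z, z <> x & z <> y].
Proof.
split=> [h|[/P_ccP[]]//]; have [? ? _] := P_oo_neq h; split => //.
by apply/P_ccP; constructor 1.
Qed.

(** Carries the points found by [cut_nonadjacent] and [cut_gap] over to P. *)
Lemma pt_between_cls (a b : P) (z : X) : cut a -> cut b -> pt_between (rep a) (rep b) z -> P_oo a b (cls z).
Proof.
move=> ca cb [h|[cz H]].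
  have cz : cutp z by exists (rep a), (rep b).
  by apply: cls_sep_oo; rewrite /cls_sep rep_cls_cut.
have cz' : ~ cut (cls z) by move=> /cutp_rep_cls.
have ez := cp_equivC (cp_equiv_rep z).
apply/P_ooE; right; split => //; try by move=> h; apply: cz'; rewrite h.
move=> e [ce ea] [_ eb]; apply: (H (rep e)).
  case: ea => [->|h]; [by left|right; exact: cp_equiv_sep ez h].
by case: eb => [->|h]; [by left|right; exact: cp_equiv_sep ez h].
Qed.

Lemma cut_not_adjacent (x y : P) : cut x -> cut y -> ~ Defs.adjacent x y.
Proof.
move=> cx cy [xy xy0].
have rxy : rep x <> rep y by move=> /rep_inj.
have [z [h _]] := cut_nonadjacent contX rxy cx cy.
by have := pt_between_cls cx cy h; rewrite xy0.
Qed.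

Lemma noncut_not_adjacent (x y : P) : ~ cut x -> ~ cut y -> ~ Defs.adjacent x y.
Proof.
move=> cx cy [xy xy0]; have [e h] := noncut_cls_sep cx cy xy.
by have := cls_sep_oo h; rewrite xy0.
Qed.

Lemma adjacentC x y : Defs.adjacent x y -> Defs.adjacent y x.
Proof.
move=> [xy xy0]; split; first exact: nesym.
by apply/seteqP; split=> // z /P_oo_sym; rewrite xy0.
Qed.

Lemma adjacent_cutl (x y : P) : Defs.adjacent x y -> cut x -> ~ cut y.
Proof. by move=> xy cx cy; exact: (cut_not_adjacent cx cy xy). Qed.

(** Seen from any s, one end of an edge lies beyond the other. *)
Lemma adjacent_split x y s : Defs.adjacent x y -> P_cc x s y \/ P_cc y s x.
Proof.
wlog cx : x y / cut x.
  move=> wl xy; have [cx|cx] := pselect (cut x); first exact: wl.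
  have [cy|cy] := pselect (cut y); last by case: (noncut_not_adjacent cx cy xy).
  by have [] := wl y x cy (adjacentC xy); [right|left].
move=> xy; have cy := adjacent_cutl xy cx; have [xney xy0] := xy.
have [->|sx] := pselect (s = x); first by right; apply/P_ccP; constructor 3.
have [->|sy] := pselect (s = y); first by left; apply/P_ccP; constructor 3.
have [h|h] := pselect (cls_sep x s y); first by right; apply/P_ccP; constructor 1; exact/cls_sep_oo/cls_sep_sym.
left; apply/P_ccP; constructor 1; apply/P_ooE; right; split => //; try exact: nesym.
move=> e [ce ex] [_ es]; case: ex => [ex|ex]; last first.
  by have := cls_sep_oo (cls_sep_sym ex); rewrite xy0.
rewrite ex in es; case: es => [xs|xs]; first by apply: sx; rewrite xs.
by apply: h; exact: cls_sep_sym.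
Qed.

(** A gap in the segment [a, b] of P, to be refuted by [P_gap]. *)
Section PGap.
Variables (a b : P) (L : set P).
Let btP := P_betweenness.
Hypothesis Lab : L `<=` P_cc a b.
Hypothesis La : L a.
Hypothesis Lb : ~ L b.
Hypothesis Ldown : forall x y, L y -> P_cc a y x -> L x.
Hypothesis Lmax : forall x, L x -> exists y, [/\ L y, x <> y & P_cc a y x].
Hypothesis Umin : forall y, P_cc a b y -> ~ L y ->
  exists x, [/\ P_cc a b x, ~ L x, x <> y & P_cc a y x].

Let lt x y := x <> y /\ P_cc a y x.
Let U := [set y | P_cc a b y /\ ~ L y].

Let lt_trans x y z : lt x y -> lt y z -> lt x z.
Proof.
move=> [xy ayx] [yz azy]; split; last exact: (bt_trans btP azy ayx).
by move=> xz; subst z; apply: xy; exact: bt_anti btP _ _ _ ayx azy.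
Qed.

Let lt_asym x y : lt x y -> ~ lt y x.
Proof. by move=> [xy h] [_ h']; apply: xy; exact: bt_anti btP _ _ _ h h'. Qed.

Let LU x y : L x -> U y -> lt x y.
Proof.
move=> Lx [aby Ly]; split; first by move=> xy; apply: Ly; rewrite -xy.
by have [/(Ldown Lx)|] := bt_total btP (Lab Lx) aby.
Qed.

Let lt_oo x y z : lt x y -> lt y z -> P_oo x z y.
Proof.
move=> [xy ayx] [yz azy]; apply/P_oo_cc; split => //; last exact: nesym.
exact: (bt_order btP azy ayx).
Qed.

Let oo_lt x y z : lt x y -> P_oo x y z -> lt x z /\ lt z y.
Proof.
move=> [xy ayx] /P_oo_cc[xyz zx zy].
have ayz : P_cc a y z.
  by apply: (bt_sub btP ayx _ xyz); exact: bt_r.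
split; split => //; first exact: nesym.
have [//|axz] := bt_total btP ayz ayx.
by exfalso; apply: zx; apply: (bt_meet btP ayx axz xyz).
Qed.

(** Between two points of L there is a cut point, so the cut points of L are
    cofinal in L. *)
Let Lcut x : L x -> exists e, [/\ cut e, L e & lt x e].
Proof.
move=> Lx; have [y [Ly xy ayx]] := Lmax Lx.
have [cy|cy] := pselect (cut y); first by exists y.
have [z [Lz yz azy]] := Lmax Ly.
have xz : lt x z by apply: (@lt_trans x y).
have [cz|cz] := pselect (cut z); first by exists z.
have [e h] := noncut_cls_sep cy cz yz; exists e.
have [ye ez] := oo_lt (conj yz azy) (cls_sep_oo h).
split; [exact: cls_sep_cut h|by apply: (Ldown Lz); case: ez|].
by apply: (@lt_trans x y).
Qed.

Let Ucut y : U y -> exists f, [/\ cut f, U f & lt f y].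
Proof.
move=> [aby Ly]; have [x [abx Lx xy ayx]] := Umin aby Ly.
have [cx|cx] := pselect (cut x); first by exists x.
have [w [abw Lw wx axw]] := Umin abx Lx.
have [cw|cw] := pselect (cut w).
  by exists w; split => //; apply: (@lt_trans w x).
have [e h] := noncut_cls_sep cw cx wx; exists e.
have [we ex] := oo_lt (conj wx axw) (cls_sep_oo h).
split; [exact: cls_sep_cut h| |by apply: (@lt_trans e x)].
split; first by apply: (bt_trans btP abx); case: ex.
by move=> Le; apply: Lw; apply: (Ldown Le); case: we.
Qed.

(** The cut points of L and of its complement satisfy the hypotheses of
    [cut_gap]; the class that it yields lies beyond all of L and before all of
    the complement, but belongs to one of them. *)
Lemma P_gap : False.
Proof.
pose L' := [set e | cutp e /\ L (cls e)].
pose U' := [set f | cutp f /\ U (cls f)].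
have Le x : cut x -> L x -> L' (rep x) by move=> cx Lx; split; rewrite ?cls_rep.
have Ue x : cut x -> U x -> U' (rep x) by move=> cx Lx; split; rewrite ?cls_rep.
have oo_sep (x y z : X) : cutp x -> cutp y -> cutp z ->
    lt (cls x) (cls y) -> lt (cls y) (cls z) -> sep y x z.
  move=> cx cy cz xy yz; have := P_oo_cut _ (lt_oo xy yz).
  by rewrite /cut /cls_sep !rep_cls_cut //; apply.
have lt_total x y : P_cc a b x -> P_cc a b y -> x = y \/ lt y x \/ lt x y.
  move=> abx aby; have [->|xy] := pselect (x = y); first by left.
  right; have [?|?] := bt_total btP abx aby; [left|right]; split => //.
  exact: nesym.
have Ub : U b by split => //; exact: bt_r.
have [e0 [ce0 Le0 _]] := Lcut La.
have [f0 [cf0 Uf0 _]] := Ucut Ub.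
have [z zP] : exists z : X, forall e f, L' e -> U' f ->
    pt_between e f z /\ z <> e /\ z <> f.
  apply: (@cut_gap R X contX L' U' _ _ _ _ (rep e0) (rep f0)).
  - move=> e [ce Lce]; have [x [cx Lx ex]] := Lcut Lce.
    exists (rep x); first exact: Le.
    by move=> f [cf Uf]; apply: oo_sep; rewrite ?cls_rep //; exact: LU.
  - move=> f [cf Uf]; have [y [cy Uy yf]] := Ucut Uf.
    exists (rep y); first exact: Ue.
    by move=> e [ce Lce]; apply: oo_sep; rewrite ?cls_rep //; exact: LU.
  - move=> e e' [ce Lce] [ce' Lce'].
    have [ee|[h|h]] := lt_total _ _ (Lab Lce) (Lab Lce').
    + by left; rewrite -(rep_cls_cut ce) ee rep_cls_cut.
    + by right; left => f [cf Uf]; apply: oo_sep => //; exact: LU.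
    + by right; right => f [cf Uf]; apply: oo_sep => //; exact: LU.
  - move=> f f' [cf Uf] [cf' Uf'].
    have [ee|[h|h]] := lt_total _ _ Uf.1 Uf'.1.
    + by left; rewrite -(rep_cls_cut cf) ee rep_cls_cut.
    + by right; right => e [ce Lce]; apply: oo_sep => //; exact: LU.
    + by right; left => e [ce Lce]; apply: oo_sep => //; exact: LU.
  - exact: Le.
  - exact: Ue.
have oo e f : cut e -> cut f -> L e -> U f -> P_oo e f (cls z).
  move=> ce cf Lce Ucf; apply: pt_between_cls => //.
  by case: (zP _ _ (Le _ ce Lce) (Ue _ cf Ucf)).
have [_ zf0] := oo_lt (LU Le0 Uf0) (oo _ _ ce0 cf0 Le0 Uf0).
have [Lz|Lz] := pselect (L (cls z)).
  have [e [ce Lce ze]] := Lcut Lz.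
  have [ez _] := oo_lt (LU Lce Uf0) (oo _ _ ce cf0 Lce Uf0).
  exact: lt_asym ze ez.
have Uz : U (cls z).
  by split => //; apply: (bt_trans btP (Uf0.1)); case: zf0.
have [f [cf Uf fz]] := Ucut Uz.
have [_ zf] := oo_lt (LU Le0 Uf) (oo _ _ ce0 cf Le0 Uf).
exact: lt_asym fz zf.
Qed.

End PGap.
End Pretree.

(** * Countability *)
Lemma countable_code (I : choiceType) (A : set I) (C : countType) (Q : I -> C -> Prop) :
  (forall i, A i -> exists n, Q i n) ->
  (forall i j n, A i -> A j -> Q i n -> Q j n -> i = j) -> countable A.
Proof.
move=> ex inj.
pose f i := if pselect (exists n, Q i n) is left h then choice.pickle (projT1 (cid h)) else 0%N.
have fP i : A i -> exists n, f i = choice.pickle n /\ Q i n.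
  move=> /ex h; rewrite /f; case: pselect => // h'.
  by exists (projT1 (cid h')); split => //; exact: (projT2 (cid h')).
apply/countable_injP; exists f => i j; rewrite !inE => Ai Aj.
have [n [-> Qn]] := fP _ Ai; have [m [-> Qm]] := fP _ Aj.
move=> /(pcan_inj choice.pickleK) nm; apply: inj Ai Aj Qn _; by rewrite nm.
Qed.

Section Countability.
Variables (R : realType) (X : metricType R).
Hypothesis contX : continuum X.
Let compactX : compact [set: X] := contX.1.
Let cX : connected [set: X] := contX.2.
Local Notation P := (cp_class X).
Implicit Types x y z w s c : P.

Lemma dense_sequence (x0 : X) : exists p : nat -> X, forall U : set X,
  open U -> U !=set0 -> exists i, U (p i).
Proof.
have [B bB] := continuum_basis compactX.
exists (fun i => xget x0 (B i)) => U oU [x Ux].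
have [i [_ Bx BU]] := bB x U oU Ux; exists i; apply: BU.
by apply: xgetPex; exists x.
Qed.

Lemma cutp_far (e a : X) : cutp e -> a <> e -> exists b, sep e b a.
Proof.
move=> [u [v euv]] ae; have [h|h] := sep_or euv ae; first by exists u.
by exists v; exact: sepC.
Qed.

Lemma cut_cls_sep (e : P) : cut e -> exists x y, cls_sep e x y.
Proof.
move=> [a [b h]]; exists (cls a), (cls b).
apply: (cp_equiv_sep (cp_equiv_rep a)); apply: sepC.
by apply: (cp_equiv_sep (cp_equiv_rep b)); exact: sepC.
Qed.

(** If z separated x from y, one of x, y would be separated from c by z,
    whereas c separates it from z. *)
Lemma leaf_noncut c z : leaf c z -> ~ cut z.
Proof.
move=> [_ zc lz] /cut_cls_sep[x [y h]].
have xz := cls_sep_neql h; have yz := cls_sep_neqr h.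
have nx w : w <> z -> ~ cls_sep z w c.
  move=> wz h'; have wc := cls_sep_neq h'.
  exact: (cls_sep_anti contX (lz _ wc wz) h').
have [xc|xc] := pselect (x = c).
  by apply: (nx y yz); rewrite -xc; exact: cls_sep_sym.
have [|h'|h'] := cls_sep_or h (w := c); first exact: nesym.
  exact: nx h'.
exact: (nx y yz (cls_sep_sym h')).
Qed.

Lemma leaf_uniq c c' z : leaf c z -> leaf c' z -> c = c'.
Proof.
move=> lz lz'; apply: contrapT => cc'.
have cz : c <> z by case: lz => _ /nesym.
have cz' : c' <> z by case: lz' => _ /nesym.
case: lz => _ _ /(_ c' (nesym cc') cz') h.
case: lz' => _ _ /(_ c cc' cz) h'.
exact: (cls_sep_anti contX (cls_sep_sym h) (cls_sep_sym h')).
Qed.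

(** Encode c by a point p_i of a dense sequence and a basic neighbourhood B_k
    of a leaf z at c such that c separates B_k from p_i.  Two such points c, c'
    with the same code would each separate the other from p_i. *)
Lemma countable_leaf_bases : countable [set c : P | exists z, leaf c z].
Proof.
have [[x0 _]|X0] := pselect ([set: X] !=set0); last first.
  apply: (@countable_code P _ nat (fun _ _ => False)) => // c.
  by move=> _; exfalso; apply: X0; exists (rep c).
have [p pP] := dense_sequence x0.
have [B bB] := continuum_basis compactX.
pose Q c (ik : nat * nat) := exists z, [/\ leaf c z, B ik.2 (rep z) &
   B ik.2 `<=` [set y | sep (rep c) y (p ik.1)]].
apply: (@countable_code P _ _ Q).
  move=> c [z lz]; have [cc zc lz'] := lz.
  have [b cb] := cutp_far cc (fun h => zc (rep_inj h)).
  have [i ci] : exists i, sep (rep c) (rep z) (p i).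
    apply: (pP _ (open_sepr (rep c) (rep z))).
    by exists b; exact: sepC.
  have [k [_ Bz BU]] := bB _ _ (open_sepl (rep c) (p i)) ci.
  by exists (i, k), z.
move=> c c' [i k] _ _ [z [lz Bz BU]] [z' [lz' Bz' BU']] /=.
apply: contrapT => cc'.
have ncz := leaf_noncut lz; have ncz' := leaf_noncut lz'.
have rcc : rep c <> rep c' by move=> /(rep_inj).
have h1 : sep (rep c') (rep c) (p i).
  have [|h|//] := sep_or (BU' _ Bz) (x := rep c) => //.
  case: lz => cc _ /(_ c' (nesym cc')) h'; exfalso.
  apply: (cls_sep_anti contX (cls_sep_sym (h' _)) h).
  by move=> c'z; apply: ncz; rewrite -c'z; case: lz'.
have h2 : sep (rep c) (rep c') (p i).
  have [|h|//] := sep_or (BU _ Bz') (x := rep c'); first exact: nesym.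
  case: lz' => cc2 _ /(_ c cc') h'; exfalso.
  apply: (cls_sep_anti contX (cls_sep_sym (h' _)) h).
  by move=> cz; apply: ncz'; rewrite -cz; case: lz.
exact: (sep_anti cX (sepC h1) (sepC h2)).
Qed.

Lemma adjacent_nosep c z w : Defs.adjacent c z -> ~ cls_sep w z c.
Proof.
by move=> [_ cz0] h; have := cls_sep_oo (cls_sep_sym h); rewrite cz0.
Qed.

(** As z is not a leaf at c, some x is not separated from z by c; a cut point
    in (z, x] serves as e. *)
Lemma core_edge_beyond c z : core_edge (c, z) ->
  exists e, [/\ cut e, e <> c & ~ cls_sep c e z].
Proof.
move=> [/= acz cc nl].
have zc : z <> c by case: acz => /nesym.
have ncz : ~ cut z := adjacent_cutl contX acz cc.
have [x [xc xz ncx]] : exists x, [/\ x <> c, x <> z & ~ cls_sep c x z].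
  apply: contrapT => nx; apply: nl; split => // x xc xz.
  by apply: contrapT => h; apply: nx; exists x.
have [e [ce ex]] := cut_toward_nonempty ncz (nesym xz).
case: ex => [ex|ezx]; first by subst e; exists x.
have ec : e <> c by move=> ec; apply: ncx; apply: cls_sep_sym; rewrite -ec.
exists e; split => // h.
have [h1|//] := cls_sep_or h xc.
have [h2|h2] := cls_sep_or ezx (nesym ec); first exact: (adjacent_nosep acz h2).
exact: (cls_sep_anti contX (cls_sep_sym h1) (cls_sep_sym h2)).
Qed.

(** Encode the edge from c to z by dense points p_i, p_j and a basic
    neighbourhood B_k of z such that c separates B_k and p_j from p_i but does
    not separate z from p_j.  Here p_j is a dense point that is cut off from z
    by the point e of [core_edge_beyond].  The points c, c' with the same code both
    separate p_i from p_j, and they coincide because no point separates the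
    ends of an edge; then p_j shows that z and z' are on one side of c. *)
Lemma countable_core_edges : countable [set cz : P * P | core_edge cz].
Proof.
have [[x0 _]|X0] := pselect ([set: X] !=set0); last first.
  apply: (@countable_code _ _ nat (fun _ _ => False)) => // -[c z].
  by move=> _; exfalso; apply: X0; exists (rep c).
have [p pP] := dense_sequence x0.
have [B bB] := continuum_basis compactX.
pose Q (cz : P * P) (ijk : nat * nat * nat) := let: (i, j, k) := ijk in
  [/\ ~ sep (rep cz.1) (rep cz.2) (p j), p j <> rep cz.1,
      sep (rep cz.1) (p i) (p j), B k (rep cz.2) &
      B k `<=` [set y | sep (rep cz.1) y (p i)]].
apply: (@countable_code _ _ _ Q).
  move=> [c z] /[dup] ccz [/= acz cc nl].
  have zc : z <> c by case: acz => /nesym.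
  have ncz : ~ cut z := adjacent_cutl contX acz cc.
  have [b cb] := cutp_far cc (fun h => zc (rep_inj h)).
  have [i ci] : exists i, sep (rep c) (rep z) (p i).
    apply: (pP _ (open_sepr (rep c) (rep z))).
    by exists b; exact: sepC.
  have [k [_ Bz BU]] := bB _ _ (open_sepl (rep c) (p i)) ci.
  have [e [ce ec nce]] := core_edge_beyond ccz.
  have ze : rep z <> rep e.
    by move=> /(rep_inj) ze; apply: ncz; rewrite ze.
  have [b' eb'] := cutp_far ce ze.
  have [j ej] : exists j, sep (rep e) (rep z) (p j).
    apply: (pP _ (open_sepr (rep e) (rep z))).
    by exists b'; exact: sepC.
  have rec : rep c <> rep e by move=> /(rep_inj) /esym.
  have pjc : p j <> rep c.
    by move=> h; apply: (adjacent_nosep acz (w := e)); rewrite /cls_sep -h.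
  have F3 : ~ sep (rep c) (rep z) (p j).
    move=> h; have [h1|h1] := sep_or h (nesym rec).
      by apply: nce; exact: sepC.
    have [h2|h2] := sep_or ej rec; first exact: (adjacent_nosep acz h2).
    exact: (sep_anti cX (sepC h1) (sepC h2)).
  exists (i, j, k); split => //=.
  by have [//|/sepC] := sep_or ci pjc.
move=> [c z] [c' z'] [[i j] k] [/= acz cc _] [/= acz' cc' _].
move=> [/= F3 pc F4 Bz BU] [/= F3' pc' F4' Bz' BU'].
have step c1 z1 c2 : Defs.adjacent c1 z1 -> c1 <> c2 ->
    sep (rep c2) (rep z1) (p i) -> ~ sep (rep c1) (p i) (rep c2).
  move=> a1 c12 h1 h2.
  have [|h|h] := sep_or h1 (x := rep c1); first by move=> /(rep_inj).
    exact: adjacent_nosep a1 h.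
  exact: (sep_anti cX h2 (sepC h)).
have ec : c = c'.
  apply: contrapT => cc2.
  have [/(rep_inj) //|[h|h]] := sep_total cX F4 F4'.
  - exact: (step _ _ _ acz cc2 (BU' _ Bz) h).
  - exact: (step _ _ _ acz' (nesym cc2) (BU _ Bz') h).
subst c'; congr pair; apply: contrapT => zz'.
have nz := adjacent_cutl contX acz cc; have nz' := adjacent_cutl contX acz' cc.
have [g h] := noncut_cls_sep nz nz' zz'.
have [gc|gc] := pselect (c = g).
  subst g; have [|h'|h'] := sep_or h (x := p j) => //.
  exact/F3'/sepC.
have [h'|h'] := cls_sep_or h gc; first exact: adjacent_nosep acz h'.
exact: adjacent_nosep acz' (cls_sep_sym h').
Qed.

(** For each quadruple of dense points, choose one cut point that separates the
    first two and also the last two, if there is any.  The point c' separates c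
    from c'', so there are dense points p_i and p_j on the far sides of c and
    c'', a dense point p_k between c and c' and a dense point p_l between c' and
    c''.  The cut point chosen for p_i, p_j, p_k, p_l lies between c and c''. *)
Lemma dense_cuts : exists2 Ds : set P, countable Ds & forall c c' c'',
  cut c -> cut c'' -> cls_sep c' c c'' -> exists d, [/\ Ds d, cut d & P_cc c c'' d].
Proof.
have [[x0 _]|X0] := pselect ([set: X] !=set0); last first.
  exists set0; first exact: countable0.
  by move=> c; exfalso; apply: X0; exists (rep c).
have [p pP] := dense_sequence x0.
pose good (n : (nat * nat) * (nat * nat)) (d : P) :=
  sep (rep d) (p n.1.1) (p n.1.2) /\ sep (rep d) (p n.2.1) (p n.2.2).
pose del n := xget (cls x0) (good n).
exists (range del); first exact: card_le_trans (card_image_le _ _) (countableP _).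
move=> c c' c'' cc cc'' h.
have c'c : rep c' <> rep c by move=> /(rep_inj) e; exact: (cls_sep_neql h).
have c'c'' : rep c' <> rep c'' by move=> /(rep_inj) e; exact: (cls_sep_neqr h).
have far e a : cutp e -> a <> e -> exists i, sep e (p i) a.
  move=> ce ae; have [b eb] := cutp_far ce ae.
  by apply: (pP _ (open_sepl e a)); exists b.
have [i hi] := far _ _ cc c'c.
have [j hj] := far _ _ cc'' c'c''.
have hj' : sep (rep c') (rep c) (p j).
  have [|//|h1] := sep_or h (x := p j); last first.
    by case: (sep_anti cX h1 hj).
  move=> e; rewrite e in hj; exact: (sep_neq hj).
have [V [cV Vi Vc' _]] := hi.
have [W [cW Wc Wj jc']] := hj'.
have [W' [cW' W'c' W'j jc'']] := sepC hj.
have sub1 : V `|` [set rep c] `<=` W.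
  apply: (connected_sub_cap (connected_cap cX cV) _ cW _ Wc).
  - by move=> [//|/esym]; exact/nesym.
  - by right.
have Wc'' : ~ W (rep c'').
  move=> Wc''; suff : W (p j) by [].
  apply: (connected_sub_cap (connected_capC cX cW') _ cW _ Wc'').
  - by move=> /(_ W'c').
  - by case: cW'.
  - exact: W'j.
have sub2 : W `|` [set rep c'] `<=` W'.
  apply: (connected_sub_cap (connected_cap cX cW) _ cW' _ W'c').
  - by move=> [//|/= e]; exact: c'c''.
  - by right.
have strict e (A A' : set X) : cap e A -> open A' -> A `|` [set e] `<=` A' ->
    (exists a, ~ A' a) -> exists k, [/\ A' (p k), ~ A (p k) & p k <> e].
  move=> [oA Ae cA] oA' AA' [a A'a].
  have [] := pP (A' `\` (A `|` [set e])).
  - by rewrite setDE; apply: openI => //; rewrite openC.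
  - apply: contrapT => /nonemptyPn D0; apply: A'a.
    have E : A' = A `|` [set e].
      apply/seteqP; split=> // y A'y; apply: contrapT => nA.
      by have : (A' `\` (A `|` [set e])) y by []; rewrite D0.
    apply: (@connected_clopen _ setT A' A' e) => //; first by rewrite E.
    by rewrite E; right.
  by move=> k [A'k /not_orP[]]; exists k.
have [k [Wk Vk kc]] := strict _ _ _ cV (let: And3 o _ _ := cW in o) sub1
  (ex_intro _ (p j) Wj).
have [l [W'l Wl lc']] := strict _ _ _ cW (let: And3 o _ _ := cW' in o) sub2
  (ex_intro _ (p j) W'j).
have Wi : W (p i) by apply: sub1; left.
have gn : good ((i, j), (k, l)) (del ((i, j), (k, l))).
  by apply: xgetPex; exists c'; split=> /=; exists W.
set d := del _ in gn; have [/= hd1 hd2] := gn.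
have Vl : ~ V (p l) by move=> Vl; apply: Wl; apply: sub1; left.
have Vj : ~ V (p j) by move=> Vj; apply: Wj; apply: sub1; left.
have hc : sep (rep c) (p i) (p j).
  by exists V; split => // e; apply: Wj; rewrite e.
have hc'' : sep (rep c'') (p i) (p j) by exists W'; split => //; apply: sub2; left.
have cd : cut d by exists (p i), (p j).
exists d; split => //; first by exists ((i, j), (k, l)).
(* d lies beyond c as seen from p_i, and c'' lies beyond d *)
have L1 : d = c \/ sep (rep c) (p i) (rep d).
  have [/(rep_inj) ->|[|hdc]] := sep_total cX hc hd1; [by left|by right|exfalso].
  have dc : rep c <> rep d by exact: sep_neqr hdc.
  have Vd : V (rep d).
    apply: contrapT => Vd; have [Z [cZ Zi Zc _]] := hdc; apply: Zc.
    apply: (connected_sub_cap (connected_cap cX cV) _ cZ _ Zi).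
    - by move=> [//|/= e]; exact: dc.
    - by left.
    - by right.
  have [Z [cZ Zk Zl _]] := hd2; apply: Zl.
  by apply: (connected_sub_cap (connected_capC cX cV) _ cZ _ Zk).
have L2 : d = c'' \/ sep (rep d) (p i) (rep c'').
  have [/(rep_inj) ->|[hcd|]] := sep_total cX hc'' hd1; [by left|exfalso|by right].
  have dc : rep d <> rep c'' by exact: sep_neqr hcd.
  have W'd : W' (rep d).
    apply: contrapT => W'd; have [Z [cZ Zk Zl _]] := hd2; apply: Zl.
    apply: (connected_sub_cap (connected_cap cX cW') _ cZ _ Zk).
    - by move=> [//|/= e]; exact: dc.
    - by left; apply: sub2; left.
    - by left.
  have [|h1|h1] := sep_or hd1 (x := rep c''); first exact: nesym.
    exact: (sep_anti cX hcd h1).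
  have [Z [cZ Zc Zj _]] := h1; apply: Zj.
  apply: (connected_sub_cap (connected_capC cX cW') _ cZ _ Zc) => //.
  by case: cW'.
apply/P_ccP; case: L1 => [->|L1]; first by constructor 2.
case: L2 => [->|L2]; first by constructor 3.
constructor 1; apply: cls_sep_oo.
have [|h1|//] := sep_or L2 (x := rep c); first exact/nesym/sep_neqr/L1.
by case: (sep_anti cX L1 h1).
Qed.

End Countability.

(** * Coordinates along the edges *)
Section Edges.
Variables (R : realType) (X : metricType R).
Hypothesis contX : continuum X.
Local Notation P := (cp_class X).
Local Notation T := (cp_tree R X).
Implicit Types (x y z w p q : P) (E F G : edge X) (s t u v : T).
Let btP := P_betweenness contX.

Lemma edge_adjacent E : Defs.adjacent (edge_src E) (edge_tgt E).
Proof. by rewrite /edge_src /edge_tgt; case: (cid _) => xy []. Qed.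

Lemma edge_val E : val E = [set edge_src E; edge_tgt E].
Proof. by rewrite /edge_src /edge_tgt; case: (cid _) => xy []. Qed.

Lemma edge_src_tgt E : edge_src E <> edge_tgt E.
Proof. by case: (edge_adjacent E). Qed.

Lemma edge_ext E x y : val E = [set x; y] ->
  (edge_src E = x /\ edge_tgt E = y) \/ (edge_src E = y /\ edge_tgt E = x).
Proof.
rewrite edge_val => h.
have : [set x; y] (edge_src E) by rewrite -h; left.
have : [set x; y] (edge_tgt E) by rewrite -h; right.
have st := @edge_src_tgt E.
by case=> [tx|ty] [sx|sy]; [case: st; rewrite sx tx|right|left|case: st; rewrite sy ty].
Qed.

Lemma adjacent_edge x y : Defs.adjacent x y -> exists E, val E = [set x; y].
Proof.
move=> xy; have h : [set x; y] \in @edge_set X by apply/mem_set; exists (x, y).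
by exists (exist (fun F : set P => F \in @edge_set X) _ h).
Qed.

Lemma adjacent_cc x y z : Defs.adjacent x y -> P_cc x y z -> z = x \/ z = y.
Proof. by move=> [_ xy0] /P_ccP[|?|?]; [rewrite xy0|left|right]. Qed.

(** Each edge E divides P into the classes beyond its source, where [vcoord]
    is 0, and the classes beyond its target, where it is 1 ([adjacent_split]).
    The function [coord] extends this to T by the parameter on E itself; it is
    the retraction of T onto the closed edge E. *)
Definition vcoord E x : R := (`[< P_cc (edge_src E) x (edge_tgt E) >])%:R.

Definition coord E s : R :=
  match s with
  | inl x => vcoord E x
  | inr (F, a) => if F == E then val a else vcoord E (edge_src F)
  end.

Lemma vcoordP E x :
  (vcoord E x = 0 /\ P_cc (edge_tgt E) x (edge_src E)) \/
  (vcoord E x = 1 /\ P_cc (edge_src E) x (edge_tgt E)).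
Proof.
rewrite /vcoord; case: asboolP => h; first by right.
by left; split => //; have [|] := adjacent_split contX x (edge_adjacent E).
Qed.

Lemma vcoord_src E : vcoord E (edge_src E) = 0.
Proof.
rewrite /vcoord; case: asboolP => // /(bt_xx btP) h.
by case: (@edge_src_tgt E).
Qed.

Lemma vcoord_tgt E : vcoord E (edge_tgt E) = 1.
Proof. by rewrite /vcoord asboolT //; exact: bt_r. Qed.

(** An edge lies on the segment between two classes that it divides. *)
Lemma vcoord_neq_cc E x y : vcoord E x <> vcoord E y ->
  P_cc x y (edge_src E) /\ P_cc x y (edge_tgt E).
Proof.
have st := @edge_src_tgt E.
have main a b : P_cc (edge_tgt E) a (edge_src E) -> P_cc (edge_src E) b (edge_tgt E) ->
    P_cc a b (edge_src E) /\ P_cc a b (edge_tgt E).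
  move=> ha hb; split.
    have [h|h] := bt_tri btP b ha; last exact: (bt_sym btP h).
    case: st; apply: (bt_anti btP (s := b)); exact: (bt_sym btP).
  have [h|//] := bt_tri btP a hb.
  case: st; apply: (bt_anti btP (s := a)); exact: (bt_sym btP).
case: (vcoordP E x) => -[-> hx]; case: (vcoordP E y) => -[-> hy] //.
  by move=> _; exact: main.
by move=> _; have [h1 h2] := main _ _ hy hx; split; exact: (bt_sym btP).
Qed.

Lemma cc_vcoord_neq E x y : P_cc x y (edge_src E) -> P_cc x y (edge_tgt E) ->
  vcoord E x <> vcoord E y.
Proof.
have st := @edge_src_tgt E.
have excl a : P_cc (edge_tgt E) a (edge_src E) -> ~ P_cc (edge_src E) a (edge_tgt E).
  by move=> h h'; apply: st; apply: (bt_anti btP (s := a)); exact: (bt_sym btP).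
move=> hs ht; case: (vcoordP E x) => -[-> hx]; case: (vcoordP E y) => -[-> hy];
  [move=> _|by move/esym/eqP; rewrite oner_eq0|by move/eqP; rewrite oner_eq0|move=> _].
  apply: (excl y hy); apply: (bt_order btP ht).
  exact: (bt_sym btP hx).
apply: (excl y) hy; apply: (bt_order btP hs).
exact: (bt_sym btP hx).
Qed.

Lemma edge_inj E F : P_cc (edge_src F) (edge_tgt F) (edge_src E) ->
  P_cc (edge_src F) (edge_tgt F) (edge_tgt E) -> E = F.
Proof.
move=> h1 h2; apply: val_inj; rewrite !edge_val.
have aF := edge_adjacent F; have st := @edge_src_tgt E.
have [e1|e1] := adjacent_cc aF h1; have [e2|e2] := adjacent_cc aF h2.
- by case: st; rewrite e1 e2.
- by rewrite e1 e2.
- by rewrite e1 e2 setUC.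
- by case: st; rewrite e1 e2.
Qed.

(** No edge divides the two ends of another one. *)
Lemma vcoord_ends E F x y : E <> F -> val F x -> val F y -> vcoord E x = vcoord E y.
Proof.
move=> EF; have h : vcoord E (edge_src F) = vcoord E (edge_tgt F).
  by apply: contrapT => /vcoord_neq_cc[h1 h2]; apply: EF; exact: edge_inj h1 h2.
by rewrite edge_val => -[->|->] [->|->].
Qed.

Lemma coord_edge E a : coord E (inr (E, a)) = val a.
Proof. by rewrite /= eqxx. Qed.

Lemma coord_other E F a x : E <> F -> val F x -> coord E (inr (F, a)) = vcoord E x.
Proof.
move=> EF Fx /=; case: eqP => [h|_]; first by case: EF.
by apply: vcoord_ends EF _ Fx; rewrite edge_val; left.
Qed.

Lemma vcoord01 E x : vcoord E x = 0 \/ vcoord E x = 1.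
Proof. by case: (vcoordP E x) => -[]; [left|right]. Qed.

Definition on_edge E s := exists a, s = inr (E, a).

Lemma coord_off E s : ~ on_edge E s -> exists2 x, ends s x & coord E s = vcoord E x.
Proof.
case: s => [x|[F a]] h; first by exists x.
have EF : E <> F by move=> EF; apply: h; exists a; rewrite EF.
exists (edge_src F); first by rewrite /= edge_val; left.
by apply: coord_other => //; rewrite edge_val; left.
Qed.

Lemma coord_off_all E s x : ~ on_edge E s -> ends s x -> coord E s = vcoord E x.
Proof.
case: s => [y|[F a]] h /=; first by move=> ->.
have EF : E <> F by move=> EF; apply: h; exists a; rewrite EF.
by move=> Fx; have := coord_other a EF Fx.
Qed.

Lemma coord_ge0 E s : 0 <= coord E s.
Proof.
case: s => [x|[F [a /= /andP[a0 a1]]]] /=; first by case: (vcoord01 E x) => ->.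
by case: ifP => _; [exact: ltW|case: (vcoord01 E (edge_src F)) => ->].
Qed.

Lemma coord_le1 E s : coord E s <= 1.
Proof.
case: s => [x|[F [a /= /andP[a0 a1]]]] /=; first by case: (vcoord01 E x) => ->.
by case: ifP => _; [exact: ltW|case: (vcoord01 E (edge_src F)) => ->].
Qed.

Lemma coord_in E s : 0 < coord E s < 1 ->
  exists a, s = inr (E, a) /\ val a = coord E s.
Proof.
move=> h; have [[a sa]|off] := pselect (on_edge E s).
  by exists a; split => //; rewrite sa coord_edge.
exfalso; have [x _ sx] := coord_off off; move: h; rewrite sx.
by case: (vcoord01 E x) => ->; rewrite ltxx ?andbF.
Qed.

Lemma on_edge_coord E s : on_edge E s -> 0 < coord E s < 1.
Proof. by move=> [[a h] ->]; rewrite coord_edge. Qed.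

Lemma coord_inj E s t : 0 < coord E s < 1 -> coord E s = coord E t -> s = t.
Proof.
move=> hs st; have ht := hs; rewrite st in ht.
have [a [ea sa]] := coord_in hs; have [b [eb tb]] := coord_in ht.
rewrite ea eb; suff -> : a = b by [].
by apply: val_inj; rewrite /= sa tb.
Qed.

Lemma same_edgeP s t : same_edge s t <-> exists E, on_edge E s /\ on_edge E t.
Proof.
split.
  by case: s => [//|[E a]]; case: t => [//|[F b]] /= <-; exists E; split; [exists a|exists b].
by move=> [E [[a ->] [b ->]]].
Qed.

Lemma endsC s x : ends s x -> (s = vtx R x) \/
  exists E a, [/\ s = inr (E, a), val E x &
    exists y, [/\ val E y, Defs.adjacent x y & val E = [set x; y]]].
Proof.
case: s => [y /= ->|[E a] /= Ex]; first by left.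
right; exists E, a; split => //; move: (Ex); rewrite edge_val => -[->|->].
  exists (edge_tgt E); split; rewrite ?edge_val //; first by right.
  exact: edge_adjacent.
exists (edge_src E); split; rewrite ?edge_val //; first by left.
  exact/adjacentC/edge_adjacent.
by rewrite setUC.
Qed.

(** The end of s on the side of t; by [facing_face] and [facing_uniq] it is
    the only choice in the definition of the segments of T. *)
Definition face s t : P :=
  match s with
  | inl x => x
  | inr (E, _) => if coord E t == 0 then edge_src E else edge_tgt E
  end.

Lemma ends_face s t : ends s (face s t).
Proof.
by case: s => [x|[E a]] //=; rewrite edge_val; case: ifP => _; [left|right].
Qed.

Lemma facing_face s t : ~ same_edge s t -> facing s t (face s t) (face t s).
Proof.
move=> nst; suff main u v : ~ same_edge u v ->
    ends u `&` P_cc (face u v) (face v u) = [set face u v].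
  split; first exact: main.
  rewrite -(main t s); last by move=> /same_edgeP[E [? ?]]; apply: nst; apply/same_edgeP; exists E.
  by apply/seteqP; split=> x [? h]; split => //; exact: (bt_sym btP h).
move=> {nst} nuv; apply/seteqP; split=> x; last first.
  by move=> ->; split; [exact: ends_face|exact: bt_l].
case=> ux h; case: u nuv ux h => [y|[E a]] nuv ux h; first exact: ux.
have off : ~ on_edge E v by move=> vE; apply: nuv; apply/same_edgeP; exists E; split=> //; exists a.
have fv := coord_off_all off (ends_face v (inr (E, a))).
move: h; rewrite /set1 /=; rewrite /= edge_val in ux.
set q := face v _ in fv *; rewrite fv.
have excl b : P_cc (edge_tgt E) b (edge_src E) -> ~ P_cc (edge_src E) b (edge_tgt E).
  move=> h h'; apply: (@edge_src_tgt E); apply: (bt_anti btP (s := b));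
  exact: (bt_sym btP).
case: (vcoordP E q) => -[-> hq]; rewrite ?eqxx ?oner_eq0.
  by case: ux => -> // /(excl _ hq).
by case: ux => -> // h; case: (excl _ h).
Qed.

Lemma facing_uniq s t p q : ~ same_edge s t -> facing s t p q ->
  p = face s t /\ q = face t s.
Proof.
move=> nst [hp hq].
suff main u v a b : ~ same_edge u v -> ends u `&` P_cc a b = [set a] ->
    ends v b -> a = face u v.
  have tq : ends t q by have : [set q] q by []; rewrite -hq => -[].
  have sp : ends s p by have : [set p] p by []; rewrite -hp => -[].
  split; first exact: main hp tq.
  apply: (main t s q p) sp.
    by move=> /same_edgeP[E [? ?]]; apply: nst; apply/same_edgeP; exists E.
  rewrite -hq; apply/seteqP; split=> x [? h]; split => //; exact: (bt_sym btP h).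
move=> nuv ha vb; have : [set a] a by [].
rewrite -{1}ha => -[ua _]; case: u nuv ha ua => [y|[E c]] nuv ha ua; first exact: ua.
have off : ~ on_edge E v by move=> vE; apply: nuv; apply/same_edgeP; exists E; split=> //; exists c.
rewrite /face (coord_off_all off vb).
have Es : val E (edge_src E) by rewrite edge_val; left.
have Et : val E (edge_tgt E) by rewrite edge_val; right.
have aonly x : val E x -> P_cc a b x -> x = a.
  move=> Ex h; have : (ends (inr (E, c) : T) `&` P_cc a b) x by [].
  by rewrite ha.
rewrite /= edge_val in ua.
case: (vcoordP E b) => -[-> hb]; rewrite ?eqxx ?oner_eq0; case: ua => // ea.
  by rewrite (aonly (edge_src E)) // ea.
by rewrite (aonly (edge_tgt E)) // ea.
Qed.

Lemma T_oo_off s t r : ~ same_edge s t -> T_oo s t r <->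
  [\/ edge_to s (face s t) r, edge_to t (face t s) r |
   [/\ P_span (face s t) (face t s) r, r <> s & r <> t]].
Proof.
move=> nst; split.
  move=> [[//]|[_ [p [q [fpq]]]]].
  by have [-> ->] := facing_uniq nst fpq.
by move=> h; right; split => //; exists (face s t), (face t s); split => //; exact: facing_face.
Qed.

(** This lemma and [T_cc_edge] replace the definition of T_cc by one condition on
    vertices and one on the interior points of edges. *)
Lemma T_cc_vtx s t z : T_cc s t (vtx R z) <->
  ~ same_edge s t /\ P_cc (face s t) (face t s) z.
Proof.
have [st|nst] := pselect (same_edge s t).
  split=> [|[]//]; move: st => /same_edgeP[E [[a ->] [b ->]]].
  by case=> [[[_ [c _ //]]|[ne _]]|[//|//]]; case: ne.
split.
  have bl := bt_l btP (face s t) (face t s); have br := bt_r btP (face s t) (face t s).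
  case=> [/(T_oo_off _ nst)[]|[h|h]].
  - by case: s {nst bl br} => [x []|[E a] [c _]].
  - by case: t {nst bl br} => [x []|[E a] [c _]].
  - by move=> [h _ _]; split => //; exact: h.
  - by split => //; move: bl; rewrite -h.
  - by split => //; move: br; rewrite -h.
move=> [_ h].
have [->|zs] := pselect (vtx R z = s); first by right; left.
have [->|zt] := pselect (vtx R z = t); first by right; right.
left; apply/(T_oo_off _ nst); constructor 3; split => //.
by move=> x /= ->.
Qed.

Definition between (a b c : R) := (a <= c <= b) || (b <= c <= a).

Lemma betweenl a b : between a b a.
Proof. by rewrite /between lexx andbT /=; exact: le_total. Qed.

Lemma betweenC a b c : between a b c = between b a c.
Proof. by rewrite /between orbC. Qed.

Lemma betweenr a b : between a b b.
Proof. by rewrite betweenC betweenl. Qed.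

Lemma T_cc_edge s t E a : T_cc s t (inr (E, a)) <->
  between (coord E s) (coord E t) (val a).
Proof.
have ha : 0 < val a < 1 by case: a.
have eqE u : val a = coord E u -> inr (E, a) = u.
  by move=> h; apply: (@coord_inj E); rewrite coord_edge.
have [/same_edgeP[F [[b sb] [c tc]]]|nst] := pselect (same_edge s t).
  subst s t; split.
    case=> [[[_ [e [_ h] [FE ea]]]|[ne _]]|[[FE ea]|[FE ea]]]; last 2 first.
    - by rewrite FE ea !coord_edge betweenl.
    - by rewrite FE ea !coord_edge betweenr.
    - rewrite -FE -ea !coord_edge /between.
      by case: h => /andP[/ltW -> /ltW ->]; rewrite ?orbT.
    - by case: ne.
  have [<-|FE] := pselect (F = E); last first.
    rewrite /between /=; case: eqP => // _ h; exfalso.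
    have e : val a = vcoord E (edge_src F).
      by apply/eqP; rewrite eq_le; case/orP: h => /andP[-> ->].
    by move: ha; rewrite e; case: (vcoord01 E (edge_src F)) => ->; rewrite ltxx ?andbF.
  rewrite /between /= eqxx => h.
  have [ab|ab] := eqVneq (val a) (val b).
    by right; left; congr (inr (F, _)); apply: val_inj.
  have [ac|ac] := eqVneq (val a) (val c).
    by right; right; congr (inr (F, _)); apply: val_inj.
  left; left; split => //; exists a => //; split => //.
  rewrite !lt_neqAle ac ab (eq_sym (val b)) (eq_sym (val c)) ab ac /=.
  by case/orP: h => ->; [left|right].
have Es : val E (edge_src E) by rewrite edge_val; left.
have Et : val E (edge_tgt E) by rewrite edge_val; right.
(* the case of two points u on E and v off E *)
have onP u v c : ~ same_edge u v -> u = inr (E, c) ->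
    [\/ edge_to u (face u v) (inr (E, a)), edge_to v (face v u) (inr (E, a)) |
     [/\ P_span (face u v) (face v u) (inr (E, a)), inr (E, a) <> u & inr (E, a) <> v]]
    <-> between (val c) (coord E v) (val a) /\ val a <> val c.
  move=> nuv uc.
  have off : ~ on_edge E v.
    by move=> vE; apply: nuv; apply/same_edgeP; exists E; split=> //; exists c.
  have [hp _] := facing_face nuv.
  have vc := coord_off_all off (ends_face v u).
  have hc : 0 < val c < 1 by case: (c).
  split.
    case.
    - rewrite uc /= vc => -[e h [<-]]; move: h.
      case: (vcoord01 E (face v u)) => ->; rewrite ?eqxx ?oner_eq0.
        move=> [[_ ec]|[/edge_src_tgt//]]; rewrite /between; split.
          by apply/orP; right; apply/andP; split; [case/andP: (valP e) => /ltW|exact: ltW].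
        by move=> h; rewrite h ltxx in ec.
      move=> [[/esym/edge_src_tgt//]|[_ ec]]; rewrite /between; split.
        by apply/orP; left; apply/andP; split; [exact: ltW|case/andP: (valP e) => _ /ltW].
      by move=> h; rewrite h ltxx in ec.
    - move=> h; exfalso; apply: off; move: h.
      by case: (v) => [//|[F b]] /= [e _ [<- _]]; exists b.
    - move=> [h _ _]; exfalso.
      have h1 : [set face u v] (edge_src E) by rewrite -hp; split; [rewrite uc|exact: h].
      have h2 : [set face u v] (edge_tgt E) by rewrite -hp; split; [rewrite uc|exact: h].
      by apply: (@edge_src_tgt E); rewrite h1 h2.
  move=> [h ac]; constructor 1; rewrite uc /= vc; exists a => //.
  move: h; rewrite vc /between; have ac' : val a != val c by exact/eqP.
  case/andP: ha => a0 a1; case/andP: hc => c0 c1.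
  case: (vcoord01 E (face v u)) => ->; rewrite ?eqxx ?oner_eq0.
    move=> /orP[/andP[_]|/andP[_ h]]; first by rewrite leNgt a0.
    by left; split => //; rewrite lt_neqAle ac'.
  move=> /orP[/andP[h _]|/andP[]]; last by rewrite leNgt a1.
  by right; split => //; rewrite lt_neqAle eq_sym ac'.
have [[c sc]|soff] := pselect (on_edge E s).
  split.
    case=> [/(T_oo_off _ nst)/(onP _ _ _ nst sc)[h _]|[ea|ea]].
    - by rewrite sc coord_edge.
    - by rewrite -ea coord_edge betweenl.
    - by rewrite -ea coord_edge betweenr.
  rewrite sc coord_edge -sc => h.
  have [e|ac] := pselect (val a = val c).
    by right; left; rewrite sc; congr (inr (E, _)); exact: val_inj.
  by left; apply/(T_oo_off _ nst)/(onP _ _ _ nst sc).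
have nts : ~ same_edge t s.
  by move=> /same_edgeP[F [? ?]]; apply: nst; apply/same_edgeP; exists F.
have [[c tc]|toff] := pselect (on_edge E t).
  split.
    case=> [/(T_oo_off _ nst) h|[ea|ea]].
    - have /(onP _ _ _ nts tc)[h' _] :
        [\/ edge_to t (face t s) (inr (E, a)), edge_to s (face s t) (inr (E, a)) |
         [/\ P_span (face t s) (face s t) (inr (E, a)), inr (E, a) <> t & inr (E, a) <> s]].
        case: h => [h|h|[h h1 h2]]; [by constructor 2|by constructor 1|constructor 3].
        by split => // x /h; exact: (bt_sym btP).
      by rewrite tc coord_edge betweenC.
    - by rewrite -ea coord_edge betweenl.
    - by rewrite -ea coord_edge betweenr.
  rewrite tc coord_edge betweenC -tc => h.
  have [e|ac] := pselect (val a = val c).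
    by right; right; rewrite tc; congr (inr (E, _)); exact: val_inj.
  left; apply/(T_oo_off _ nst); have [h'|h'|[h' h1 h2]] :=
    (onP _ _ _ nts tc).2 (conj h ac); [by constructor 2|by constructor 1|constructor 3].
  by split => // x /h'; exact: (bt_sym btP).
have sf := coord_off_all soff (ends_face s t).
have tf := coord_off_all toff (ends_face t s).
split.
  case=> [/(T_oo_off _ nst) h|[ea|ea]]; last 2 first.
  - by case: soff; exists a.
  - by case: toff; exists a.
  case: h => [h|h|[h _ _]].
  - by exfalso; apply: soff; move: h; case: (s) => [//|[F b]] /= [e _ [<- _]]; exists b.
  - by exfalso; apply: toff; move: h; case: (t) => [//|[F b]] /= [e _ [<- _]]; exists b.
  have := cc_vcoord_neq (h _ Es) (h _ Et); rewrite -sf -tf sf tf.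
  case/andP: ha => /ltW a0 /ltW a1.
  by case: (vcoord01 E (face s t)) => ->; case: (vcoord01 E (face t s)) => -> //;
    rewrite /between a0 a1 ?orbT.
rewrite sf tf => h; left; apply/(T_oo_off _ nst); constructor 3; split.
- have /vcoord_neq_cc[h1 h2] : vcoord E (face s t) <> vcoord E (face t s).
    move=> e; move: h; rewrite -e /between orbb => h.
    have : val a = vcoord E (face s t) by apply/eqP; rewrite eq_le; case/andP: h => -> ->.
    move=> e'; move: ha; rewrite e'.
    by case: (vcoord01 E (face s t)) => ->; rewrite ltxx ?andbF.
  by move=> x /=; rewrite edge_val => -[->|->].
- by move=> e; apply: soff; exists a.
- by move=> e; apply: toff; exists a.
Qed.

End Edges.

(** * The tree satisfies the betweenness axioms *)
Section TreeAxioms.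
Variables (R : realType) (X : metricType R).
Hypothesis contX : continuum X.
Local Notation P := (cp_class X).
Local Notation T := (cp_tree R X).
Implicit Types (x y z w p q : P) (E F G : edge X) (s t u v : T).
Let btP := P_betweenness contX.

(** The faces of s and t depend on both points, which obstructs the axioms that
    involve a third one.  Here x and y may be any ends, so that the axioms of P
    carry over. *)
Lemma T_cc_vtxE s t z : T_cc s t (vtx R z) <->
  [\/ vtx R z = s, vtx R z = t | exists x y, [/\ ends s x, ends t y & P_oo x y z]].
Proof.
split.
  move=> /(T_cc_vtx contX)[nst h].
  have [zs|zs] := pselect (vtx R z = s); first by constructor 1.
  have [zt|zt] := pselect (vtx R z = t); first by constructor 2.
  constructor 3.
  have [hp hq] := facing_face contX nst; move: h hp hq.
  have := ends_face t s; have := ends_face s t.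
  move: (face s t) (face t s) => p q sp tq h hp hq.
  have other u x : ends u x -> vtx R x <> u -> exists y, [/\ ends u y, Defs.adjacent x y & ends u = [set x; y]].
    move=> ux xu; have [/esym//|[E [a [-> Ex [y [Ey xy Exy]]]]]] := endsC ux.
    by exists y; split.
  have [zp|zp] := pselect (z = p).
    subst z; have [p' [sp' pp' _]] := other _ _ sp zs.
    have np' : ~ P_cc p q p'.
      move=> h'; have : [set p] p' by rewrite -hp.
      by case: pp' => pp' _ /= e; apply: pp'; rewrite e.
    have [pq|pq] := pselect (p = q).
      subst q; have [q' [tq' pq' tE]] := other _ _ tq zt.
      exists p', q'; split => //; apply/P_oo_cc; split.
      - have [h'|//] := adjacent_split contX q' pp'.
        have [e|e] := adjacent_cc pq' h'; first by case: pp' => /(_ (esym e)).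
        exfalso; apply: nst.
        have [e1|[E [a [sE Ep [y [Ey py Epy]]]]]] := endsC sp; first by case: zs.
        have [e2|[F [b [tF Fp [y2 [Fy2 py2 Fpy]]]]]] := endsC tq; first by case: zt.
        apply/same_edgeP; exists E; split; first by exists a.
        suff -> : E = F by exists b.
        apply: val_inj; rewrite Epy Fpy.
        move: sp' tq'; rewrite sE tF /= Epy Fpy => -[e3|e3]; first by case: pp' => /(_ (esym e3)).
        case=> e4; first by case: pq' => /(_ (esym e4)).
        by rewrite -e3 -e4 e.
      - by case: pp'.
      - by case: pq'.
    exists p', q; split => //; apply/P_oo_cc; split => //; last by case: pp'.
    by have [/np'|] := adjacent_split contX q pp'.
  have [zq|zq] := pselect (z = q).
    subst z; have [q' [tq' qq' _]] := other _ _ tq zt.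
    have nq' : ~ P_cc p q q'.
      move=> h'; have : [set q] q' by rewrite -hq.
      by case: qq' => qq' _ /= e; apply: qq'; rewrite e.
    exists p, q'; split => //; apply/P_oo_cc; split => //; last by case: qq'.
    have [h'|h'] := adjacent_split contX p qq'; last exact: (bt_sym btP).
    by case: nq'; exact: (bt_sym btP).
  by exists p, q; split => //; apply/P_oo_cc.
move=> [->|->|[x [y [sx ty h]]]]; [by right; left|by right; right|].
have [zx zy xy] := P_oo_neq h.
have nst : ~ same_edge s t.
  move=> /same_edgeP[E [[a sE] [b tE]]].
  move: sx ty; rewrite sE tE /= edge_val => Ex Ey.
  have aE := edge_adjacent E; have aE' := adjacentC aE.
  case: Ex => ex; case: Ey => ey; rewrite ex ey in h xy => //.
    by case: aE => _ e; rewrite e in h.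
  by case: aE' => _ e; rewrite e in h.
apply/(T_cc_vtx contX); split => //.
have step u v x' y' : ~ same_edge u v -> ends u x' -> P_cc x' y' z ->
    z <> x' -> P_cc (face u v) y' z.
  move=> nuv ux' h' zx'.
  have [<- //|xf] := pselect (x' = face u v).
  have adj : Defs.adjacent x' (face u v).
    have uf := ends_face u v; case: u ux' uf {nuv} xf => [w /= -> _ //|[E a]] /=.
    rewrite edge_val; have aE := edge_adjacent E; have aE' := adjacentC aE.
    by move=> [->|->] [->|->].
  have [h1|//] := bt_tri btP (face u v) h'.
  by have [//|->] := adjacent_cc adj h1; exact: bt_l.
have nts : ~ same_edge t s.
  by move=> /same_edgeP[E [? ?]]; apply: nst; apply/same_edgeP; exists E.
have h1 : P_cc (face s t) y z.
  by apply: (step _ _ x) => //; apply/P_ccP; constructor 1.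
apply: (bt_sym btP); apply: (step _ _ y) => //.
exact: (bt_sym btP).
Qed.

Lemma ends_other s z : s <> vtx R z -> exists2 x, ends s x & x <> z.
Proof.
case: s => [x xz|[E a] _]; first by exists x => // e; apply: xz; rewrite e.
have [sz|sz] := pselect (edge_src E = z).
  exists (edge_tgt E); first by rewrite /= edge_val; right.
  by rewrite -sz => /esym; exact: edge_src_tgt.
by exists (edge_src E) => //=; rewrite edge_val; left.
Qed.

Lemma T_cc_sym s t u : T_cc s t u -> T_cc t s u.
Proof.
case: u => [z|[E a]]; last by rewrite !(T_cc_edge contX) betweenC.
move=> /T_cc_vtxE h; apply/T_cc_vtxE; case: h => [->|->|[x [y [sx ty h]]]].
- by constructor 2.
- by constructor 1.
- by constructor 3; exists y, x; split => //; exact: P_oo_sym.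
Qed.

Lemma T_cc_tri s t u v : T_cc s t u -> T_cc s v u \/ T_cc v t u.
Proof.
case: u => [z|[E a]]; last first.
  rewrite !(T_cc_edge contX) /between.
  move: (coord E s) (coord E t) (coord E v) (val a) => p q r c.
  case/orP => /andP[h1 h2]; have /orP[h|h] := le_total r c.
  - by right; rewrite h h2.
  - by left; rewrite h1 h.
  - by left; rewrite h h2 orbT.
  - by right; rewrite h1 h orbT.
move=> /T_cc_vtxE[<-|<-|[x [y [sx ty h]]]]; [by left; right; left|by right; right; right|].
have [->|vz] := pselect (v = vtx R z); first by left; right; right.
have [w vw wz] := ends_other vz.
have [h'|h'] := P_oo_or contX h wz; [left|right]; apply/T_cc_vtxE; constructor 3.
  by exists x, w.
by exists w, y.
Qed.

Lemma T_cc_xx s u : T_cc s s u -> u = s.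
Proof.
case: u => [z|[E a]].
  move=> /T_cc_vtxE[//|//|[x [y [sx sy h]]]]; exfalso.
  have [_ _ xy] := P_oo_neq h.
  case: s sx sy => [w /= xw yw|[E a]] /=; first by apply: xy; rewrite xw yw.
  rewrite edge_val; have aE := edge_adjacent E; have aE' := adjacentC aE.
  move=> [ex|ex] [ey|ey]; rewrite ex ey in h xy => //.
    by case: aE => _ e; rewrite e in h.
  by case: aE' => _ e; rewrite e in h.
move=> /(T_cc_edge contX); rewrite /between orbb => h.
have e : coord E s = val a by apply/eqP; rewrite eq_le.
apply: (@coord_inj R X contX E); rewrite coord_edge ?e //.
by case: (a).
Qed.

(** Antisymmetry when one of the two points is inside an edge E.  For t off E,
    the point (E, a) of [s, t] separates s from t along E, so that t cannot lie
    in [s, (E, a)]. *)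
Lemma T_cc_anti_edge s t E a : T_cc s t (inr (E, a)) -> T_cc s (inr (E, a)) t ->
  inr (E, a) = t.
Proof.
move=> h1 h2; have /(T_cc_edge contX) b1 := h1.
have ha : 0 < val a < 1 by case: (a).
have [[b tb]|toff] := pselect (on_edge E t).
  subst t; move: h2 => /(T_cc_edge contX); move: b1; rewrite !coord_edge.
  move=> b1 b2; suff /val_inj -> : val a = val b by [].
  move: b1 b2; rewrite /between; set c := coord E s; move: (val a) (val b) => a' b'.
  move=> /orP[] /andP[p1 p2] /orP[] /andP[p3 p4]; lra.
exfalso.
have tc x : ends t x -> coord E t = vcoord E x by exact: (coord_off_all contX).
have Es : val E (edge_src E) by rewrite edge_val; left.
have Et : val E (edge_tgt E) by rewrite edge_val; right.
have neq : coord E s <> coord E t.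
  move=> e; move: b1; rewrite e /between orbb => /andP[h h'].
  have e' : val a = coord E t by apply/eqP; rewrite eq_le h h'.
  apply: toff; have [|b [-> _]] := @coord_in R X contX E t; first by rewrite -e'.
  by exists b.
have [[b sb]|soff] := pselect (on_edge E s).
  have same : same_edge s (inr (E, a)) by apply/same_edgeP; exists E; split; [exists b|exists a].
  case: t h1 h2 toff tc neq b1 => [z|[F c]] h1 h2 toff tc neq b1.
    by move: h2 => /(T_cc_vtx contX)[].
  have FE : F <> E by move=> e; apply: toff; exists c; rewrite e.
  move: h2 => /(T_cc_edge contX); rewrite sb.
  rewrite (coord_other contX a FE Es) (coord_other contX b FE Es) /between orbb.
  move=> /andP[p1 p2]; have e : val c = vcoord F (edge_src E) by apply/eqP; rewrite eq_le p1 p2.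
  have : 0 < val c < 1 by case: (c).
  by rewrite e; case: (vcoord01 contX F (edge_src E)) => ->; rewrite ltxx ?andbF.
have sc x : ends s x -> coord E s = vcoord E x by exact: (coord_off_all contX).
have sub x y : ends s x -> ends t y -> P_cc x y (edge_src E) /\ P_cc x y (edge_tgt E).
  by move=> sx ty; apply: (vcoord_neq_cc contX); rewrite -(sc x sx) -(tc y ty).
have subE x y g : ends s x -> ends t y -> val E g -> P_cc x y g.
  by move=> sx ty; rewrite edge_val; have [? ?] := sub x y sx ty; case=> ->.
case: t h1 h2 toff tc neq b1 sub subE => [z|[F c]] h1 h2 toff tc neq b1 sub subE.
  move: h2 => /T_cc_vtxE[zs|//|[x [y [sx Ey h]]]].
    by apply: neq; rewrite -zs.
  have [_ zy _] := P_oo_neq h; apply: zy.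
  have /P_oo_cc[h' _ _] := h.
  have h3 := subE x z y sx erefl Ey.
  exact: (bt_anti btP h' h3).
have FE : F <> E by move=> e; apply: toff; exists c; rewrite e.
have Fs : val F (edge_src F) by rewrite edge_val; left.
have Ft : val F (edge_tgt F) by rewrite edge_val; right.
have [[b sb]|soff'] := pselect (on_edge F s).
  apply: neq; rewrite sb (coord_other contX _ (nesym FE) Fs).
  by rewrite (coord_other contX _ (nesym FE) Fs).
have [x sx _] := coord_off contX soff'.
have sx' := coord_off_all contX soff' sx.
have neqF g : val E g -> vcoord F x <> vcoord F g.
  move=> Eg e; move: h2 => /(T_cc_edge contX); rewrite sx' (coord_other contX a FE Eg) e.
  rewrite /between orbb => /andP[p1 p2].
  have e' : val c = vcoord F g by apply/eqP; rewrite eq_le p1 p2.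
  have : 0 < val c < 1 by case: (c).
  by rewrite e'; case: (vcoord01 contX F g) => ->; rewrite ltxx ?andbF.
have subF g f : val E g -> val F f -> P_cc x g f.
  move=> Eg; rewrite edge_val; have [? ?] := vcoord_neq_cc contX (neqF g Eg).
  by case=> ->.
have same g : val E g -> g = edge_src F.
  move=> Eg; exact: (bt_anti btP (subE x _ g sx Fs Eg) (subF g _ Eg Fs)).
exact: (edge_src_tgt (etrans (same _ Es) (esym (same _ Et)))).
Qed.

Lemma T_betweenness : betweenness (@T_cc R X).
Proof.
split.
- by move=> s t; right; left.
- exact: T_cc_sym.
- exact: T_cc_xx.
- exact: T_cc_tri.
- move=> s t [z|[E a]] h1 h2; last exact: T_cc_anti_edge h1 h2.
  case: t h1 h2 => [w|[E a]] h1 h2; last exact/esym/(T_cc_anti_edge h2 h1).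
  apply: contrapT => zw.
  have zw' : z <> w by move=> e; apply: zw; rewrite e.
  have := h1 => /T_cc_vtxE[zs|//|[x [y [sx /= -> hx]]]].
    apply: zw; apply/esym; apply: (@T_cc_xx (vtx R z) (vtx R w)).
    by rewrite {1}zs.
  have := h2 => /T_cc_vtxE[ws|[/esym//]|[x' [y' [sx' /= -> hx']]]].
    by apply: zw; apply: (@T_cc_xx (vtx R w) (vtx R z)); rewrite {1}ws.
  have [e|xx'] := pselect (x = x'); first by rewrite e in hx; case: (P_oo_anti contX hx hx').
  have adj : Defs.adjacent x x'.
    case: s sx sx' {h1 h2} => [v /= xv xv'|[E a]] /=; first by case: xx'; rewrite xv xv'.
    rewrite edge_val; have aE := edge_adjacent E; have aE' := adjacentC aE.
    by move=> [ex|ex] [ex'|ex']; rewrite ex ex' // in xx' *.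
  have [_ _ e] := P_oo_neq hx'.
  have [h|h] := P_oo_or contX hx e.
    by case: adj => _ e'; rewrite e' in h.
  exact: (P_oo_anti contX h hx').
Qed.

End TreeAxioms.

(** * Density and completeness of the segments of the tree *)
Section TreeOrder.
Variables (R : realType) (X : metricType R).
Hypothesis contX : continuum X.
Local Notation P := (cp_class X).
Local Notation T := (cp_tree R X).
Implicit Types (x y z p q : P) (E F G : edge X) (s t u v w : T).
Let btP := P_betweenness contX.
Let btT := T_betweenness contX.

Definition edge_pt E (a : R) (h : 0 < a < 1) : T := inr (E, exist _ a h).

Lemma on_edge_pt E a h : on_edge E (@edge_pt E a h).
Proof. by exists (exist (fun t : R => 0 < t < 1) a h). Qed.

Lemma coord_edge_pt E a h : coord E (@edge_pt E a h) = a.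
Proof. by rewrite coord_edge. Qed.

Lemma T_cc_edge_pt s t E a h : between (coord E s) (coord E t) a ->
  T_cc s t (@edge_pt E a h).
Proof. by move=> b; apply/(T_cc_edge contX). Qed.

Lemma T_cc_vtx_P_cc x y z : T_cc (vtx R x) (vtx R y) (vtx R z) <-> P_cc x y z.
Proof.
split; first by move=> /(T_cc_vtx contX)[].
by move=> h; apply/(T_cc_vtx contX); split.
Qed.

(** If coord E u were outside the range, some point of the edge E would lie in
    [s, u] and in [u, t], which meet only in u. *)
Lemma coord_between E s t u : T_cc s t u -> between (coord E s) (coord E t) (coord E u).
Proof.
move=> stu; apply: contrapT => nb.
have [a [h ns nt nu]] : exists a, [/\ 0 < a < 1,
   between (coord E s) (coord E u) a, between (coord E u) (coord E t) a & a <> coord E u].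
  have := coord_ge0 contX E s; have := coord_le1 contX E s; have := coord_ge0 contX E t.
  have := coord_le1 contX E t; have := coord_ge0 contX E u; have := coord_le1 contX E u.
  move: nb; rewrite /between.
  move: (coord E s) (coord E t) (coord E u) => p q r nb r1 r0 q1 q0 p1 p0.
  have [pq|qp] := leP p q.
    have [rp|pr] := ltP r p; first by exists ((r + p) / 2); split; [apply/andP; split|apply/orP; right; apply/andP; split|apply/orP; left; apply/andP; split|]; lra.
    have [qr|rq] := ltP q r; first by exists ((r + q) / 2); split; [apply/andP; split|apply/orP; left; apply/andP; split|apply/orP; right; apply/andP; split|]; lra.
    by case: nb; rewrite pr rq.
  have [rp|pr] := ltP r q; first by exists ((r + q) / 2); split; [apply/andP; split|apply/orP; right; apply/andP; split|apply/orP; left; apply/andP; split|]; lra.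
  have [qr|rq] := ltP p r; first by exists ((r + p) / 2); split; [apply/andP; split|apply/orP; left; apply/andP; split|apply/orP; right; apply/andP; split|]; lra.
  by case: nb; rewrite pr rq orbT.
apply: nu; rewrite -[LHS](coord_edge_pt E h); congr coord.
apply: (bt_meet btT stu); first exact: T_cc_edge_pt.
exact: T_cc_edge_pt.
Qed.

Lemma T_dense s t : s <> t -> exists u, [/\ T_cc s t u, u <> s & u <> t].
Proof.
move=> st; have [[E Est]|allE] := pselect (exists E, coord E s <> coord E t).
  have [a [h b as_ at_]] : exists a, [/\ 0 < a < 1, between (coord E s) (coord E t) a,
      a <> coord E s & a <> coord E t].
    have := coord_ge0 contX E s; have := coord_le1 contX E s; have := coord_ge0 contX E t.
    have := coord_le1 contX E t; move: Est; rewrite /between.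
    move: (coord E s) (coord E t) => p q pq q1 q0 p1 p0; exists ((p + q) / 2).
    have [h|h] := ltP p q; first by split; [apply/andP; split|apply/orP; left; apply/andP; split| |]; lra.
    have {}h : q < p by rewrite lt_neqAle h andbT; apply/eqP => /esym.
    by split; [apply/andP; split|apply/orP; right; apply/andP; split| |]; lra.
  exists (edge_pt E h); split; first exact: T_cc_edge_pt.
    by move=> e; apply: as_; rewrite -e coord_edge_pt.
  by move=> e; apply: at_; rewrite -e coord_edge_pt.
have coordE E : coord E s = coord E t by apply: contrapT => e; apply: allE; exists E.
have vtxs u v : u <> v -> (forall E, coord E u = coord E v) -> exists x, u = vtx R x.
  case: u => [x|[E a]] uv h; first by exists x.
  case: uv; apply: (coord_inj contX _ (h E)); rewrite coord_edge; by case: a h.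
have [x sx] := vtxs s t st coordE.
have [y ty] := vtxs t s (nesym st) (fun E => esym (coordE E)).
subst s t; have xy : x <> y by move=> e; apply: st; rewrite e.
have [[z h]|nz] := pselect (exists z, P_oo x y z).
  have /P_oo_cc[h' zx zy] := h; exists (vtx R z); split; first exact/T_cc_vtx_P_cc.
    by case.
  by case.
have adj : Defs.adjacent x y.
  by split => //; apply/seteqP; split=> // z h; apply: nz; exists z.
have [E Exy] := adjacent_edge adj.
exfalso; have := coordE E => /=; have := vcoord_src contX E; have := vcoord_tgt contX E.
by have [[-> ->]|[-> ->]] := edge_ext Exy => -> -> /eqP; rewrite ?oner_eq0 // eq_sym oner_eq0.
Qed.

(** Reduces questions about segments to segments between vertices. *)
Lemma T_extend s t : exists x y, T_cc (vtx R x) (vtx R y) s /\ T_cc (vtx R x) (vtx R y) t.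
Proof.
have ext u v : exists x, T_cc (vtx R x) v u.
  case: u => [x|[E a]]; first by exists x; exact: bt_l.
  have [h|h] := leP (coord E v) (val a).
    exists (edge_tgt E); apply/(T_cc_edge contX).
    rewrite (_ : coord E (vtx R _) = 1); last exact: vcoord_tgt.
    by apply/orP; right; rewrite h; case/andP: (valP a) => _ /ltW.
  exists (edge_src E); apply/(T_cc_edge contX).
  rewrite (_ : coord E (vtx R _) = 0); last exact: vcoord_src.
  by apply/orP; left; rewrite (ltW h) andbT; case/andP: (valP a) => /ltW.
have [x h] := ext s t; have [y h'] := ext t (vtx R x).
exists x, y; split; last exact: (bt_sym btT).
by apply: (bt_trans btT) h; exact: (bt_sym btT).
Qed.

Lemma edge_seg E x y u : val E = [set x; y] -> T_cc (vtx R x) (vtx R y) u ->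
  [\/ u = vtx R x, u = vtx R y | on_edge E u].
Proof.
move=> Exy; case: u => [z|[F a]].
  move=> /T_cc_vtx_P_cc; have := edge_adjacent E.
  have [[-> ->]|[-> ->]] := edge_ext Exy => adj h.
    by have [->|->] := adjacent_cc adj h; [constructor 1|constructor 2].
  by have [->|->] := adjacent_cc (adjacentC adj) h; [constructor 1|constructor 2].
move=> /(T_cc_edge contX) h; constructor 3.
have [->|FE] := pselect (F = E); first by exists a.
exfalso; move: h => /=.
rewrite (@vcoord_ends R X contX F E x y FE); last 2 first.
- by rewrite Exy; left.
- by rewrite Exy; right.
rewrite /between orbb => /andP[p1 p2].
have e : val a = vcoord F y by apply/eqP; rewrite eq_le p1 p2.
have : 0 < val a < 1 by case: (a).
by rewrite e; case: (vcoord01 contX F y) => ->; rewrite ltxx ?andbF.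
Qed.

(** A gap in a segment of T between two vertices, to be refuted by [T_gap]. *)
Section Gap.
Variables (a b : P) (L : set T).
Let cc := @T_cc R X.
Let ccl s t : cc s t s := bt_l btT s t.
Let ccr s t : cc s t t := bt_r btT s t.
Hypothesis Lab : L `<=` cc (vtx R a) (vtx R b).
Hypothesis La : L (vtx R a).
Hypothesis Lb : ~ L (vtx R b).
Hypothesis Ldown : forall u v, L v -> cc (vtx R a) v u -> L u.
Hypothesis Lmax : forall u, L u -> exists v, [/\ L v, u <> v & cc (vtx R a) v u].
Hypothesis Umin : forall v, cc (vtx R a) (vtx R b) v -> ~ L v ->
  exists u, [/\ cc (vtx R a) (vtx R b) u, ~ L u, u <> v & cc (vtx R a) v u].

(** The gap cannot be inside an edge, which is order isomorphic to an interval
    of real numbers: the supremum of the parameters of L is the parameter of a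
    last point of L or of a first point after L. *)
Let straddle E x y : val E = [set x; y] -> L (vtx R x) -> ~ L (vtx R y) ->
  cc (vtx R a) (vtx R b) (vtx R y) -> cc (vtx R a) (vtx R y) (vtx R x) -> False.
Proof.
move=> Exy Lx Ly aby ayx.
pose h u : R := if coord E (vtx R x) == 0 then coord E u else 1 - coord E u.
have h01 u : 0 <= h u <= 1.
  have := coord_ge0 contX E u; have := coord_le1 contX E u; rewrite /h.
  by case: ifP => _ h1 h0; apply/andP; split; lra.
have [hx hy] : h (vtx R x) = 0 /\ h (vtx R y) = 1.
  rewrite /h /=; have := vcoord_src contX E; have := vcoord_tgt contX E.
  have [[-> ->]|[-> ->]] := edge_ext Exy => -> ->; rewrite ?eqxx ?oner_eq0 //.
  by rewrite subrr subr0.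
have hon u : 0 < h u < 1 -> 0 < coord E u < 1.
  by rewrite /h; case: ifP => // _ /andP[h0 h1]; apply/andP; split; lra.
have hcoord u v : h u = h v -> coord E u = coord E v.
  by rewrite /h; case: ifP => // _ e; lra.
pose seg := cc (vtx R x) (vtx R y).
have hinj u v : seg u -> seg v -> h u = h v -> u = v.
  move=> Su Sv huv; have e := hcoord _ _ huv.
  have on w : on_edge E w -> 0 < coord E w < 1 by exact: on_edge_coord.
  have ux : coord E (vtx R x) = 0 \/ coord E (vtx R x) = 1 by exact: vcoord01.
  have uy : coord E (vtx R y) = 0 \/ coord E (vtx R y) = 1 by exact: vcoord01.
  have nxy : coord E (vtx R x) <> coord E (vtx R y).
    move=> e'; have : h (vtx R x) = h (vtx R y) by rewrite /h e'.
    by rewrite hx hy => /eqP; rewrite eq_sym oner_eq0.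
  have [ux'|uy'|uE] := edge_seg Exy Su; last exact: (coord_inj contX (on _ uE) e).
    have [vx|vy|vE] := edge_seg Exy Sv; last exact/esym/(coord_inj contX (on _ vE) (esym e)).
      by rewrite ux' vx.
    by exfalso; apply: nxy; rewrite -ux' -vy.
  have [vx|vy|vE] := edge_seg Exy Sv; last exact/esym/(coord_inj contX (on _ vE) (esym e)).
    by exfalso; apply: nxy; rewrite -uy' -vx e.
  by rewrite uy' vy.
have hmono u v : seg v -> cc (vtx R x) v u -> h u <= h v.
  move=> Sv /(coord_between E); rewrite /between.
  have := coord_ge0 contX E v; have := coord_le1 contX E v; move: hx; rewrite /h.
  case: ifP => _ h0 v1 v0; rewrite ?h0.
    by move=> /orP[/andP[]//|/andP[h1 h2]]; lra.
  by move=> /orP[/andP[h1 h2]|/andP[h1 h2]]; lra.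
have hsurj (c : R) : 0 <= c <= 1 -> exists2 w, seg w & h w = c.
  move=> /andP[c0 c1].
  have [->|cn0] := eqVneq c 0; first by exists (vtx R x) => //; exact: ccl _ _.
  have [->|cn1] := eqVneq c 1; first by exists (vtx R y) => //; exact: ccr _ _.
  have c01 : 0 < c < 1 by rewrite !lt_neqAle eq_sym cn0 cn1 c0 c1.
  pose c' := if coord E (vtx R x) == 0 then c else 1 - c.
  have c'01 : 0 < c' < 1.
    rewrite /c'; case: ifP => // _; move: c01 => /andP[h0 h1]; apply/andP; split; lra.
  exists (edge_pt E c'01).
    apply: T_cc_edge_pt; move: hx hy; rewrite /h /between /c'.
    move: c01 => /andP[h0 h1]; case: ifP => _ hx hy.
      by rewrite hx hy (ltW h0) (ltW h1).
    have -> : coord E (vtx R x) = 1 by lra.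
    have -> : coord E (vtx R y) = 0 by lra.
    by apply/orP; right; rewrite subr_ge0 gerBl (ltW h0) (ltW h1).
  by rewrite /h coord_edge_pt /c'; case: (coord E _ == 0); rewrite ?subKr.
pose A := [set h u | u in L `&` seg].
have Ax : A 0 by exists (vtx R x) => //; split => //; exact: ccl _ _.
have supA : has_sup A.
  by split; [exists 0|exists 1 => r [u _ <-]; case/andP: (h01 u)].
have [w Sw hw] : exists2 w, seg w & h w = sup A.
  apply: hsurj; apply/andP; split; first exact: ub_le_sup supA.2 _ Ax.
  by apply: ge_sup => [|r [u _ <-]]; [exact: supA.1|case/andP: (h01 u)].
have abx : cc (vtx R a) (vtx R b) (vtx R x) by exact: (bt_trans btT aby ayx).
have Sord u v : seg u -> seg v -> h u <= h v -> cc (vtx R x) v u.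
  move=> Su Sv huv; have [//|h'] := bt_total btT Sv Su.
  have := hmono _ _ Su h' => hvu.
  rewrite (hinj u v Su Sv); first exact: ccr _ _.
  by apply/eqP; rewrite eq_le huv hvu.
have Sa u v : seg v -> cc (vtx R x) v u -> cc (vtx R a) v u.
  move=> Sv xvu; have ayv : cc (vtx R a) (vtx R y) v.
    by apply: (bt_sub btT ayx _ Sv); exact: ccr _ _.
  have avx : cc (vtx R a) v (vtx R x).
    have [//|h'] := bt_total btT ayv ayx.
    rewrite -(bt_meet btT ayx h' Sv); exact: ccr _ _.
  by apply: (bt_sub btT avx _ xvu); exact: ccr _ _.
have [Lw|Lw] := pselect (L w).
  have [v [Lv wv avw]] := Lmax Lw.
  have ayv : cc (vtx R a) (vtx R y) v.
    by have [//|/(Ldown Lv)//] := bt_total btT aby (Lab Lv).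
  have awx : cc (vtx R a) w (vtx R x).
    have ayw : cc (vtx R a) (vtx R y) w.
      by apply: (bt_sub btT ayx _ Sw); exact: ccr _ _.
    have [//|h'] := bt_total btT ayw ayx.
    rewrite -(bt_meet btT ayx h' Sw); exact: ccr _ _.
  have avx : cc (vtx R a) v (vtx R x) by exact: (bt_trans btT avw awx).
  have Sv : seg v by exact: (bt_order btT ayv avx).
  have hv : h v <= h w.
    by rewrite hw; apply: ub_le_sup supA.2 _ _; exists v.
  apply: wv; apply: hinj => //; apply/eqP; rewrite eq_le hv andbT.
  by apply: hmono Sv _; exact: (bt_order btT avw awx).
have abw : cc (vtx R a) (vtx R b) w by exact: (bt_sub btT abx aby Sw).
have [u [abu Lu uw awu]] := Umin abw Lw.
have aux : cc (vtx R a) u (vtx R x).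
  by have [//|/(Ldown Lx)] := bt_total btT abu abx.
have xwu : cc (vtx R x) w u by exact: (bt_order btT awu aux).
have Su : seg u by exact: (bt_trans btT Sw xwu).
have hu : h u < sup A.
  rewrite -hw lt_neqAle hmono // andbT; apply/eqP => e; apply: uw; exact: hinj.
have [_ [v [Lv Sv] <-] huv] := sup_gt supA.1 hu.
by apply: Lu; apply: (Ldown Lv); apply: Sa => //; apply: Sord => //; exact: ltW.
Qed.

Let side v : cc (vtx R a) (vtx R b) v -> ~ (exists x, v = vtx R x) ->
  exists E x y, [/\ val E = [set x; y],
    cc (vtx R a) v (vtx R x), cc (vtx R a) (vtx R b) (vtx R y),
    cc (vtx R a) (vtx R y) v & cc (vtx R x) (vtx R y) v].
Proof.
case: v => [x _ []|[E c] abv _]; first by exists x.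
have hc : 0 < val c < 1 by case: (c).
have := abv => /(T_cc_edge contX) /= bet.
have neq : vcoord E a <> vcoord E b :> R.
  move=> e; move: bet; rewrite e /between orbb => /andP[p1 p2].
  have e' : val c = vcoord E b by apply/eqP; rewrite eq_le p1 p2.
  by move: hc; rewrite e'; case: (vcoord01 contX E b) => ->; rewrite ltxx ?andbF.
have [as_ at_] := vcoord_neq_cc contX neq.
have c0 := vcoord_src contX E; have c1 := vcoord_tgt contX E.
have [x [y [Exy ax bY abx aby]]] : exists x y, [/\ val E = [set x; y],
    vcoord E x = vcoord E a :> R, vcoord E y = vcoord E b :> R, P_cc a b x & P_cc a b y].
  have EE := edge_val E.
  case: (vcoord01 contX E a) => va; case: (vcoord01 contX E b) => vb;
    rewrite va vb // in neq *.
    by exists (edge_src E), (edge_tgt E).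
  by exists (edge_tgt E), (edge_src E); rewrite setUC.
set v := inr (E, c) : T in abv *.
have ayv : cc (vtx R a) (vtx R y) v by apply/(T_cc_edge contX); rewrite /= bY.
have xyv : cc (vtx R x) (vtx R y) v by apply/(T_cc_edge contX); rewrite /= ax bY.
have xbv : cc (vtx R x) (vtx R b) v by apply/(T_cc_edge contX); rewrite /= ax.
exists E, x, y; split => //; last exact/T_cc_vtx_P_cc.
have [//|h] := bt_tri btT v ((T_cc_vtx_P_cc _ _ _).2 abx).
by have := bt_anti btT (bt_sym btT xbv) (bt_sym btT h).
Qed.

(** If neither the vertices in L have a last element nor the others a first
    one, [P_gap] applies.  Otherwise the extreme vertex is an end of an edge that reaches into the
    gap; the other end of this edge is on the other side of the gap, because it
    would be a more extreme vertex on the same side, and [straddle] applies. *)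
Lemma T_gap : False.
Proof.
pose LP := [set x | L (vtx R x)].
have vinj x y : x <> y -> vtx R x <> vtx R y by move=> xy [].
have abb : cc (vtx R a) (vtx R b) (vtx R b) by exact: ccr _ _.
have [noLmax|yesLmax] := pselect (forall x, LP x -> exists y, [/\ LP y, x <> y & P_cc a y x]).
  have [noUmin|yesUmin] := pselect (forall y, P_cc a b y -> ~ LP y ->
      exists x, [/\ P_cc a b x, ~ LP x, x <> y & P_cc a y x]).
    apply: (P_gap contX (a := a) (b := b) (L := LP)) => //.
      by move=> x Lx; apply/T_cc_vtx_P_cc; exact: Lab.
    by move=> x y Ly ayx; apply: (Ldown Ly); exact/T_cc_vtx_P_cc.
  (* y is the first vertex after L *)
  move: yesUmin => /existsNP[y /not_implyP[aby /not_implyP[Ly nU]]].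
  have aby' : cc (vtx R a) (vtx R b) (vtx R y) by exact/T_cc_vtx_P_cc.
  have [v [abv Lv vy ayv]] := Umin aby' Ly.
  have [[x vx]|nv] := pselect (exists x, v = vtx R x).
    subst v; apply: nU; exists x; split => //; try exact/T_cc_vtx_P_cc.
    by move=> e; apply: vy; rewrite e.
  have [E [x [z [Exz avx abz azv xzv]]]] := side abv nv.
  have Lz : ~ L (vtx R z) by move=> Lz; apply: Lv; exact: Ldown Lz azv.
  have yz : y = z.
    apply: contrapT => yz; have [h|h] := bt_total btT aby' abz.
      by apply: nU; exists z; split; [exact/T_cc_vtx_P_cc|exact: Lz|exact: nesym|exact/T_cc_vtx_P_cc].
    have h' : cc v (vtx R z) (vtx R y) by exact: (bt_order btT h ayv).
    have hS : cc (vtx R x) (vtx R z) (vtx R y).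
      by apply: (bt_sym btT); apply: (bt_trans btT (bt_sym btT xzv)); exact: (bt_sym btT).
    have [e|[e]|[c yE]] := edge_seg Exz hS => //.
    by apply: vy; rewrite e in ayv *; exact: (bt_anti btT ayv avx).
  subst z; have Lx : L (vtx R x).
    apply: contrapT => Lx; apply: nU; exists x; split => //.
    - by apply/T_cc_vtx_P_cc; apply: (bt_trans btT abv).
    - move=> e; subst x; apply: vy; exact: (bt_anti btT ayv avx).
    - by apply/T_cc_vtx_P_cc; apply: (bt_trans btT ayv).
  exact: (straddle Exz Lx Lz abz (bt_trans btT azv avx)).
(* x is the last vertex of L *)
move: yesLmax => /existsNP[x /not_implyP[Lx nL]].
have [v [Lv xv avx]] := Lmax Lx.
have [[y vy]|nv] := pselect (exists x, v = vtx R x).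
  subst v; apply: nL; exists y; split => //; last exact/T_cc_vtx_P_cc.
  by move=> e; apply: xv; rewrite e.
have [E [x' [z [Exz avx' abz azv xzv]]]] := side (Lab Lv) nv.
have Lx' : L (vtx R x') by exact: Ldown Lv avx'.
have e : x = x'.
  apply: contrapT => xx'; have [h|h] := bt_total btT avx avx'.
    have h' : cc (vtx R x') v (vtx R x) by exact: (bt_order btT avx h).
    have [[e]|e|[c yE]] := edge_seg Exz (bt_trans btT xzv h') => //.
    by apply: xv; rewrite e in avx *; exact: (bt_anti btT avx azv).
  by apply: nL; exists x'; split => //; exact/T_cc_vtx_P_cc.
subst x'; have [Lz|Lz] := pselect (L (vtx R z)).
  apply: nL; exists z; split => //.
    by move=> e; subst z; apply: xv; exact: (bt_anti btT avx azv).
  by apply/T_cc_vtx_P_cc; exact: (bt_trans btT azv avx).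
exact: (straddle Exz Lx Lz abz (bt_trans btT azv avx)).
Qed.

End Gap.
End TreeOrder.

(** * Heights over the leaf edges, and a countable dense set *)
Section Leaves.
Variables (R : realType) (X : metricType R).
Hypothesis contX : continuum X.
Local Notation P := (cp_class X).
Local Notation T := (cp_tree R X).
Implicit Types (x y z p q : P) (E F G : edge X) (s t u v w : T).
Let btP := P_betweenness contX.
Let btT := T_betweenness contX.

Definition leaf_edge E := leaf (edge_src E) (edge_tgt E) \/ leaf (edge_tgt E) (edge_src E).

Definition leaf_base E : P :=
  if `[< leaf (edge_src E) (edge_tgt E) >] then edge_src E else edge_tgt E.

Definition leaf_tip E : P :=
  if `[< leaf (edge_src E) (edge_tgt E) >] then edge_tgt E else edge_src E.

(** The coordinate on a leaf edge measured from its base, so that the height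
    is 0 outside the edge and its tip. *)
Definition height E s : R :=
  if `[< leaf (edge_src E) (edge_tgt E) >] then coord E s else 1 - coord E s.

Lemma leaf_edgeP E : leaf_edge E -> leaf (leaf_base E) (leaf_tip E).
Proof.
rewrite /leaf_base /leaf_tip; case: asboolP => [//|h] [/h|] //.
Qed.

Lemma leaf_edge_val E : val E = [set leaf_base E; leaf_tip E].
Proof.
by rewrite edge_val /leaf_base /leaf_tip; case: asboolP => // _; rewrite setUC.
Qed.

Lemma height01 E s : 0 <= height E s <= 1.
Proof.
have := coord_ge0 contX E s; have := coord_le1 contX E s; rewrite /height.
by case: asboolP => _ h1 h0; apply/andP; split; lra.
Qed.

Lemma height_between E s t u : T_cc s t u ->
  between (height E s) (height E t) (height E u).
Proof.
move=> /(coord_between contX E); rewrite /between /height; case: asboolP => // _.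
case/orP => /andP[h1 h2]; apply/orP; [right|left]; apply/andP; split; lra.
Qed.

Lemma height_base E : height E (vtx R (leaf_base E)) = 0.
Proof.
rewrite /height /leaf_base; case: asboolP => _; first exact: vcoord_src.
by rewrite /= (vcoord_tgt contX) subrr.
Qed.

Lemma height_tip E : height E (vtx R (leaf_tip E)) = 1.
Proof.
rewrite /height /leaf_tip; case: asboolP => _; first exact: vcoord_tgt.
by rewrite /= (vcoord_src contX) subr0.
Qed.

Lemma height_coord E s t : height E s = height E t <-> coord E s = coord E t.
Proof. by rewrite /height; case: asboolP => _ //; split=> h; lra. Qed.

Lemma height_level E (a : R) : 0 < a < 1 -> exists u, height E u = a /\
  forall s t, between (height E s) (height E t) a -> T_cc s t u.
Proof.
move=> ha; rewrite /height; case: asboolP => _.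
  exists (edge_pt E ha); rewrite coord_edge_pt; split => // s t.
  exact: T_cc_edge_pt.
have hb : 0 < 1 - a < 1 by case/andP: ha => h0 h1; apply/andP; split; lra.
exists (edge_pt E hb); rewrite coord_edge_pt; split; first by lra.
move=> s t h; apply: (T_cc_edge_pt contX); move: h; rewrite /between.
case/orP => /andP[h1 h2]; apply/orP; [right|left]; apply/andP; split; lra.
Qed.

(** Every vertex other than the tip lies beyond the base. *)
Lemma height_vtx E x : leaf_edge E -> height E (vtx R x) != 0 -> x = leaf_tip E.
Proof.
move=> lE h; apply: contrapT => xt.
have [cb tb H] := leaf_edgeP lE; move/eqP: h; apply.
have [->|xb] := pselect (x = leaf_base E); first exact: height_base.
rewrite -(height_base E); apply/height_coord => /=.
apply: contrapT => /(vcoord_neq_cc contX)[h1 h2].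
have hx : P_cc x (leaf_base E) (leaf_tip E).
  have : val E (leaf_tip E) by rewrite leaf_edge_val; right.
  by rewrite edge_val => -[->|->].
have /P_oo_cc[hb _ _] := cls_sep_oo (H x xb xt).
by apply: tb; exact: (bt_anti btP hx hb).
Qed.

Lemma height_ends E s : leaf_edge E -> height E s != 0 -> ends s (leaf_tip E).
Proof.
move=> lE h; have [[a ->]|off] := pselect (on_edge E s).
  by rewrite /= leaf_edge_val; right.
have [x sx cx] := coord_off contX off.
rewrite -(height_vtx lE (x := x)) //; apply: contra_neq h.
have -> : height E (vtx R x) = height E s; last by [].
exact/height_coord.
Qed.

(** The sets of positive height over different leaf edges are disjoint: each
    consists of the open edge and its tip, and the tip of a leaf edge belongs to
    no other edge. *)
Lemma height_uniq E F s : leaf_edge E -> leaf_edge F ->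
  height E s != 0 -> height F s != 0 -> E = F.
Proof.
move=> lE lF hE hF.
have LE := leaf_edgeP lE; have LF := leaf_edgeP lF.
have tips : leaf_tip E = leaf_tip F -> E = F.
  move=> e; apply: val_inj; rewrite !leaf_edge_val -e.
  by rewrite -e in LF; rewrite (leaf_uniq contX LE LF).
case: s hE hF => [x|[G a]] hE hF.
  by apply: tips; rewrite -(height_vtx lE hE) -(height_vtx lF hF).
have GE : val G (leaf_tip E) := height_ends lE hE.
have GF : val G (leaf_tip F) := height_ends lF hF.
have [/tips //|nt] := pselect (leaf_tip E = leaf_tip F).
exfalso; have adj : Defs.adjacent (leaf_tip E) (leaf_tip F).
  move: GE GF; rewrite edge_val; have aG := edge_adjacent G; have aG' := adjacentC aG.
  by move=> [e|e] [f|f]; rewrite e f // in nt *.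
exact: (noncut_not_adjacent (leaf_noncut contX LE) (leaf_noncut contX LF) adj).
Qed.

Lemma height_base_cc E s t : leaf_edge E -> height E t != 0 -> height E s = 0 ->
  T_cc s t (vtx R (leaf_base E)).
Proof.
move=> lE ht hs; apply/(T_cc_vtxE contX).
have [->|sb] := pselect (vtx R (leaf_base E) = s); first by constructor 1.
have [->|tb] := pselect (vtx R (leaf_base E) = t); first by constructor 2.
have [cb tipb H] := leaf_edgeP lE.
constructor 3.
have [x sx xb] : exists2 x, ends s x & x <> leaf_base E by exact/ends_other/nesym.
exists x, (leaf_tip E); split => //; first exact: height_ends.
apply/cls_sep_oo/H => // xt.
have soff : ~ on_edge E s.
  move=> /(on_edge_coord); move: hs; rewrite /height.
  case: asboolP => _ hs0; first by rewrite hs0 ltxx.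
  by rewrite -[coord E s < 1]subr_gt0 hs0 ltxx andbF.
have e := coord_off_all contX soff sx.
have : height E s = height E (vtx R (leaf_tip E)) by apply/height_coord; rewrite e xt.
by rewrite hs height_tip => /eqP; rewrite eq_sym oner_eq0.
Qed.

Lemma countable_leaf_edge_bases : countable [set leaf_base E | E in leaf_edge].
Proof.
apply: sub_countable (countable_leaf_bases contX); apply: subset_card_le.
by move=> _ [E /leaf_edgeP lE <-]; exists (leaf_tip E).
Qed.

Lemma countable_non_leaf_edges : countable [set E | ~ leaf_edge E].
Proof.
have /countable_injP[f finj] := countable_core_edges contX.
pose Q E n := (core_edge (edge_src E, edge_tgt E) /\ f (edge_src E, edge_tgt E) = n) \/
  (core_edge (edge_tgt E, edge_src E) /\ f (edge_tgt E, edge_src E) = n).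
apply: (@countable_code _ _ _ Q).
  move=> E nl; have aE := edge_adjacent E; have aE' := adjacentC aE.
  have [cs|cs] := pselect (cut (edge_src E)).
    exists (f (edge_src E, edge_tgt E)); left; split => //; split => //= h.
    by apply: nl; left.
  have [ct|ct] := pselect (cut (edge_tgt E)).
    exists (f (edge_tgt E, edge_src E)); right; split => //; split => //= h.
    by apply: nl; right.
  by case: (noncut_not_adjacent cs ct aE).
move=> E F n _ _ QE QF; apply: val_inj; rewrite !edge_val.
have inj a b : core_edge a -> core_edge b -> f a = n -> f b = n -> a = b.
  by move=> ca cb fa fb; apply: finj; rewrite ?inE // fa fb.
case: QE => -[c1 f1]; case: QF => -[c2 f2]; have [-> ->] := inj _ _ c1 c2 f1 f2 => //.
- exact: setUC.
- exact: setUC.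
Qed.

(** Take two points of the open segment; if neither is a cut point, a cut
    point separates them. *)
Lemma exists_cut x y : x <> y -> (forall u v : P, P_cc x y u -> P_cc x y v -> ~ Defs.adjacent u v) ->
  exists c, cut c /\ P_oo x y c.
Proof.
move=> xy na.
have mid (u v : P) : P_cc x y u -> P_cc x y v -> u <> v -> exists z, P_oo u v z.
  move=> hu hv uv; apply: contrapT => nz; apply: (na u v hu hv); split => //.
  by apply/seteqP; split=> // z h; apply: nz; exists z.
have [z hz] := mid x y (bt_l btP _ _) (bt_r btP _ _) xy.
have [cz|cz] := pselect (cut z); first by exists z.
have /P_oo_cc[hz' zx zy] := hz.
have [z' hz2] := mid z y hz' (bt_r btP _ _) zy.
have /P_oo_cc[hz2' z'z z'y] := hz2.
have [cz'|cz'] := pselect (cut z').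
  have xyz' : P_cc x y z' by exact: (bt_sub btP hz' (bt_r btP _ _) hz2').
  exists z'; split => //; apply/P_oo_cc; split => // e; subst z'.
  by apply: zx; exact: (bt_anti btP (bt_sym btP hz') (bt_sym btP hz2')).
have [c hc] := noncut_cls_sep cz cz' (nesym z'z).
have /P_oo_cc[hc' nz nz'] := cls_sep_oo hc.
have zyc : P_cc z y c by exact: (bt_trans btP hz2' hc').
exists c; split; first exact: cls_sep_cut hc.
apply/P_oo_cc; split; first exact: (bt_sub btP hz' (bt_r btP _ _) zyc).
  move=> e; subst c; apply: zx.
  exact: (bt_anti btP (bt_sym btP hz') (bt_sym btP zyc)).
move=> e; subst c; apply: z'y; exact: (bt_anti btP hz2' hc').
Qed.

(** The set consists of the points d of [dense_cuts] and the points with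
    rational parameter on the edges that are not leaf edges.  If s and t have
    different coordinates over an edge, the points of the second kind on this edge
    serve.  Otherwise s and t are vertices and [s, t] contains no edge; then each
    of its subsegments contains cut points by [exists_cut], and [dense_cuts]
    applies to these. *)
Lemma tree_dense_set : exists2 Q : set T, countable Q &
  forall s t, s <> t -> (forall E, leaf_edge E -> height E s = height E t) ->
    exists u v, [/\ Q u, Q v, u <> v, T_cc s t u & T_cc s t v].
Proof.
have [Ds cDs DsP] := dense_cuts contX.
pose Q1 := [set vtx R d | d in Ds].
pose Q2 := [set u : T | exists E a, [/\ ~ leaf_edge E, on_edge E u & coord E u = ratr a]].
exists (Q1 `|` Q2).
  have c1 : countable Q1 by apply: card_le_trans (card_image_le _ _) cDs.
  have c2 : countable Q2.
    have /countable_injP[f finj] := countable_non_leaf_edges.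
    pose code (u : T) (n : nat * rat) := exists E, [/\ ~ leaf_edge E, on_edge E u,
      coord E u = ratr n.2 & f E = n.1].
    apply: (@countable_code _ _ _ code).
      by move=> u [E [a [nl uE cu]]]; exists (f E, a), E.
    move=> u v [n a] _ _ [E [nl uE cu fE]] [F [nl' vF cv fF]].
    have EF : E = F by apply: finj; rewrite ?inE //= fE fF.
    subst F; apply: (coord_inj contX (E := E)); first exact: on_edge_coord.
    by rewrite cu cv.
  have : countable (\bigcup_(i in [set: bool]) (if i then Q1 else Q2)).
    by apply: bigcup_countable; [exact: countableP|case].
  apply: sub_countable; apply: subset_card_le => u [h|h]; first by exists true.
  by exists false.
move=> s t st hst.
have [[E Est]|allE] := pselect (exists E, coord E s <> coord E t).
  have nl : ~ leaf_edge E by move=> /hst /height_coord.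
  have rats (p q : R) : p < q -> 0 <= p -> q <= 1 ->
      exists a b : rat, [/\ p < ratr a, ratr a < ratr b :> R, ratr b < q, 0 < (ratr a : R) < 1 & 0 < (ratr b : R) < 1].
    move=> pq p0 q1.
    have [a] := rat_in_itvoo pq; rewrite in_itv /= => /andP[pa aq].
    have [b] := rat_in_itvoo aq; rewrite in_itv /= => /andP[ab bq].
    by exists a, b; split => //; apply/andP; split; lra.
  have main (p q : R) : p < q -> 0 <= p -> q <= 1 ->
      (forall c, p <= c <= q -> between (coord E s) (coord E t) c) ->
      exists u v, [/\ (Q1 `|` Q2) u, (Q1 `|` Q2) v, u <> v, T_cc s t u & T_cc s t v].
    move=> pq p0 q1 bet.
    have [a [b [pa ab bq a01 b01]]] := rats p q pq p0 q1.
    exists (edge_pt E a01), (edge_pt E b01); split.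
    - right; exists E, a; rewrite coord_edge_pt; split => //.
      exact: on_edge_pt.
    - right; exists E, b; rewrite coord_edge_pt; split => //.
      exact: on_edge_pt.
    - move=> e; have := coord_edge_pt E a01; rewrite e coord_edge_pt => e'.
      by rewrite e' ltxx in ab.
    - apply: (T_cc_edge_pt contX); apply: bet; apply/andP; split; lra.
    - apply: (T_cc_edge_pt contX); apply: bet; apply/andP; split; lra.
  have [h|h|//] := ltgtP (coord E s) (coord E t).
    apply: (main _ _ h); [exact: coord_ge0|exact: coord_le1|].
    by move=> c; rewrite /between => ->.
  apply: (main _ _ h); [exact: coord_ge0|exact: coord_le1|].
  by move=> c; rewrite /between orbC => ->.
have coordE E : coord E s = coord E t by apply: contrapT => e; apply: allE; exists E.
have vtxs u v : u <> v -> (forall E, coord E u = coord E v) -> exists x, u = vtx R x.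
  case: u => [x|[E a]] uv h; first by exists x.
  case: uv; apply: (coord_inj contX _ (h E)); rewrite coord_edge; by case: a h.
have [x sx] := vtxs s t st coordE.
have [y ty] := vtxs t s (nesym st) (fun E => esym (coordE E)).
subst s t; have xy : x <> y by move=> e; apply: st; rewrite e.
have na (u v : P) : P_cc x y u -> P_cc x y v -> ~ Defs.adjacent u v.
  move=> xyu xyv adj; have [E Euv] := adjacent_edge adj.
  have sub z : val E z -> P_cc x y z by rewrite Euv => -[->|->].
  have := coordE E => /=; apply: (cc_vcoord_neq contX); apply: sub.
    by rewrite edge_val; left.
  by rewrite edge_val; right.
have nasub (u v : P) : P_cc x y u -> P_cc x y v ->
    forall u' v' : P, P_cc u v u' -> P_cc u v v' -> ~ Defs.adjacent u' v'.
  by move=> hu hv u' v' hu' hv'; apply: na; exact: (bt_sub btP hu hv).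
have ecut (u v : P) : P_cc x y u -> P_cc x y v -> u <> v -> exists c, cut c /\ P_oo u v c.
  by move=> hu hv uv; apply: exists_cut => //; exact: nasub.
have edense (u v : P) : P_cc x y u -> P_cc x y v -> u <> v -> exists2 d, Ds d & P_cc u v d.
  move=> hu hv uv.
  have [c [cc /P_oo_cc[uvc cu cv]]] := ecut u v hu hv uv.
  have hc : P_cc x y c by exact: (bt_sub btP hu hv uvc).
  have [c1 [cc1 /P_oo_cc[ucc1 c1u c1c]]] := ecut u c hu hc (nesym cu).
  have [c3 [cc3 /P_oo_cc[cvc3 c3c c3v]]] := ecut c v hc hv cv.
  have uvc1 : P_cc u v c1 by exact: (bt_trans btP uvc ucc1).
  have uvc3 : P_cc u v c3 by apply: (bt_sub btP uvc _ cvc3); exact: bt_r.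
  have c1vc : P_cc c1 v c by exact: (bt_order btP uvc ucc1).
  have c1c3c : P_cc c1 c3 c.
    apply: (bt_sym btP); apply: (bt_order btP (bt_sym btP c1vc)); exact: (bt_sym btP).
  have h : cls_sep c c1 c3.
    by apply: P_oo_cut => //; apply/P_oo_cc; split => //; exact: nesym.
  have [d [Dd _ hd]] := DsP _ _ _ cc1 cc3 h.
  by exists d => //; exact: (bt_sub btP uvc1 uvc3 hd).
have hx := bt_l btP x y; have hy := bt_r btP x y.
have [m1 [_ /P_oo_cc[hm1 m1x m1y]]] := ecut x y hx hy xy.
have [m2 [_ /P_oo_cc[hm2 m2m m2y]]] := ecut m1 y hm1 hy m1y.
have hm2' : P_cc x y m2 by exact: (bt_sub btP hm1 hy hm2).
have [d1 D1 h1] := edense x m1 hx hm1 (nesym m1x).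
have [d2 D2 h2] := edense m2 y hm2' hy m2y.
exists (vtx R d1), (vtx R d2); split.
- by left; exists d1.
- by left; exists d2.
- case=> e; subst d2; apply: m2m.
  have a1 : P_cc y x m1 := bt_sym btP hm1.
  have a2 : P_cc y m1 m2 := bt_sym btP hm2.
  have a3 : P_cc y m1 d1 := bt_trans btP a2 (bt_sym btP h2).
  have a4 : P_cc d1 y m1.
    by apply: (bt_order btP hm1 h1).
  have e1 : m1 = d1 by exact: (bt_anti btP (bt_sym btP a4) a3).
  by subst d1; exact: (bt_anti btP a2 (bt_sym btP h2)).
- apply/(T_cc_vtx_P_cc contX); exact: (bt_sub btP hx hm1 h1).
- apply/(T_cc_vtx_P_cc contX); exact: (bt_sub btP hm2' hy h2).
Qed.

End Leaves.

(** * Functions monotone along segments *)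
Lemma exprV_lt (R : realType) (e : R) : 0 < e -> exists n, 2 ^- n < e.
Proof.
move=> e0; have [n hn] := ltr_add_invr e0.
exists n.+1; apply: le_lt_trans hn; rewrite add0r lef_pV2 ?posrE //.
by rewrite -natrX ler_nat ltnW // ltn_expl.
Qed.

Section Scales.
Variables (R : realType) (T : Type) (cc : T -> T -> T -> Prop).
Hypothesis bt : betweenness cc.
Implicit Types s t u v : T.

(** The last condition provides, between any two values p < q that f crosses, a
    level at which a single point u separates the points below from the points
    above.  These points make f continuous for the topology of the finite cuts
    U(s, A) ([scale_local]). *)
Definition scale (f : T -> R) := [/\ forall s, 0 <= f s <= 1,
  forall s t u, cc s t u -> between (f s) (f t) (f u) &
  forall p q s t, p < q -> f s <= p -> q <= f t -> exists u,
    p < f u < q /\ forall s' t', f s' < f u < f t' -> cc s' t' u].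

(** Two points suffice: one at a level shortly above f s and one at a level
    shortly below. *)
Lemma scale_local f s (e : R) : scale f -> 0 < e -> exists A : set T,
  [/\ finite_set A, ~ A s &
   forall t, (forall a, A a -> ~ cc s t a) -> `|f s - f t| < e].
Proof.
move=> [f01 fbet flev] e0.
have [A1 [fA1 sA1 hA1]] : exists A : set T, [/\ finite_set A, ~ A s &
    forall t, (forall a, A a -> ~ cc s t a) -> f t < f s + e].
  have [[t0 ht0]|nt] := pselect (exists t, f s + e <= f t).
    have [|u [/andP[u1 u2] hu]] := flev (f s) (f s + e) s t0 _ (lexx _) ht0.
      by rewrite ltrDl.
    exists [set u]; split; first exact: finite_set1.
      by move=> su; rewrite su ltxx in u1.
    move=> t ht; apply: le_lt_trans u2; rewrite leNgt; apply/negP => ut.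
    by apply: (ht u) => //; apply: hu; rewrite u1.
  exists set0; split => // t _; rewrite ltNge; apply/negP => h.
  by apply: nt; exists t.
have [A2 [fA2 sA2 hA2]] : exists A : set T, [/\ finite_set A, ~ A s &
    forall t, (forall a, A a -> ~ cc s t a) -> f s - e < f t].
  have [[t0 ht0]|nt] := pselect (exists t, f t <= f s - e).
    have [|u [/andP[u1 u2] hu]] := flev (f s - e) (f s) t0 s _ ht0 (lexx _).
      by rewrite ltrBlDr ltrDl.
    exists [set u]; split; first exact: finite_set1.
      by move=> su; rewrite su ltxx in u2.
    move=> t ht; apply: (lt_le_trans u1); rewrite leNgt; apply/negP => ut.
    by apply: (ht u) => //; apply: (bt_sym bt); apply: hu; rewrite u2 andbT.
  exists set0; split => // t _; rewrite ltNge; apply/negP => h.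
  by apply: nt; exists t.
exists (A1 `|` A2); split; first by rewrite finite_setU.
  by case.
move=> t ht; have h1 := hA1 t (fun a Aa => ht a (or_introl Aa)).
have h2 := hA2 t (fun a Aa => ht a (or_intror Aa)).
by rewrite ltr_norml; apply/andP; split; lra.
Qed.

Section Urysohn.
Hypothesis dense : forall s t, s <> t -> exists u, [/\ cc s t u, u <> s & u <> t].
Variables p q : T.
Hypothesis pq : p <> q.

Let mid s t : T := if pselect (s <> t) is left h then projT1 (cid (dense h)) else s.

Let midP s t : s <> t -> [/\ cc s t (mid s t), mid s t <> s & mid s t <> t].
Proof. by move=> st; rewrite /mid; case: pselect => // h; case: (cid _). Qed.

Let lt s t := s <> t /\ cc p t s.

Let lt_trans s t u : lt s t -> lt t u -> lt s u.
Proof.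
move=> [st pts] [tu put]; split; last exact: (bt_trans bt put pts).
by move=> su; subst u; apply: st; exact: (bt_anti bt pts put).
Qed.

Let lt_mid s t : lt s t -> lt s (mid s t) /\ lt (mid s t) t.
Proof.
move=> [st pts]; have [sm ms mt] := midP st.
have ptm : cc p t (mid s t) by apply: (bt_sub bt pts _ sm); exact: (bt_r bt _ _).
split; split => //; first exact: nesym.
have [//|h] := bt_total bt ptm pts.
by case: ms; exact: (bt_meet bt pts h sm).
Qed.

(** Iterated bisection of the segment [p, q], as in the proof of the lemma of
    Urysohn. *)
Fixpoint dyadic (n k : nat) : T :=
  if n is n'.+1 then
    if odd k then mid (dyadic n' k./2) (dyadic n' k./2.+1) else dyadic n' k./2
  else if k is 0 then p else q.

Let dyadicS n k : (k < 2 ^ n)%N -> lt (dyadic n k) (dyadic n k.+1).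
Proof.
elim: n k => [|n IH] k kn.
  by move: kn; rewrite expn0 ltnS leqn0 => /eqP -> /=; split => //; exact: (bt_l bt _ _).
have k2 : (k./2 < 2 ^ n)%N.
  by rewrite -ltn_double -mul2n -mul2n -expnS; apply: leq_ltn_trans kn; rewrite mul2n -{2}(odd_double_half k) leq_addl.
have [h1 h2] := lt_mid (IH _ k2).
by rewrite /= uphalf_half; case: (odd k).
Qed.

Let dyadic_lt n k l : (k < l <= 2 ^ n)%N -> lt (dyadic n k) (dyadic n l).
Proof.
elim: l => [|l IH] /andP[]//; rewrite ltnS leq_eqVlt => /orP[/eqP ->|kl] ln.
  exact: dyadicS.
by apply: (lt_trans (IH _)) (dyadicS ln); rewrite kl ltnW.
Qed.

Let dyadic_up n m k : dyadic (m + n) (k * 2 ^ m) = dyadic n k.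
Proof.
elim: m k => [|m IH] k; first by rewrite muln1.
rewrite addSn /= expnS mulnCA mul2n odd_double doubleK; exact: IH.
Qed.

Let dval (n k : nat) : R := k%:R / 2 ^+ n.

Let p2 n : 0 < (2 ^+ n : R). Proof. by rewrite exprn_gt0. Qed.

Let dval_le n k m l : (dval n k <= dval m l) = (k * 2 ^ m <= l * 2 ^ n)%N.
Proof.
by rewrite /dval ler_pdivrMr // mulrAC ler_pdivlMr // -!natrX -!natrM ler_nat.
Qed.

Let dyadic_le n k m l : (l <= 2 ^ m)%N -> dval n k <= dval m l ->
  cc p (dyadic m l) (dyadic n k).
Proof.
rewrite dval_le => lm; rewrite leq_eqVlt.
rewrite -(dyadic_up n m k) -(dyadic_up m n l) (addnC n m).
case/orP => [/eqP ->|h]; first exact: (bt_r bt _ _).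
by apply: (dyadic_lt _).2; rewrite h addnC expnD mulnC leq_mul2l lm orbT.
Qed.

Let dyadic_neq n k m l : (l <= 2 ^ m)%N -> dval n k < dval m l ->
  dyadic n k <> dyadic m l.
Proof.
rewrite ltNge dval_le -ltnNge => lm h.
rewrite -(dyadic_up n m k) -(dyadic_up m n l) (addnC n m).
by apply: (dyadic_lt _).1; rewrite h addnC expnD mulnC leq_mul2l lm orbT.
Qed.

Let I x := [set r : R | exists n k, [/\ (k <= 2 ^ n)%N, r = dval n k & cc p x (dyadic n k)]].

Let I0 x : I x 0.
Proof. by exists 0%N, 0%N; split => //; rewrite ?/dval ?mul0r //; exact: (bt_l bt _ _). Qed.

Let I1 x r : I x r -> r <= 1.
Proof.
move=> [n [k [kn -> _]]].
by rewrite /dval ler_pdivrMr // mul1r -natrX ler_nat.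
Qed.

Let hasI x : has_sup (I x).
Proof. by split; [exists 0; exact: I0|exists 1; move=> r; exact: I1]. Qed.

Let Idown x r n k : I x r -> dval n k <= r -> cc p x (dyadic n k).
Proof.
by move=> [m [l [lm -> h]]] kl; exact: (bt_trans bt h (dyadic_le lm kl)).
Qed.

Let f x := sup (I x).

Let I_le x n k : (k <= 2 ^ n)%N -> cc p x (dyadic n k) -> dval n k <= f x.
Proof. by move=> kn h; apply: ub_le_sup (hasI x).2 _ _; exists n, k. Qed.

Let f_I x n k : dval n k < f x -> cc p x (dyadic n k).
Proof.
move=> h; have [r Ir nr] := sup_gt (hasI x).1 h.
exact: Idown Ir (ltW nr).
Qed.

Let f_dyadic n k : (k <= 2 ^ n)%N -> f (dyadic n k) = dval n k.
Proof.
move=> kn; apply/eqP; rewrite eq_le; apply/andP; split; last first.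
  by apply: I_le => //; exact: (bt_r bt _ _).
apply: ge_sup; first exact: (hasI _).1.
move=> _ [m [l [lm -> h]]]; rewrite leNgt; apply/negP => kl.
have h' := dyadic_le lm (ltW kl).
by apply: (dyadic_neq lm kl); exact: (bt_anti bt h' h).
Qed.

Let dyadic_between (a b : R) : 0 <= a -> a < b -> b <= 1 ->
  exists n k, (k <= 2 ^ n)%N /\ a < dval n k < b.
Proof.
move=> a0 ab b1; have e0 : 0 < b - a by rewrite subr_gt0.
have [n hn] := exprV_lt e0.
have a2 : 0 <= a * 2 ^+ n by rewrite mulr_ge0 // ltW.
pose k := (Num.truncn (a * 2 ^+ n)).+1.
have /andP[k1 k2] := truncn_itv a2.
have ak : a < dval n k by rewrite /dval ltr_pdivlMr.
have kb : dval n k < b.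
  rewrite /dval /k -addn1 natrD mulrDl mul1r.
  have : (Num.truncn (a * 2 ^+ n))%:R / 2 ^+ n <= a by rewrite ler_pdivrMr.
  by move=> h; lra.
exists n, k; split; last by rewrite ak.
rewrite -(ler_nat R) natrX; apply: ltW.
have : dval n k < 1 by apply: lt_le_trans kb b1.
by rewrite /dval ltr_pdivrMr // mul1r.
Qed.

(** f x is the supremum of the dyadic numbers k / 2^n such that the point
    dyadic n k lies in [p, x].  The points dyadic n k themselves are the
    separating points. *)
Lemma urysohn_scale : exists g, [/\ scale g, g p = 0 & g q = 1].
Proof.
have fp : f p = 0 by rewrite -[p]/(dyadic 0 0) f_dyadic // /dval mul0r.
have fq : f q = 1 by rewrite -[q]/(dyadic 0 1) f_dyadic // /dval expr0 divr1.
have f01 s : 0 <= f s <= 1.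
  apply/andP; split; first exact: (ub_le_sup (hasI s).2 (I0 s)).
  by apply: ge_sup; [exact: (hasI s).1|move=> r; exact: I1].
exists f; split => //; split => //.
- move=> s t u stu.
  have le_max : f u <= Num.max (f s) (f t).
    apply: ge_sup; first exact: (hasI u).1.
    move=> _ [n [k [kn -> h]]]; rewrite le_max.
    have [h1|h1] := bt_tri bt s h; first by rewrite I_le.
    have [h2|h2] := bt_tri bt t h; first by rewrite (I_le kn h2) orbT.
    have e : dyadic n k = u.
      apply: (bt_meet bt (bt_sym bt stu)); last by apply: (bt_sym bt); exact: h1.
      exact: h2.
    have [h3|h3] := bt_tri bt p stu; last first.
      by apply/orP; right; apply: I_le => //; rewrite e.
    by apply/orP; left; apply: I_le => //; rewrite e; exact: (bt_sym bt).
  have ge_min : Num.min (f s) (f t) <= f u.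
    rewrite leNgt; apply/negP; rewrite lt_min => /andP[us ut].
    have [rs Is us'] := sup_gt (hasI s).1 us.
    have [rt It ut'] := sup_gt (hasI t).1 ut.
    have [n [k [kn [h1 h2] h3]]] : exists n k, [/\ (k <= 2 ^ n)%N,
        cc p s (dyadic n k) /\ cc p t (dyadic n k) & f u < dval n k].
      have [n [k [kn e _]]] := Is; have [m [l [lm e' _]]] := It.
      have [h|h] := leP rs rt.
        exists n, k; split => //; last by rewrite -e.
        by split; [apply: Idown Is _|apply: Idown It _]; rewrite -e.
      exists m, l; split => //; last by rewrite -e'.
      by split; [apply: Idown Is _|apply: Idown It _]; rewrite -e' // ltW.
    have : cc p u (dyadic n k); last by move=> /(I_le kn); rewrite leNgt h3.
    have [//|h4] := bt_tri bt u h1; have [//|h5] := bt_tri bt u h2.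
    have e : dyadic n k = u by apply: (bt_meet bt stu) => //; exact: (bt_sym bt).
    by rewrite e; exact: (bt_r bt _ _).
  move: le_max ge_min; rewrite le_max ge_min /between.
  move=> /orP[] h1 /orP[] h2; rewrite ?h1 ?h2 ?orbT //.
    by rewrite andbT /=; exact: le_total.
  by rewrite andbT /=; exact: le_total.
- move=> a b s t ab sa bt_.
  have [n [k [kn /andP[ak kb]]]] : exists n k, (k <= 2 ^ n)%N /\ a < dval n k < b.
    apply: dyadic_between => //.
      by apply: le_trans sa; case/andP: (f01 s).
    by apply: le_trans bt_ _; case/andP: (f01 t).
  exists (dyadic n k); rewrite f_dyadic // ak kb; split => // s' t' /andP[h1 h2].
  have [h|//] := bt_tri bt s' (f_I h2).
  by exfalso; move: (I_le kn h); rewrite leNgt h1.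
Qed.

End Urysohn.
End Scales.

(** * The two parts of the distance *)
Lemma half_exprV (R : realType) m : (2 ^- m : R) = 2 ^- m.+1 + 2 ^- m.+1.
Proof. by rewrite exprS invfM; move: ((2 ^+ m)^-1) => x; lra. Qed.

Section CoreDistance.
Variables (R : realType) (T : Type) (cc : T -> T -> T -> Prop).
Hypothesis bt : betweenness cc.
Implicit Types s t u v : T.
Variable Phi : nat -> T -> R.
Hypothesis Phi_scale : forall i, scale cc (Phi i).

Lemma between_dist (a b c : R) : between a b c -> `|a - b| = `|a - c| + `|c - b|.
Proof.
by case/orP => /andP[h1 h2];
  [rewrite !ler0_norm|rewrite !ger0_norm]; rewrite ?subr_le0 ?subr_ge0 //; try lra; exact: le_trans h1 h2.
Qed.

Let core_sum n s t : R := \sum_(i < n) (2 ^- i.+1) * `|Phi i s - Phi i t|.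

Let wpos i : 0 < (2 ^- i.+1 : R).
Proof. by rewrite invr_gt0 exprn_gt0. Qed.

Let term_ge0 i s t : 0 <= (2 ^- i.+1) * `|Phi i s - Phi i t|.
Proof. by rewrite mulr_ge0 // ltW. Qed.

Let Phi_le1 i s t : `|Phi i s - Phi i t| <= 1.
Proof.
have [f01 _ _] := Phi_scale i.
have /andP[h1 h2] := f01 s; have /andP[h3 h4] := f01 t.
by rewrite ler_norml; apply/andP; split; lra.
Qed.

Let core_sum_tail n m s t : (n <= m)%N -> core_sum m s t <= core_sum n s t + (2 ^- n - 2 ^- m).
Proof.
elim: m => [|m IH]; first by rewrite leqn0 => /eqP ->; rewrite subrr addr0.
rewrite leq_eqVlt => /orP[/eqP ->|]; first by rewrite subrr addr0.
rewrite ltnS => /IH {}IH; rewrite /core_sum big_ord_recr /= -/(core_sum m s t) -/(core_sum n s t).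
have e := half_exprV R m.
have := Phi_le1 m s t; have := wpos m; set c : R := 2 ^- m.+1 in e *.
move=> c0 h1; have : c * `|Phi m s - Phi m t| <= c by rewrite ger_pMr.
by move=> h; lra.
Qed.

Let core_sum_mono n m s t : (n <= m)%N -> core_sum n s t <= core_sum m s t.
Proof.
move=> nm; rewrite /core_sum -(subnKC nm) big_split_ord /= lerDl.
by apply: sumr_ge0 => i _; exact: term_ge0.
Qed.

Let core_sum_le1 n s t : core_sum n s t <= 1.
Proof.
have := @core_sum_tail 0 n s t (leq0n n); rewrite {2}/core_sum big_ord0 add0r invr1.
by move=> h; apply: (le_trans h); rewrite gerBl ltW // invr_gt0 exprn_gt0.
Qed.

(** The series of the weighted differences of the functions Phi_i, as the
    supremum of its partial sums. *)
Definition core_dist s t : R := sup [set core_sum n s t | n in [set: nat]].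

Let core_sum_has_sup s t : has_sup [set core_sum n s t | n in [set: nat]].
Proof. by split; [exists (core_sum 0 s t); exists 0%N|exists 1 => r [n _ <-]; exact: core_sum_le1]. Qed.

Let core_sum_le n s t : core_sum n s t <= core_dist s t.
Proof. by apply: ub_le_sup (core_sum_has_sup s t).2 _ _; exists n. Qed.

Let core_ub s t (a : R) : (forall n, core_sum n s t <= a) -> core_dist s t <= a.
Proof. by move=> h; apply: ge_sup (core_sum_has_sup s t).1 _ => r [n _ <-]. Qed.

Lemma core_dist_ge0 s t : 0 <= core_dist s t.
Proof. by apply: le_trans (core_sum_le 0 s t); rewrite /core_sum big_ord0. Qed.

Lemma core_dist_sym s t : core_dist s t = core_dist t s.
Proof.
congr sup; apply/seteqP; split=> r [n _ <-]; exists n => //;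
  by apply: eq_bigr => i _; rewrite distrC.
Qed.

Lemma core_dist_xx s : core_dist s s = 0.
Proof.
apply/eqP; rewrite eq_le core_dist_ge0 andbT; apply: core_ub => n.
by rewrite /core_sum big1 // => i _; rewrite subrr normr0 mulr0.
Qed.

Lemma core_dist_triangle t s u : core_dist s u <= core_dist s t + core_dist t u.
Proof.
apply: core_ub => n; apply: le_trans (lerD (core_sum_le n s t) (core_sum_le n t u)).
rewrite /core_sum -big_split /=; apply: ler_sum => i _.
by rewrite -mulrDr ler_pM2l // ler_distD.
Qed.

Lemma core_dist_add s t u : cc s t u -> core_dist s t = core_dist s u + core_dist u t.
Proof.
move=> stu; apply/eqP; rewrite eq_le core_dist_triangle /=.
have Sadd n : core_sum n s t = core_sum n s u + core_sum n u t.
  rewrite /core_sum -big_split /=; apply: eq_bigr => i _; rewrite -mulrDr.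
  by have [_ h _] := Phi_scale i; rewrite (between_dist (h _ _ _ stu)).
rewrite -lerBrDr; apply: core_ub => n; rewrite lerBrDr addrC -lerBrDr.
apply: core_ub => m; rewrite lerBrDr addrC.
apply: le_trans (core_sum_le (maxn n m) s t); rewrite Sadd.
by apply: lerD; apply: core_sum_mono; [exact: leq_maxl|exact: leq_maxr].
Qed.

Lemma core_dist_eq0 s t i : core_dist s t = 0 -> Phi i s = Phi i t.
Proof.
move=> h; have := core_sum_le i.+1 s t; rewrite h /core_sum big_ord_recr /= => h'.
have h0 : 0 <= \sum_(j < i) (2 ^- j.+1) * `|Phi j s - Phi j t|.
  by apply: sumr_ge0 => j _; exact: term_ge0.
have : (2 ^- i.+1) * `|Phi i s - Phi i t| <= 0 by lra.
rewrite pmulr_rle0 // normr_le0 subr_eq0 => /eqP //.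
Qed.

(** Up to e / 4 the series is a finite sum, and each term of it is controlled by
    finitely many points according to [scale_local]. *)
Lemma core_dist_local s (e : R) : 0 < e -> exists A : set T,
  [/\ finite_set A, ~ A s &
   forall t, (forall a, A a -> ~ cc s t a) -> core_dist s t < e].
Proof.
move=> e0; have [n hn] := exprV_lt (divr_gt0 e0 (ltr0Sn R 1)).
have [A [fA sA hA]] : exists A : set T, [/\ finite_set A, ~ A s &
    forall t, (forall a, A a -> ~ cc s t a) -> forall i, (i < n)%N -> `|Phi i s - Phi i t| < e / 4].
  elim: {hn} n => [|n [A [fA sA hA]]]; first by exists set0; split.
  have e4 : 0 < e / 4 by rewrite divr_gt0.
  have [B [fB sB hB]] := scale_local bt s (Phi_scale n) e4.
  exists (A `|` B); split; [by rewrite finite_setU|by case|].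
  move=> t ht i; rewrite ltnS leq_eqVlt => /orP[/eqP ->|].
    by apply: hB => a Ba; apply: ht; right.
  by apply: hA => a Aa; apply: ht; left.
exists A; split => // t /hA ht.
suff h : core_dist s t <= e / 4 + 2 ^- n by lra.
apply: core_ub => m; apply: le_trans (core_sum_mono s t (leq_maxr n m)) _.
apply: le_trans (core_sum_tail s t (leq_maxl n m)) _; apply: lerD; last first.
  by rewrite gerBl invr_ge0 exprn_ge0.
have : core_sum n s t <= \sum_(i < n) (2 ^- i.+1) * (e / 4).
  by apply: ler_sum => i _; rewrite ler_pM2l // ltW // ht.
move=> /le_trans; apply; rewrite -mulr_suml.
have h1 : \sum_(i < n) (2 ^- i.+1 : R) = 1 - 2 ^- n.
  elim: n {hn hA ht} => [|n IH]; first by rewrite big_ord0 invr1 subrr.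
  rewrite big_ord_recr /= IH; have e' := half_exprV R n.
  by lra.
rewrite h1 ger_pMl ?divr_gt0 // gerBl invr_ge0 exprn_ge0 //.
Qed.

End CoreDistance.

Section LeafDistance.
Variables (R : realType) (T : choiceType) (cc : T -> T -> T -> Prop).
Hypothesis bt : betweenness cc.
Implicit Types s t u v : T.
Variables (I : choiceType) (lf : set I) (hgt : I -> T -> R) (base : I -> T) (idx : T -> nat).
Hypothesis hgt01 : forall i s, 0 <= hgt i s <= 1.
Hypothesis hgt_between : forall i s t u, cc s t u -> between (hgt i s) (hgt i t) (hgt i u).
Hypothesis hgt_level : forall i (a : R), 0 < a < 1 -> exists u, hgt i u = a /\
  forall s t, between (hgt i s) (hgt i t) a -> cc s t u.
Hypothesis hgt_base : forall i, hgt i (base i) = 0.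
Hypothesis hgt_uniq : forall i j s, lf i -> lf j -> hgt i s != 0 -> hgt j s != 0 -> i = j.
Hypothesis hgt_base_cc : forall i s t, lf i -> hgt i t != 0 -> hgt i s = 0 -> cc s t (base i).
Hypothesis idx_inj : forall i j, lf i -> lf j -> idx (base i) = idx (base j) -> base i = base j.

(** By [hgt_uniq] there is at most one leaf edge over which s has positive
    height. *)
Let arms s : seq I :=
  if pselect (exists i, lf i /\ hgt i s != 0) is left h then [:: projT1 (cid h)] else [::].

Let arms_lf s i : i \in arms s -> lf i.
Proof.
rewrite /arms; case: pselect => // h; rewrite inE => /eqP ->.
by case: (cid h) => j [].
Qed.

Let armsP s i : lf i -> hgt i s != 0 -> i \in arms s.
Proof.
move=> li hi; rewrite /arms; case: pselect => [h|[]]; last by exists i.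
rewrite inE; case: (cid h) => j [lj hj] /=; apply/eqP; exact: hgt_uniq hi hj.
Qed.

Let lam i : R := 2 ^- idx (base i).

Let lam_gt0 i : 0 < lam i. Proof. by rewrite /lam invr_gt0 exprn_gt0. Qed.

Let term i s t := lam i * `|hgt i s - hgt i t|.

Let term_ge0 i s t : 0 <= term i s t.
Proof. by rewrite mulr_ge0 // ltW. Qed.

(** The sum over all leaf edges, of which at most two contribute.  The weight
    depends on the base only, so all leaf edges at a point have one length. *)
Definition leaf_dist s t : R := \sum_(i <- undup (arms s ++ arms t)) term i s t.

(** Allows the three sums of a triangle to be taken over one common range. *)
Let leaf_distE (r : seq I) s t : uniq r -> (forall i, i \in r -> lf i) ->
  {subset arms s <= r} -> {subset arms t <= r} ->
  leaf_dist s t = \sum_(i <- r) term i s t.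
Proof.
move=> ur lr sr tr; rewrite /leaf_dist.
rewrite [RHS](bigID (mem (undup (arms s ++ arms t)))) /= [X in _ + X]big1_seq ?addr0.
  rewrite -[RHS]big_filter; apply: perm_big; apply: uniq_perm.
  - exact: undup_uniq.
  - exact: filter_uniq.
  - move=> i; rewrite mem_filter /= mem_undup mem_cat.
    by case: (boolP (i \in arms s)) => [/sr ->//|_]; case: (boolP (i \in arms t)) => [/tr ->|].
move=> i /andP[]; rewrite mem_undup mem_cat negb_or => /andP[is_ it_] ir.
have h0 v : i \notin arms v -> hgt i v = 0.
  by move=> iv; apply: contraNeq iv => h; apply: armsP => //; exact: lr.
by rewrite /term !h0 // subrr normr0 mulr0.
Qed.

Let all3 s t u := undup (arms s ++ arms t ++ arms u).

Let leaf3 s t u : [/\ leaf_dist s t = \sum_(i <- all3 s t u) term i s t,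
  leaf_dist t u = \sum_(i <- all3 s t u) term i t u &
  leaf_dist s u = \sum_(i <- all3 s t u) term i s u].
Proof.
have hl i : i \in all3 s t u -> lf i.
  by rewrite mem_undup !mem_cat => /or3P[] /arms_lf.
have sub v : v \in [:: s; t; u] -> {subset arms v <= all3 s t u}.
  move=> hv i iv; rewrite mem_undup !mem_cat; move: hv iv.
  by rewrite !inE => /or3P[] /eqP -> ->; rewrite ?orbT.
by split; apply: leaf_distE; rewrite ?undup_uniq //; apply: sub; rewrite !inE eqxx ?orbT.
Qed.

Lemma leaf_dist_ge0 s t : 0 <= leaf_dist s t.
Proof. by apply: sumr_ge0 => i _; exact: term_ge0. Qed.

Lemma leaf_dist_xx s : leaf_dist s s = 0.
Proof. by rewrite /leaf_dist big1 // => i _; rewrite /term subrr normr0 mulr0. Qed.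

Lemma leaf_dist_sym s t : leaf_dist s t = leaf_dist t s.
Proof.
have [-> _ _] := leaf3 s t s; have [_ -> _] := leaf3 s t s.
by apply: eq_bigr => i _; rewrite /term distrC.
Qed.

Lemma leaf_dist_triangle t s u : leaf_dist s u <= leaf_dist s t + leaf_dist t u.
Proof.
have [-> -> ->] := leaf3 s t u; rewrite -big_split /=; apply: ler_sum => i _.
by rewrite /term -mulrDr ler_pM2l // ler_distD.
Qed.

Lemma leaf_dist_add s t u : cc s t u -> leaf_dist s t = leaf_dist s u + leaf_dist u t.
Proof.
move=> stu; have [-> -> ->] := leaf3 s u t; rewrite -big_split /=; apply: eq_bigr => i _.
by rewrite /term -mulrDr (between_dist (hgt_between i stu)).
Qed.

Lemma leaf_dist_term i s t : lf i -> lam i * `|hgt i s - hgt i t| <= leaf_dist s t.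
Proof.
move=> li; have [h|h] := boolP (i \in arms s ++ arms t).
  rewrite /leaf_dist (bigD1_seq i) ?undup_uniq ?mem_undup //= lerDl.
  by apply: sumr_ge0 => j _; exact: term_ge0.
move: h; rewrite mem_cat negb_or => /andP[is_ it_].
have h0 v : i \notin arms v -> hgt i v = 0.
  by move=> iv; apply: contraNeq iv => h; exact: armsP.
by rewrite !h0 // subrr normr0 mulr0 leaf_dist_ge0.
Qed.

Lemma hgt_scale i : scale cc (hgt i).
Proof.
split => //; first exact: hgt_between.
move=> p q s t pq sp qt; have [|u [hu Hu]] := @hgt_level i ((p + q) / 2).
  have /andP[s0 s1] := hgt01 i s; have /andP[t0 t1] := hgt01 i t.
  by apply/andP; split; lra.
exists u; rewrite hu; split; first by apply/andP; split; lra.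
move=> s' t' /andP[h1 h2]; apply: Hu; rewrite /between; apply/orP; left.
by rewrite (ltW h1) (ltW h2).
Qed.

Let sum_arms s (F : I -> R) e : 0 <= e -> (forall i, i \in arms s -> F i <= e) ->
  \sum_(i <- arms s) F i <= e.
Proof.
rewrite /arms; case: pselect => [h|_] e0 he; last by rewrite big_nil.
by rewrite big_seq1; apply: he; rewrite inE.
Qed.

Let leaf_dist_le s t : leaf_dist s t <=
  \sum_(i <- arms s) term i s t + \sum_(i <- arms t) term i s t.
Proof.
rewrite /leaf_dist -big_cat /=; elim: (arms s ++ arms t) => [|i r IH] /=.
  by rewrite !big_nil.
rewrite [X in _ <= X]big_cons; case: ifP => _; last first.
  by rewrite big_cons lerD2l.
by apply: (le_trans IH); rewrite lerDr; exact: term_ge0.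
Qed.

(** A leaf edge that contributes is the one with s on it, where the difference
    of heights is controlled by [scale_local]; or it is based at s, where it is
    controlled by the bound d; or its base lies in [s, t].  Finitely many bases
    have a large weight, and these are put into A. *)
Lemma leaf_dist_local s (e : R) : 0 < e -> exists (A : set T) (d : R),
  [/\ finite_set A, ~ A s, 0 < d &
   forall t, (forall a, A a -> ~ cc s t a) ->
     (forall i, lf i -> base i = s -> hgt i t < d) -> leaf_dist s t < e].
Proof.
move=> e0; have e4 : 0 < e / 4 by rewrite divr_gt0.
have [n hn] := exprV_lt e4.
pose A1 := [set base i | i in [set i | lf i /\ (idx (base i) < n)%N]] `\ s.
have fA1 : finite_set A1.
  pose g k := xget s [set a | exists i, [/\ lf i, base i = a & idx a = k]].
  apply: (@sub_finite_set _ _ [set g k | k in `I_n]); last first.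
    by apply: finite_image; exact: finite_II.
  move=> a [[i [li idn] <-] _]; exists (idx (base i)) => //.
  have [j [lj ja jk]] : exists j, [/\ lf j, base j = g (idx (base i)) & idx (g (idx (base i))) = idx (base i)].
    by apply: (@xgetPex _ s [set a | exists j, [/\ lf j, base j = a & idx a = idx (base i)]]); exists (base i), i.
  by rewrite -ja; apply: idx_inj => //; rewrite ja.
have [A2 [fA2 sA2 hA2]] : exists A : set T, [/\ finite_set A, ~ A s &
    forall t, (forall a, A a -> ~ cc s t a) ->
      forall i, i \in arms s -> `|hgt i s - hgt i t| < e / 4].
  have [i0 hi0] : exists i0 : option I, forall i, i \in arms s -> i0 = Some i.
    rewrite /arms; case: pselect => [h|_]; last by exists None.
    by exists (Some (projT1 (cid h))) => i; rewrite inE => /eqP ->.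
  case: i0 hi0 => [i0|] hi0; last by exists set0; split => // t _ i /hi0.
  have [A [fA sA hA]] := scale_local bt s (hgt_scale i0) e4.
  by exists A; split => // t ht i /hi0 [<-]; exact: hA.
exists (A1 `|` A2), (e / 4); split => //.
- by rewrite finite_setU.
- by move=> [[_ /(_ erefl)]|].
move=> t ht hfrac; have {}hA2 := hA2 t (fun a Aa => ht a (or_intror Aa)).
have lam1 i : lam i <= 1.
  by rewrite /lam invf_le1 ?exprn_gt0 // exprn_ege1 // ler1n.
have h1 : \sum_(i <- arms s) term i s t <= e / 4.
  apply: sum_arms => [|i is_]; first exact: ltW.
  apply: (le_trans _ (ltW (hA2 i is_))); rewrite /term ler_piMl //.
have h2 : \sum_(i <- arms t) term i s t <= e / 4.
  apply: sum_arms => [|i it_]; first exact: ltW.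
  have li := arms_lf it_.
  have [hs|hs] := eqVneq (hgt i s) 0; last first.
    have is_ := armsP li hs.
    apply: (le_trans _ (ltW (hA2 i is_))); rewrite /term ler_piMl //.
  have [ht0|ht0] := eqVneq (hgt i t) 0.
    by rewrite /term hs ht0 subrr normr0 mulr0 ltW.
  have ab : `|hgt i s - hgt i t| = hgt i t.
    by rewrite hs sub0r normrN ger0_norm //; case/andP: (hgt01 i t).
  have [bs|bs] := pselect (base i = s).
    apply: (le_trans _ (ltW (hfrac i li bs))).
    by rewrite /term ab ler_piMl //; case/andP: (hgt01 i t).
  have bst := hgt_base_cc li ht0 hs.
  have idn : (n <= idx (base i))%N.
    rewrite leqNgt; apply/negP => idn; apply: (ht (base i)) => //.
    by left; split => //; exists i.
  apply: (le_trans _ (ltW hn)); rewrite /term ab.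
  have : lam i * hgt i t <= lam i.
    by rewrite ger_pMr //; case/andP: (hgt01 i t).
  move=> /le_trans; apply; rewrite /lam lef_pV2 ?posrE ?exprn_gt0 //.
  by rewrite ler_eXn2l // ltr1n.
by apply: (le_lt_trans (leaf_dist_le s t)); lra.
Qed.

End LeafDistance.

(** * The metric on the tree *)
Section TreeMetric.
Variables (R : realType) (T : choiceType) (cc : T -> T -> T -> Prop).
Hypothesis bt : betweenness cc.
Implicit Types s t u v w : T.

(** Segments are isometric to real intervals. *)
Record tree_metric (d : metric_on R T) : Prop := TreeMetric {
  tm_add : forall s t u, cc s t u -> d s t = d s u + d u t ;
  tm_onto : forall s t (y : R), 0 <= y <= d s t -> exists u, cc s t u /\ d s u = y
}.

(** Dedekind completeness of [a, b], in the form in which [T_gap] proves it. *)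
Definition complete_segment (a b : T) := forall L : set T,
  L `<=` cc a b -> L a -> ~ L b ->
  (forall u v, L v -> cc a v u -> L u) ->
  (forall u, L u -> exists v, [/\ L v, u <> v & cc a v u]) ->
  (forall v, cc a b v -> ~ L v -> exists u, [/\ cc a b u, ~ L u, u <> v & cc a v u]) ->
  False.

Variable Phi : nat -> T -> R.
Hypothesis Phi_scale : forall i, scale cc (Phi i).
Variables (I : choiceType) (lf : set I) (hgt : I -> T -> R) (base : I -> T) (idx : T -> nat).
Hypothesis hgt01 : forall i s, 0 <= hgt i s <= 1.
Hypothesis hgt_between : forall i s t u, cc s t u -> between (hgt i s) (hgt i t) (hgt i u).
Hypothesis hgt_level : forall i (a : R), 0 < a < 1 -> exists u, hgt i u = a /\
  forall s t, between (hgt i s) (hgt i t) a -> cc s t u.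
Hypothesis hgt_base : forall i, hgt i (base i) = 0.
Hypothesis hgt_uniq : forall i j s, lf i -> lf j -> hgt i s != 0 -> hgt j s != 0 -> i = j.
Hypothesis hgt_base_cc : forall i s t, lf i -> hgt i t != 0 -> hgt i s = 0 -> cc s t (base i).
Hypothesis idx_inj : forall i j, lf i -> lf j -> idx (base i) = idx (base j) -> base i = base j.
Hypothesis dense : forall s t, s <> t -> exists u, [/\ cc s t u, u <> s & u <> t].
Hypothesis separating : forall s t, s <> t -> (forall i, lf i -> hgt i s = hgt i t) ->
  exists i, Phi i s <> Phi i t.
Hypothesis complete : forall s t, exists a b, [/\ cc a b s, cc a b t & complete_segment a b].

Let d0 s t := core_dist Phi s t + leaf_dist lf hgt base idx s t.

Let d0_xx s : d0 s s = 0.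
Proof. by rewrite /d0 (core_dist_xx Phi_scale) leaf_dist_xx addr0. Qed.

Let lam i : R := 2 ^- idx (base i).

Let lam_gt0 i : 0 < lam i. Proof. by rewrite /lam invr_gt0 exprn_gt0. Qed.

Let hgt_d0 i s t : lf i -> lam i * `|hgt i s - hgt i t| <= d0 s t.
Proof.
move=> li; apply: le_trans (leaf_dist_term base idx hgt_uniq s t li) _.
by rewrite /d0 lerDr; exact: (core_dist_ge0 Phi_scale).
Qed.

Let d0_eq0 s t : d0 s t = 0 -> s = t.
Proof.
move=> h; apply: contrapT => st.
have c0 := core_dist_ge0 Phi_scale s t.
have l0 := leaf_dist_ge0 lf hgt base idx s t.
have [i lf_i|i] := separating st.
  have := hgt_d0 s t lf_i; rewrite h pmulr_rle0 // normr_le0 subr_eq0 => /eqP //.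
apply; apply: (core_dist_eq0 Phi_scale).
by move: h; rewrite /d0 => h; lra.
Qed.

Let d0_sym s t : d0 s t = d0 t s.
Proof. by rewrite /d0 core_dist_sym (leaf_dist_sym base idx hgt_uniq). Qed.

Let d0_triangle t s u : d0 s u <= d0 s t + d0 t u.
Proof.
rewrite /d0 addrACA; apply: lerD; first exact: (core_dist_triangle Phi_scale).
exact: leaf_dist_triangle.
Qed.

Let d : metric_on R T := MetricOn d0_xx d0_eq0 d0_sym d0_triangle.

Let d_add s t u : cc s t u -> d s t = d s u + d u t.
Proof.
move=> stu; rewrite /d /= /d0 addrACA; congr (_ + _).
  exact: (core_dist_add Phi_scale).
exact: (leaf_dist_add base idx hgt_between hgt_uniq).
Qed.

Let d_local s (e : R) : 0 < e -> exists (A : set T) (c : R),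
  [/\ finite_set A, ~ A s, 0 < c &
   forall t, (forall a, A a -> ~ cc s t a) ->
     (forall i, lf i -> base i = s -> hgt i t < c) -> d s t < e].
Proof.
move=> e0; have e2 : 0 < e / 2 by rewrite divr_gt0.
have [A1 [fA1 sA1 h1]] := core_dist_local bt Phi_scale s e2.
have [A2 [c [fA2 sA2 c0 h2]]] := leaf_dist_local bt hgt01 hgt_between hgt_level
  hgt_uniq hgt_base_cc idx_inj s e2.
exists (A1 `|` A2), c; split => //; [by rewrite finite_setU|by case|].
move=> t ht hc; rewrite /d /= /d0.
have := h1 t (fun a Aa => ht a (or_introl Aa)).
have := h2 t (fun a Aa => ht a (or_intror Aa)) hc.
by move=> ? ?; lra.
Qed.

Let d_ge0 s t : 0 <= d s t.
Proof. by rewrite /d /= /d0 addr_ge0 //; [exact: (core_dist_ge0 Phi_scale)|exact: leaf_dist_ge0]. Qed.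

(** By [d_local], it is enough to find v close enough to u along the segment to
    avoid finitely many points, which is possible by density, and to stay low on
    a leaf edge based at u. *)
Let d_step u t (e : R) : u <> t -> 0 < e -> exists v, [/\ cc u t v, v <> u & d u v < e].
Proof.
move=> ut /(d_local u)[A [c [fA uA c0 hA]]].
have [w [utw wu hw]] : exists w, [/\ cc u t w, w <> u & forall v, cc u w v ->
    forall i, lf i -> base i = u -> hgt i v < c].
  have [[i [li bi hi]]|nh] := pselect (exists i, [/\ lf i, base i = u & c <= hgt i t]).
    pose a := Num.min c 1 / 2.
    have /andP[t0 t1] := hgt01 i t.
    have [a0 ac a1] : [/\ 0 < a, a < c & a < 1].
      by rewrite /a; have [h|h] := leP c 1; split; lra.
    have [w [hw Hw]] := @hgt_level i a (introT andP (conj a0 a1)).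
    have hu : hgt i u = 0 by rewrite -bi.
    exists w; split.
    - by apply: Hw; rewrite hu /between; apply/orP; left; apply/andP; split; lra.
    - by move=> wu; move: hw; rewrite wu hu => e0; rewrite -e0 ltxx in a0.
    - move=> v uwv j lj bj; have := hgt_between j uwv.
      have -> : hgt j u = 0 by rewrite -bj.
      have [ij|ij] := eqVneq j i.
        by rewrite ij hw /between => /orP[/andP[]|/andP[]] *; lra.
      have -> : hgt j w = 0.
        apply: contrapT => /eqP hj; move/eqP: ij; apply.
        by apply: (hgt_uniq (s := w)) => //; rewrite hw gt_eqF.
      by rewrite /between orbb => /andP[]; lra.
  exists t; split; [exact: (bt_r bt)|exact: nesym|].
  move=> v utv i li bi; have ht : hgt i t < c.
    by rewrite ltNge; apply/negP => h; apply: nh; exists i.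
  have := hgt_between i utv; have -> : hgt i u = 0 by rewrite -bi.
  have /andP[t0 t1] := hgt01 i t.
  by rewrite /between => /orP[/andP[]|/andP[]] *; lra.
have [v [uwv vu vA]] : exists v, [/\ cc u w v, v <> u & forall a, A a -> ~ cc u v a].
  have /finite_setP[n] := fA; move: uA => {hA fA}.
  elim: n A => [|n IH] A uA An.
    exists w; split => //; first exact: (bt_r bt).
    by move=> a Aa; move: An; rewrite II0 card_eq0 => /eqP A0; rewrite A0 in Aa.
  have /eq_cardSP[a Aa hD] := An.
  have uD : ~ (A `\ a) u by move=> [].
  have [v [uwv vu hv]] := IH _ uD hD.
  have [uva|uva] := pselect (cc u v a); last first.
    exists v; split => // b Ab; have [->//|ba] := pselect (b = a).
    by apply: hv; split.
  have ua : u <> a by move=> e'; apply: uA; rewrite e'.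
  have [m [uam mu ma]] := dense ua.
  have uvm : cc u v m by exact: (bt_trans bt uva uam).
  exists m; split => //; first exact: (bt_trans bt uwv uvm).
  move=> b Ab umb; have [ba|ba] := pselect (b = a).
    by subst b; apply: ma; exact: (bt_anti bt uam umb).
  by apply: (hv b); [split|exact: (bt_trans bt uvm umb)].
exists v; split => //; first exact: (bt_trans bt utw uwv).
by apply: hA => // i li bi; exact: hw.
Qed.

(** If the value y were not taken, the points at distance less than y from a
    would be an initial part whose existence contradicts completeness: by
    [d_step] it has no last element and its complement no first one. *)
Let onto_complete a b (y : R) : complete_segment a b -> 0 <= y <= d a b ->
  exists u, cc a b u /\ d a u = y.
Proof.
move=> cab /andP[y0 yab]; apply: contrapT => /forallNP nu.
have neq u : cc a b u -> d a u <> y by move=> abu h; apply: (nu u).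
have ya : 0 < y.
  by rewrite lt_neqAle y0 andbT; apply/eqP => e; apply: (neq a); [exact: (bt_l bt)|rewrite -e; exact: d0_xx].
have yb : y < d a b.
  by rewrite lt_neqAle yab andbT; apply/eqP => /esym; apply: neq; exact: (bt_r bt).
have mono v u : cc a v u -> d a u <= d a v.
  by move=> /d_add ->; rewrite lerDl.
apply: (cab [set u | cc a b u /\ d a u < y]).
- by move=> u [].
- by split; [exact: (bt_l bt)|rewrite /d /= d0_xx].
- by move=> [_]; rewrite ltNge ltW.
- move=> u v [abv dv] avu; split; first exact: (bt_trans bt abv avu).
  exact: le_lt_trans (mono _ _ avu) dv.
- move=> u [abu du]; have ub : u <> b by move=> e; rewrite e in du; move: du; rewrite ltNge ltW.
  have e0 : 0 < y - d a u by rewrite subr_gt0.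
  have [v [ubv vu duv]] := d_step ub e0.
  have abv : cc a b v by apply: (bt_sub bt abu _ ubv); exact: (bt_r bt).
  have avu : cc a v u.
    have [//|h] := bt_total bt abv abu.
    by case: vu; apply: (bt_meet bt abu h ubv).
  exists v; split => //; last exact: nesym.
  by split => //; rewrite (d_add avu); lra.
- move=> v abv nv; have dv : y < d a v.
    rewrite lt_neqAle; apply/andP; split; first by apply/eqP => /esym; exact: neq.
    by rewrite leNgt; apply/negP => h; apply: nv.
  have va : v <> a by move=> e; move: dv; rewrite e /d /= d0_xx ltNge ltW.
  have e0 : 0 < d a v - y by rewrite subr_gt0.
  have [u [vau uv dvu]] := d_step va e0.
  have avu := bt_sym bt vau.
  exists u; split => //; first exact: (bt_trans bt abv avu).
  move=> [_ du]; have := d_add avu; rewrite [d u v]d0_sym => e.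
  by move: dvu; rewrite -/(d v u) => dvu; have : d v u = d0 v u by []; lra.
Qed.

Let d_onto s t (y : R) : 0 <= y <= d s t -> exists u, cc s t u /\ d s u = y.
Proof.
move=> /andP[y0 yst]; have [a [b [abs abt cab]]] := complete s t.
have dsym u v : d u v = d v u by exact: d0_sym.
have [ats|ast] := bt_total bt abt abs.
  have e1 := d_add ats; have e2 := d_add abt; have h := d_ge0 t b; have h' := d_ge0 a s.
  have [|v [abv dv]] := @onto_complete a b (d a s + y) cab.
    by apply/andP; split; lra.
  have [avs|asv] := bt_total bt abv abs; last first.
    have e3 := d_add asv; have h3 := d_ge0 v s.
    exists s; split; first exact: (bt_l bt).
    by rewrite [LHS]d0_xx; lra.
  have e3 := d_add avs.
  have [avt|atv] := bt_total bt abv abt.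
    have e4 := d_add avt; have h4 := d_ge0 t v.
    exists t; split; first exact: (bt_r bt).
    by lra.
  exists v; split; last by lra.
  exact: (bt_order bt atv avs).
have e1 := d_add ast; have h := d_ge0 a t; have e2 := d_add abs; have h' := d_ge0 s b.
rewrite dsym in yst; have [|v [abv dv]] := @onto_complete a b (d a s - y) cab.
  by apply/andP; split; lra.
have [asv|avs] := bt_total bt abs abv; last first.
  have e3 := d_add avs; have h3 := d_ge0 s v.
  exists s; split; first exact: (bt_l bt).
  by rewrite [LHS]d0_xx; lra.
have e3 := d_add asv.
have [atv|avt] := bt_total bt abt abv.
  have e4 := d_add atv; have h4 := d_ge0 v t.
  exists t; split; first exact: (bt_r bt).
  by rewrite dsym; lra.
exists v; split; last by rewrite dsym; lra.
by apply: (bt_sym bt); exact: (bt_order bt asv avt).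
Qed.

(** The last two clauses determine the topology without reference to d: a
    neighbourhood of s contains all t such that [s, t] avoids some finite set and
    t is low on the leaf edges at s, and conversely d controls the heights. *)
Lemma tree_metric_exists : exists d : metric_on R T, [/\ tree_metric d,
  forall s (e : R), 0 < e -> exists (A : set T) (c : R),
    [/\ finite_set A, ~ A s, 0 < c &
     forall t, (forall a, A a -> ~ cc s t a) ->
       (forall i, lf i -> base i = s -> hgt i t < c) -> d s t < e] &
  exists l : T -> R, (forall a, 0 < l a) /\
    forall i s t, lf i -> l (base i) * `|hgt i s - hgt i t| <= d s t].
Proof.
exists d; split; [split; [exact: d_add|exact: d_onto]|exact: d_local|].
exists (fun a => 2 ^- idx a); split; first by move=> a; rewrite invr_gt0 exprn_gt0.
by move=> i s t li; exact: hgt_d0.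
Qed.

End TreeMetric.

(** One function of [urysohn_scale] for each pair of points of Q, enumerated by
    pairs of natural numbers. *)
Lemma scale_family (R : realType) (T : choiceType) (cc : T -> T -> T -> Prop) (Q : set T) :
  betweenness cc -> (forall s t, s <> t -> exists u, [/\ cc s t u, u <> s & u <> t]) ->
  countable Q -> exists Phi : nat -> T -> R, (forall n, scale cc (Phi n)) /\
    forall u v, Q u -> Q v -> u <> v -> exists n, Phi n u <> Phi n v.
Proof.
move=> bt dense /countable_injP[f finj].
pose good (ij : nat * nat) (g : T -> R) := scale cc g /\
  forall u v, Q u -> Q v -> u <> v -> f u = ij.1 -> f v = ij.2 -> g u <> g v.
have exg ij : exists g, good ij g.
  have [[[u v] [Qu [Qv [uv [fu fv]]]]]|none] := pselect (exists uv : T * T,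
      Q uv.1 /\ Q uv.2 /\ uv.1 <> uv.2 /\ f uv.1 = ij.1 /\ f uv.2 = ij.2).
    have [g [sg gu gv]] := urysohn_scale R bt dense uv.
    exists g; split => // u' v' Qu' Qv' _ fu' fv'.
    have -> : u' = u by apply: finj; rewrite ?inE // fu' fu.
    have -> : v' = v by apply: finj; rewrite ?inE // fv' fv.
    by rewrite gu gv => /eqP; rewrite eq_sym oner_eq0.
  exists (fun=> 0); split.
    split => [s|s t u _|p q s t pq p0 q0]; first by rewrite lexx ler01.
      by rewrite /between lexx.
    by have := le_lt_trans p0 (lt_le_trans pq q0); rewrite ltxx.
  by move=> u v Qu Qv uv fu fv; exfalso; apply: none; exists (u, v).
pose G ij := projT1 (cid (exg ij)).
have GP ij : good ij (G ij) by exact: (projT2 (cid (exg ij))).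
exists (fun n => if choice.unpickle n is Some ij then G ij else G (0%N, 0%N)).
split=> [n|u v Qu Qv uv].
  by case: (choice.unpickle n) => [ij|]; [case: (GP ij)|case: (GP (0%N, 0%N))].
exists (choice.pickle (f u, f v)); rewrite choice.pickleK.
by case: (GP (f u, f v)) => _; apply.
Qed.

Section CutPointTreeMetric.
Variables (R : realType) (X : metricType R).
Hypothesis contX : continuum X.
Local Notation T := (cp_tree R X).

Lemma cp_tree_metric : exists d : metric_on R T, [/\ tree_metric (@T_cc R X) d,
  forall s (e : R), 0 < e -> exists (A : set T) (c : R),
    [/\ finite_set A, ~ A s, 0 < c &
     forall t, (forall a, A a -> ~ T_cc s t a) ->
       (forall E, leaf_edge E -> vtx R (leaf_base E) = s -> height E t < c) -> d s t < e] &
  exists l : T -> R, (forall a, 0 < l a) /\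
    forall E s t, leaf_edge E ->
      l (vtx R (leaf_base E)) * `|height E s - height E t| <= d s t].
Proof.
have bt := T_betweenness contX.
have [Q cQ QP] := tree_dense_set contX.
have [Phi [sPhi PhiP]] := scale_family R bt (T_dense contX) cQ.
have /countable_injP[f finj] := countable_leaf_edge_bases contX.
pose idx (t : T) := if t is inl x then f x else 0%N.
apply: (@tree_metric_exists R T _ bt Phi sPhi (edge X) (@leaf_edge R X) (@height R X)
  (fun E => vtx R (leaf_base E)) idx).
- exact: height01.
- exact: height_between.
- exact: height_level.
- exact: height_base.
- by move=> E F s; exact: height_uniq.
- exact: height_base_cc.
- move=> E F lE lF /= h; congr vtx; apply: finj => //.
    by rewrite inE; exists E.
  by rewrite inE; exists F.
- exact: T_dense.
- move=> s t st hst; have [u [v [Qu Qv uv stu stv]]] := QP s t st hst.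
  have [n hn] := PhiP u v Qu Qv uv; exists n => e; apply: hn.
  have [_ bet _] := sPhi n.
  have := bet _ _ _ stu; have := bet _ _ _ stv; rewrite e /between !orbb.
  by move=> /andP[h1 h2] /andP[h3 h4]; apply/eqP; rewrite eq_le (le_trans h4 h1) (le_trans h2 h3).
- move=> s t; have [x [y [h1 h2]]] := T_extend contX s t.
  exists (vtx R x), (vtx R y); split => // L; exact: T_gap.
Qed.

End CutPointTreeMetric.

(** * Trees with a metric that is additive along segments *)
Section Clamp.
Variable R : realType.
Implicit Types D x y : R.

Definition clamp D x : R := Num.max 0 (Num.min x D).

Lemma clamp_itv D x : 0 <= D -> 0 <= clamp D x <= D.
Proof. by move=> D0; rewrite /clamp le_max lexx /= ge_max D0 ge_min lexx orbT. Qed.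

Lemma clamp_id D x : 0 <= x <= D -> clamp D x = x.
Proof. by move=> /andP[x0 xD]; rewrite /clamp min_l // max_r. Qed.

Lemma clamp_dist D x y : 0 <= D -> `|clamp D x - clamp D y| <= `|x - y|.
Proof.
move=> D0; rewrite /clamp.
have [xD|xD] := leP x D; have [yD|yD] := leP y D; have [x0|x0] := ltP 0 x;
  have [y0|y0] := ltP 0 y; rewrite ?(max_r (ltW x0)) ?(max_r (ltW y0)) ?(max_l x0)
  ?(max_l y0) ?(max_r D0) //; rewrite !ler_norml; (try (apply/andP; split));
  have := ler_norm (x - y); have := ler_norm (- (x - y)); rewrite normrN; lra.
Qed.

End Clamp.

(** A linearly ordered space that is order isomorphic to the real interval
    [0, D] by v is homeomorphic to it. *)
Section OrderedSegment.
Variables (R : realType) (D : R) (disp : Order.disp_t) (L : orderTopologicalType disp).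
Variable v : L -> R.
Hypothesis v_lt : forall x y, (x < y)%O = (v x < v y).
Hypothesis v_seg : forall x, 0 <= v x <= D.
Hypothesis v_onto : forall y, 0 <= y <= D -> exists x, v x = y.

Lemma segment_coord_continuous : continuous v.
Proof.
move=> x; apply/cvgrPdist_lt => e e0.
have h1 : nbhs x [set y : L | v y < v x + e].
  have [z1|z1] := leP (v x + e) D.
    have z0 : 0 <= v x + e <= D.
      by have /andP[] := v_seg x => ? _; apply/andP; split => //; rewrite addr_ge0 // ltW.
    have [z vz] := v_onto z0.
    apply: open_nbhs_nbhs; split.
      rewrite (_ : mkset _ = [set` `]-oo, z[]); first exact: lray_open.
      by apply/seteqP; split => y /=; rewrite in_itv /= v_lt vz.
    by rewrite /= ltrDl.
  by near=> y; have /andP[_ h] := v_seg y; exact: le_lt_trans h z1.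
have h2 : nbhs x [set y : L | v x - e < v y].
  have [z1|z1] := leP 0 (v x - e).
    have z0 : 0 <= v x - e <= D.
      by have /andP[_ h] := v_seg x; apply/andP; split => //; rewrite lerBlDr (le_trans h) // lerDl ltW.
    have [z vz] := v_onto z0.
    apply: open_nbhs_nbhs; split.
      rewrite (_ : mkset _ = [set` `]z, +oo[]); first exact: rray_open.
      by apply/seteqP; split => y /=; rewrite in_itv /= andbT v_lt vz.
    by rewrite /= ltrBlDr ltrDl.
  by near=> y; have /andP[h _] := v_seg y; exact: lt_le_trans z1 h.
near=> y; rewrite ltr_norml.
have : v y < v x + e by near: y.
have : v x - e < v y by near: y.
by move=> *; apply/andP; split; lra.
Unshelve. all: by end_near. Qed.

Hypothesis D0 : 0 <= D.

Let proj (x : R) : L := projT1 (cid (v_onto (clamp_itv x D0))).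
Let v_proj x : v (proj x) = clamp D x.
Proof. exact: (projT2 (cid (v_onto (clamp_itv x D0)))). Qed.

Let open_prop (P : Prop) : open [set _ : R | P].
Proof.
have [p|p] := pselect P.
  suff -> : [set _ : R | P] = setT by exact: openT.
  by apply/seteqP; split.
suff -> : [set _ : R | P] = set0 by exact: open0.
by apply/seteqP; split.
Qed.

Let proj_continuous : continuous proj.
Proof.
have oc (i : interval L) : itv_open_ends i -> open (proj @^-1` [set` i]).
  have eR (z : L) : open (proj @^-1` [set` `]z, +oo[]).
    have -> : proj @^-1` [set` `]z, +oo[] = [set x | v z < x] `&` [set x | v z < D].
      apply/seteqP; split => x; rewrite /= in_itv /= andbT v_lt v_proj lt_max lt_min.
        by move=> /orP[|/andP[//]]; have /andP[] := v_seg z => *; lra.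
      by move=> [-> ->]; rewrite orbT.
    apply: openI; first exact: open_gt.
    exact: open_prop.
  have eL (z : L) : open (proj @^-1` [set` `]-oo, z[]).
    have -> : proj @^-1` [set` `]-oo, z[] = [set x | x < v z] `&` [set x | 0 < v z].
      apply/seteqP; split => x; rewrite /= in_itv /= v_lt v_proj gt_max gt_min.
        by move=> /andP[? /orP[|]] *; split => //; have /andP[] := v_seg z => *; lra.
      by move=> [-> ->].
    apply: openI; first exact: open_lt.
    exact: open_prop.
  case: i => [[[]a|[]]] [[]b|[]] //= _.
  - by rewrite set_itv_splitI preimage_setI; apply: openI; [exact: eR|exact: eL].
  - by rewrite set_itvE preimage_setT; exact: openT.
move=> x U; rewrite /= itv_nbhsE => -[i [oi xi] iU].
apply: filterS (_ : nbhs x (proj @^-1` [set` i])); first by move=> y /iU.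
by apply: open_nbhs_nbhs; split => //; exact: oc.
Qed.

Let proj_onto : proj @` `[0, D] = [set: L].
Proof.
apply/seteqP; split => // x _; have /andP[x0 xD] := v_seg x.
exists (v x); first by rewrite /= in_itv /= x0 xD.
apply/eqP; rewrite eq_le 2!leNgt !v_lt v_proj /clamp min_l // max_r //.
by rewrite ltxx.
Qed.

Lemma segment_order_compact : compact [set: L].
Proof.
rewrite -proj_onto; apply: continuous_compact; last exact: segment_compact.
exact/continuous_subspaceT/proj_continuous.
Qed.

Lemma segment_order_connected : connected [set: L].
Proof.
rewrite -proj_onto; apply: connected_continuous_connected; first exact: segment_connected.
exact/continuous_subspaceT/proj_continuous.
Qed.

End OrderedSegment.

Definition closed_segment (R : realType) (D : R) : Type := {x : R | 0 <= x <= D}.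

Section ClosedSegment.
Variables (R : realType) (D : R).
HB.instance Definition _ := [isSub of closed_segment D for @sval R _].
HB.instance Definition _ := [Choice of closed_segment D by <:].
HB.instance Definition _ :=
  [SubChoice_isSubOrder of closed_segment D by <: with ring_display].
End ClosedSegment.

Section MetrizedSpace.
Variables (R : realType) (T : choiceType) (d : metric_on R T).
Local Notation M := (metrized d).

Lemma metrized_ge0 (s t : T) : 0 <= d s t.
Proof. exact: (@mdist_ge0 R M). Qed.

Lemma nbhs_metrizedP (s : M) (O : set M) :
  nbhs s O <-> exists2 e, 0 < e & forall t, d s t < e -> O t.
Proof.
split=> [/nbhs_ballP[e e0 h]|[e e0 h]].
  by exists e => // t st; apply: h; rewrite ballEmdist.
by apply/nbhs_ballP; exists e => // t; rewrite ballEmdist; exact: h.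
Qed.

Lemma open_metrizedP (O : set M) :
  open O <-> forall s, O s -> exists2 e, 0 < e & forall t, d s t < e -> O t.
Proof.
by rewrite openE; split=> h s Os; apply/nbhs_metrizedP; exact: h.
Qed.

End MetrizedSpace.

Section TreeMetricSpace.
Variables (R : realType) (T : choiceType) (cc : T -> T -> T -> Prop).
Variable d : metric_on R T.
Hypotheses (bt : betweenness cc) (td : tree_metric cc d).
Local Notation M := (metrized d).
Implicit Types s t u v w : T.

Lemma segment_dist s t u v : cc s t u -> cc s t v -> d u v = `|d s u - d s v|.
Proof.
move=> stu stv; have [suv|svu] := bt_total bt stu stv.
  by rewrite (tm_add td suv) addrAC subrr add0r ger0_norm ?metrized_ge0 // (dist_sym d).
by rewrite (tm_add td svu) opprD addrA subrr add0r normrN ger0_norm ?metrized_ge0.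
Qed.

Lemma segment_dist_le s t u : cc s t u -> d s u <= d s t.
Proof. by move=> /(tm_add td) ->; rewrite lerDl metrized_ge0. Qed.

(** The point of [s, t] at distance x from s, for x clamped to [0, d s t] so
    that the map is defined and 1-Lipschitz on all real numbers. *)
Lemma geodesic_exists s t : exists g : R -> T,
  [/\ forall x, cc s t (g x), forall x, 0 <= x <= d s t -> d s (g x) = x &
      forall x y, d (g x) (g y) <= `|x - y| ].
Proof.
have D0 := metrized_ge0 d s t.
have ex x : exists u, cc s t u /\ d s u = clamp (d s t) x.
  exact/(tm_onto td)/clamp_itv.
exists (fun x => projT1 (cid (ex x))).
have gP x := projT2 (cid (ex x)).
split=> [x|x xD|x y]; first by case: (gP x).
  by case: (gP x) => _ ->; exact: clamp_id.
have [h1 e1] := gP x; have [h2 e2] := gP y.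
by rewrite (segment_dist h1 h2) e1 e2; exact: clamp_dist.
Qed.

Definition geodesic s t := projT1 (cid (geodesic_exists s t)).

Lemma geodesic_cc s t x : cc s t (geodesic s t x).
Proof. by rewrite /geodesic; case: cid => g []. Qed.

Lemma geodesic_dist s t x : 0 <= x <= d s t -> d s (geodesic s t x) = x.
Proof. by rewrite /geodesic; case: cid => g [] /= _ h _; exact: h. Qed.

Lemma geodesic_lipschitz s t x y : d (geodesic s t x) (geodesic s t y) <= `|x - y|.
Proof. by rewrite /geodesic; case: cid => g []. Qed.

Lemma geodesicK s t u : cc s t u -> geodesic s t (d s u) = u.
Proof.
move=> stu; apply: (dist_eq0 (m := d)).
rewrite (segment_dist (geodesic_cc s t _) stu) geodesic_dist ?subrr ?normr0 //.
by rewrite metrized_ge0 segment_dist_le.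
Qed.

Lemma geodesic_continuous s t : continuous (geodesic s t : R -> M).
Proof.
move=> x U /nbhs_metrizedP[e e0 h]; apply/nbhs_ballP; exists e => // y xy.
by apply: h; exact: le_lt_trans (geodesic_lipschitz s t x y) xy.
Qed.

Lemma geodesic_range s t : geodesic s t @` `[0, d s t] = (cc s t : set M).
Proof.
apply/seteqP; split => [_ [x _ <-]|u stu]; first exact: geodesic_cc.
exists (d s u); last exact: geodesicK.
by rewrite /= in_itv /= metrized_ge0 segment_dist_le.
Qed.

Lemma tree_segment_connected s t : connected (cc s t : set M).
Proof.
rewrite -geodesic_range; apply: connected_continuous_connected.
  exact: segment_connected.
exact/continuous_subspaceT/geodesic_continuous.
Qed.

Lemma tree_segment_separable s t : is_separable (cc s t : set M).
Proof.
exists [set geodesic s t (ratr q) | q in [set: rat]]; split.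
- by apply: card_le_trans (card_image_le _ _) _; exact: countableP.
- by move=> _ [q _ <-]; exact: geodesic_cc.
- move=> u stu O /nbhs_metrizedP[e e0 h].
  have /rat_in_itvoo[q] : d s u < d s u + e by rewrite ltrDl.
  rewrite in_itv /= => /andP[q1 q2].
  exists (geodesic s t (ratr q)); split; first by exists q.
  apply: h; rewrite -{1}(geodesicK stu).
  apply: le_lt_trans (geodesic_lipschitz s t _ _) _.
  by rewrite ltr_norml; apply/andP; split; lra.
Qed.

(** The length of a curve is at least the distance of its ends, by the trivial
    partition.  The geodesic, reparametrised on [0, 1], attains this bound: the
    sum over a partition is bounded by a telescoping sum. *)
Lemma tree_path_metric : path_metric M.
Proof.
move=> x y; have D0 := metrized_ge0 d x y; apply/eqP; rewrite eq_le; apply/andP; split.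
  apply: le_ereal_inf_tmp => _ [g [_ g0 g1] <-].
  apply: ereal_sup_ubound; exists [:: 1].
    by rewrite /itv_partition /= ltr01; split.
  by rewrite big_ord_recl big_ord0 /= addr0 g0 g1.
pose g (u : R) : M := geodesic x y (d x y * u).
apply: (@le_trans _ _ (curve_length g)).
  apply: ereal_inf_lbound; exists g => //; split.
  - apply: continuous_subspaceT => u; apply: continuous_comp; last exact: geodesic_continuous.
    exact: mulrl_continuous.
  - by rewrite /g mulr0 -[X in geodesic x y X](dist_xx d x); apply: geodesicK; exact: (bt_l bt).
  - by rewrite /g mulr1; apply: geodesicK; exact: (bt_r bt).
apply: ge_ereal_sup => _ [p [pp /eqP pl] <-]; rewrite lee_fin.
have step (u v : R) : u < v -> d (g u) (g v) <= d x y * (v - u).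
  move=> uv; apply: le_trans (geodesic_lipschitz x y _ _) _.
  by rewrite -mulrBr normrM ger0_norm // distrC gtr0_norm // subr_gt0.
suff : forall a, path <%O a p -> \sum_(i < size p)
    mdist (g (nth 0 (a :: p) i)) (g (nth 0 (a :: p) i.+1)) <= d x y * (last a p - a).
  by move=> /(_ 0 pp); rewrite pl subr0 mulr1.
elim: p {pp pl} => [|b p IH] a /=; first by rewrite big_ord0 subrr mulr0.
move=> /andP[ab bp]; rewrite big_ord_recl /=.
rewrite -(addrNK b (last b p)) -addrA mulrDr [leRHS]addrC.
apply: lerD; first exact: step.
by rewrite [leLHS](_ : _ = \sum_(i < size p)
  mdist (g (nth 0 (b :: p) i)) (g (nth 0 (b :: p) i.+1))) ?IH.
Qed.

(** The geodesic is injective and continuous on a compact space, so it is an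
    embedding. *)
Lemma tree_big_arc s t : s <> t -> big_arc (s : M) t (cc s t).
Proof.
move=> st; have D0 := metrized_ge0 d s t.
pose L : orderTopologicalType ring_display := order_topology (closed_segment (d s t)).
pose v (x : L) : R := sval x.
have v_lt x y : (x < y)%O = (v x < v y) by [].
have v_seg x : 0 <= v x <= d s t by exact: (svalP x).
have v_onto y : 0 <= y <= d s t -> exists x, v x = y by move=> h; exists (exist _ y h).
have v_inj x y : v x = v y -> x = y by move=> h; apply: val_inj.
have cv := segment_coord_continuous v_lt v_seg v_onto.
have cL := segment_order_compact v_lt v_seg v_onto D0.
have nL := segment_order_connected v_lt v_seg v_onto D0.
have [lo vlo] := v_onto 0 (introT andP (conj (lexx _) D0)).
have [hi vhi] := v_onto _ (introT andP (conj D0 (lexx (d s t)))).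
pose f (x : L) : M := geodesic s t (v x).
have finj : injective f.
  move=> x y fxy; apply: v_inj.
  by rewrite -(geodesic_dist (v_seg x)) -(geodesic_dist (v_seg y)) -/(f x) fxy.
have fc : continuous f.
  by move=> x; apply: continuous_comp; [exact: cv|exact: geodesic_continuous].
exists ring_display, L, f, lo, hi; split => //.
- split; first by move=> h; apply: st; apply: (dist_eq0 (m := d)); rewrite -vhi -h vlo.
  move=> l; have /andP[l0 lD] := v_seg l.
  by rewrite !leNgt !v_lt vlo vhi -!leNgt l0.
- split => // U oU; exists (~` (f @` (~` U))).
    rewrite openC; apply: compact_closed; first exact: metric_hausdorff.
    apply: continuous_compact; first exact/continuous_subspaceT.
    rewrite -[~` U]setTI; apply: compact_closedI => //.
    by rewrite closedC.
  apply/seteqP; split => [_ [x Ux <-]|y [nU [x _ fx]]].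
    by split; [move=> [y nUy /finj yx]; apply: nUy; rewrite yx|exists x].
  by exists x => //; apply: contrapT => nUx; apply: nU; exists x.
- apply/seteqP; split => [_ [x _ <-]|u stu]; first exact: geodesic_cc.
  have [|x vx] := v_onto (d s u); first by rewrite metrized_ge0 segment_dist_le.
  by exists x => //; rewrite /f vx geodesicK.
- rewrite /f vlo vhi -[X in geodesic s t X](dist_xx d s) !geodesicK //; first exact: (bt_r bt).
  exact: (bt_l bt).
Qed.

(** A big arc from s to t contains each u of [s, t]: otherwise the points v with
    u in [s, v] and those without would form an open partition of it.  The
    two sets are open because a segment from v to a point at distance less than
    d v u does not contain u.  Conversely a point of the arc outside [s, t] would cut the arc
    into two open pieces, and these would separate the connected set [s, t]. *)
Lemma tree_big_arc_uniq s t (A : set M) : big_arc (s : M) t A -> A = cc s t.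
Proof.
move=> [disp [L [f [lo [hi [[cL nL] [lohi lh] [finj fc fU] <- [flo fhi]]]]]]].
have sub : cc s t `<=` range f.
  move=> u stu; apply: contrapT => nu.
  have us : s <> u by move=> h; apply: nu; exists lo => //; rewrite flo.
  (* the points that u does not separate from s, and those that it does *)
  pose V1 : set M := [set v | v <> u /\ ~ cc s v u].
  pose V2 : set M := [set v | v <> u /\ cc s v u].
  have du v : v <> u -> 0 < d v u.
    by move=> vu; rewrite lt_neqAle metrized_ge0 andbT eq_sym; apply/eqP => /(dist_eq0 (m := d)).
  have gate v v' : d v v' < d v u -> cc v v' u -> False.
    by move=> h /(tm_add td) e; move: h; rewrite e ltNge lerDl metrized_ge0.
  have o1 : open V1.
    apply/open_metrizedP => v [vu nc]; exists (d v u); first exact: du.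
    move=> v' h; split; first by move=> e; rewrite e ltxx in h.
    by move=> c; have [//|] := bt_tri bt v c; exact: gate.
  have o2 : open V2.
    apply/open_metrizedP => v [vu nc]; exists (d v u); first exact: du.
    move=> v' h; split; first by move=> e; rewrite e ltxx in h.
    by have [//|/(bt_sym bt)] := bt_tri bt v' nc; move/gate => /(_ h).
  have := @connected_clopen L [set: L] (f @^-1` V1) (~` (f @^-1` V2)) lo nL.
  move=> /(_ _ _ _ I _ hi I) h; suff : V1 (f hi) by rewrite fhi => -[].
  apply: h.
  - by apply: open_comp => // x _; exact: fc.
  - by rewrite closedC; apply: open_comp => // x _; exact: fc.
  - rewrite !setTI; apply/seteqP; split => x /=; first by move=> [_ h1] [_ h2].
    move=> h; have fu : f x <> u by move=> e; apply: nu; exists x.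
    by split => // h2; apply: h.
  - by rewrite /= flo; split => // /(bt_xx bt) /esym.
apply/seteqP; split => // _ [l _ <-]; apply: contrapT => nl.
have nlo : lo != l by apply/eqP => h; apply: nl; rewrite -h flo; exact: (bt_l bt).
have nhi : l != hi by apply/eqP => h; apply: nl; rewrite h fhi; exact: (bt_r bt).
have [V1 oV1 e1] := fU _ (lray_open l).
have [V2 oV2 e2] := fU _ (rray_open l).
have V1P x : V1 (f x) <-> (x < l)%O.
  split=> [h|h].
    have : (f @` [set` `]-oo, l[]) (f x) by rewrite e1; split => //; exists x.
    by move=> [y /= + /finj <-]; rewrite in_itv.
  have : (f @` [set` `]-oo, l[]) (f x) by exists x => //=; rewrite in_itv.
  by rewrite e1 => -[].
have V2P x : V2 (f x) <-> (l < x)%O.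
  split=> [h|h].
    have : (f @` [set` `]l, +oo[]) (f x) by rewrite e2; split => //; exists x.
    by move=> [y /= + /finj <-]; rewrite in_itv /= andbT.
  have : (f @` [set` `]l, +oo[]) (f x) by exists x => //=; rewrite in_itv /= andbT.
  by rewrite e2 => -[].
have := @connected_clopen M (cc s t) V1 (~` V2) s (@tree_segment_connected s t) oV1.
move=> /(_ _ _ (bt_l bt s t) _ t (bt_r bt s t)) h.
have : V1 t.
  apply: h; first by rewrite closedC.
  - apply/seteqP; split => u [stu]; have [x _ fx] := sub u stu; rewrite -fx.
      by move=> /V1P xl; rewrite fx; split => //= ; rewrite -fx => /V2P; rewrite ltNge ltW.
    move=> /= nV2; rewrite fx; split => //; rewrite -fx; apply/V1P.
    rewrite lt_neqAle; apply/andP; split; first by apply/eqP => xl; apply: nl; rewrite -xl fx.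
    by rewrite leNgt; apply/negP => /V2P.
  - by rewrite -flo; apply/V1P; rewrite lt_neqAle nlo; have /andP[] := lh l.
rewrite -fhi => /V1P; rewrite ltNge => /negP; apply; by have /andP[] := lh l.
Qed.

Lemma tree_is_arc s t (A : set M) : s <> t -> is_arc (s : M) t A <-> A = cc s t.
Proof.
move=> st; split => [[/tree_big_arc_uniq //]|->].
by split; [exact: tree_big_arc|exact: tree_segment_separable].
Qed.

Lemma tree_R_tree : R_tree M R.
Proof.
split.
  exists (@MetricOn R M d (dist_xx d) (@dist_eq0 _ _ d) (dist_sym d) (dist_triangle d)).
  by move=> A; split=> /open_metrizedP h; apply/open_metrizedP.
split=> [x y xy|x y A /[dup] /tree_big_arc_uniq -> h].
  exists (cc x y); split; first exact: tree_big_arc.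
  by move=> A /tree_big_arc_uniq.
by split => //; exact: tree_segment_separable.
Qed.

End TreeMetricSpace.

(** * The automorphism induced by a homeomorphism *)
Lemma finite_lower_bound (R : realType) (T : choiceType) (A : set T) (f : T -> R) : finite_set A ->
  (forall a, A a -> 0 < f a) -> exists2 e, 0 < e & forall a, A a -> e <= f a.
Proof.
move=> fA f0; have memA a : (a \in fset_set A) = (a \in A) by rewrite in_fset_set.
exists (\big[Num.min/1]_(a <- fset_set A) f a).
  rewrite big_seq; elim/big_ind: _ => // [p q p0 q0|a]; first by rewrite lt_min p0.
  by rewrite memA inE => /f0.
by move=> a Aa; apply: ge_bigmin_seq => //; rewrite memA inE.
Qed.

Section InducedMap.
Variables (R : realType) (X : metricType R).
Hypothesis contX : continuum X.
Local Notation P := (cp_class X).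
Local Notation T := (cp_tree R X).
Implicit Types (phi psi : X -> X) (a b c : X) (x y z : P) (E F : edge X) (s t u : T).
Let btP := P_betweenness contX.

Definition inverse_homeos phi psi : Prop :=
  [/\ cancel phi psi, cancel psi phi, continuous phi & continuous psi].

Lemma inverse_homeosC phi psi : inverse_homeos phi psi -> inverse_homeos psi phi.
Proof. by case. Qed.

Definition cls_map phi x : P := cls (phi (rep x)).

(** Defined for any map phi, so that its properties for a homeomorphism can be
    stated separately. *)
Definition edge_map phi E : edge X :=
  if pselect (exists F : edge X,
      val F = [set cls_map phi (edge_src E); cls_map phi (edge_tgt E)])
  is left h then projT1 (cid h) else E.

(** The orientation of edges is arbitrary, so the parameter on the image edge
    may have to be reversed. *)
Definition keeps_src phi E : bool :=
  `[< edge_src (edge_map phi E) = cls_map phi (edge_src E) >].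

Definition flip (b : bool) (r : R) : R := if b then r else 1 - r.

Lemma flip01 (b : bool) (r : {r : R | 0 < r < 1}) : 0 < flip b (val r) < 1.
Proof. by case: r => r /= /andP[h1 h2]; case: b => /=; apply/andP; split; lra. Qed.

Lemma between_flip (b : bool) (p q r : R) :
  between (flip b p) (flip b q) (flip b r) = between p q r.
Proof.
case: b => //=; rewrite /between !lerD2l !lerN2 orbC.
by congr orb; exact: andbC.
Qed.

Definition tree_map phi s : T :=
  match s with
  | inl x => vtx R (cls_map phi x)
  | inr (E, r) => edge_pt (edge_map phi E) (flip01 (keeps_src phi E) r)
  end.

Lemma sep_homeo phi psi c a b : inverse_homeos phi psi ->
  sep c a b -> sep (phi c) (phi a) (phi b).
Proof.
move=> [pK qK _ cq] [V [[oV Vc clV] Va Vb bc]].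
have pre (W : set X) : open W -> open (psi @^-1` W) by move=> oW; apply: open_comp.
exists (psi @^-1` V); split; rewrite /preimage /= ?pK //.
- split; [exact: pre|by rewrite /preimage /= pK|].
  have -> : psi @^-1` V `|` [set phi c] = psi @^-1` (V `|` [set c]).
    apply/seteqP; split => w /=.
      by case=> [?|->]; [left|right; rewrite pK].
    by case=> [?|<-]; [left|right; rewrite qK].
  by rewrite -[V `|` _]setCK -preimage_setC closedC; apply: pre; rewrite openC.
- by move=> h; apply: bc; rewrite -(pK b) h pK.
Qed.

Lemma sep_homeoE phi psi c a b : inverse_homeos phi psi ->
  sep (phi c) (phi a) (phi b) <-> sep c a b.
Proof.
move=> hp; split; last exact: sep_homeo hp.
by move=> /(sep_homeo (inverse_homeosC hp)); case: hp => pK _ _ _; rewrite !pK.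
Qed.

Lemma cutp_homeo phi psi c : inverse_homeos phi psi -> cutp (phi c) <-> cutp c.
Proof.
move=> hp; split=> -[a [b h]].
  by exists (psi a), (psi b); apply/(sep_homeoE _ _ _ hp); case: hp => _ qK _ _; rewrite !qK.
by exists (phi a), (phi b); apply/(sep_homeoE _ _ _ hp).
Qed.

Lemma cp_equiv_homeo phi psi a b : inverse_homeos phi psi ->
  cp_equiv a b -> cp_equiv (phi a) (phi b).
Proof.
move=> hp /cp_equivE[->|[ca cb ab]]; apply/cp_equivE; first by left.
right; split; try by move/(cutp_homeo _ hp).
by move=> e; case: (hp) => _ qK _ _; rewrite -(qK e) => /(sep_homeoE _ _ _ hp) /ab.
Qed.

Lemma pts_cls_map phi psi x : inverse_homeos phi psi ->
  pts (cls_map phi x) = phi @` pts x.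
Proof.
move=> hp; have [pK qK _ _] := hp.
rewrite /cls_map pts_cls -{2}(cls_rep x) pts_cls; apply/seteqP; split=> a.
  move=> /(cp_equiv_homeo (inverse_homeosC hp)); rewrite pK => h.
  by exists (psi a) => //; rewrite qK.
by move=> [b h <-]; exact: cp_equiv_homeo hp h.
Qed.

Lemma cls_map_cls phi psi a : inverse_homeos phi psi -> cls_map phi (cls a) = cls (phi a).
Proof.
move=> hp; apply: pts_clsP; rewrite (pts_cls_map _ hp); exists a => //.
by rewrite pts_cls; left.
Qed.

Lemma cls_mapK phi psi : inverse_homeos phi psi -> cancel (cls_map phi) (cls_map psi).
Proof.
move=> hp x; rewrite {2}/cls_map (cls_map_cls _ (inverse_homeosC hp)).
by case: hp => pK _ _ _; rewrite pK cls_rep.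
Qed.

Lemma P_oo_map phi psi x y z : inverse_homeos phi psi ->
  P_oo x y z -> P_oo (cls_map phi x) (cls_map phi y) (cls_map phi z).
Proof.
move=> hp [a [b [c [xa yb zc h]]]]; have hq := inverse_homeosC hp; have [pK qK _ _] := hp.
exists (phi a), (phi b), (phi c); rewrite !(pts_cls_map _ hp); split; [by exists a|by exists b|by exists c|].
case: h => [[cc abc]|[ncc zx zy h]]; [left|right].
  split; first exact/cut_pointE/(cutp_homeo c hp)/cut_pointE.
  by apply/pt_ooE/(sep_homeoE _ _ _ hp)/pt_ooE.
have inj : injective (cls_map phi) := can_inj (cls_mapK hp).
split; [by move=> /cut_pointE/(cutp_homeo c hp)/cut_pointE|by move/inj|by move/inj|].
apply/seteqP; split => // e [[ac ae] [cb eb]].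
have : (pt_co a c `&` pt_oc c b) (psi e); last by rewrite h.
rewrite -(qK e) in ae eb.
split; (split; first by move=> ?; subst).
  case: ae => [/(can_inj pK) ->|/pt_ooE/(sep_homeoE _ _ _ hp) ?]; first by left.
  by right; apply/pt_ooE.
case: eb => [/(can_inj pK) ->|/pt_ooE/(sep_homeoE _ _ _ hp) ?]; first by left.
by right; apply/pt_ooE.
Qed.

Lemma P_oo_mapE phi psi x y z : inverse_homeos phi psi ->
  P_oo (cls_map phi x) (cls_map phi y) (cls_map phi z) <-> P_oo x y z.
Proof.
move=> hp; split; last exact: P_oo_map hp.
by move=> /(P_oo_map (inverse_homeosC hp)); rewrite !(cls_mapK hp).
Qed.

Lemma cls_map_inj phi psi : inverse_homeos phi psi -> injective (cls_map phi).
Proof. by move=> hp; exact: can_inj (cls_mapK hp). Qed.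

Lemma P_cc_mapE phi psi x y z : inverse_homeos phi psi ->
  P_cc (cls_map phi x) (cls_map phi y) (cls_map phi z) <-> P_cc x y z.
Proof.
move=> hp; have inj := cls_map_inj hp.
split=> /P_ccP[h|h|h]; apply/P_ccP.
- by constructor 1; apply/(P_oo_mapE _ _ _ hp).
- by constructor 2; exact: inj.
- by constructor 3; exact: inj.
- by constructor 1; apply/(P_oo_mapE _ _ _ hp).
- by constructor 2; rewrite h.
- by constructor 3; rewrite h.
Qed.

Lemma adjacent_map phi psi x y : inverse_homeos phi psi ->
  Defs.adjacent x y -> Defs.adjacent (cls_map phi x) (cls_map phi y).
Proof.
move=> hp [xy xy0]; split; first by move/(cls_map_inj hp).
apply/seteqP; split => // z; rewrite -(cls_mapK (inverse_homeosC hp) z).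
by move=> /(P_oo_mapE _ _ _ hp); rewrite xy0.
Qed.

Lemma leaf_map phi psi x y : inverse_homeos phi psi ->
  leaf x y -> leaf (cls_map phi x) (cls_map phi y).
Proof.
move=> hp [cx yx H]; have inj := cls_map_inj hp.
have cxp : cut (cls_map phi x).
  by rewrite /cut rep_cls_cut; apply/(cutp_homeo _ hp).
split => // [/inj //|w]; rewrite -(cls_mapK (inverse_homeosC hp) w) => wx wy.
apply: P_oo_cut => //; apply/(P_oo_mapE _ _ _ hp)/cls_sep_oo/H.
  by move=> e; apply: wx; rewrite e.
by move=> e; apply: wy; rewrite e.
Qed.

Lemma edge_map_val2 phi psi E : inverse_homeos phi psi ->
  val (edge_map phi E) = [set cls_map phi (edge_src E); cls_map phi (edge_tgt E)].
Proof.
move=> hp; rewrite /edge_map; case: pselect => [h|[]]; first exact: (projT2 (cid h)).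
exact/adjacent_edge/(adjacent_map hp)/edge_adjacent.
Qed.

Lemma edge_map_val phi psi E : inverse_homeos phi psi ->
  val (edge_map phi E) = cls_map phi @` val E.
Proof. by move=> hp; rewrite (edge_map_val2 _ hp) edge_val image_setU !image_set1. Qed.

Lemma edge_mapK phi psi : inverse_homeos phi psi -> cancel (edge_map phi) (edge_map psi).
Proof.
move=> hp E; apply: val_inj.
rewrite (edge_map_val _ (inverse_homeosC hp)) (edge_map_val _ hp).
apply/seteqP; split => [_ [_ [x Ex <-] <-]|x Ex]; first by rewrite (cls_mapK hp).
by exists (cls_map phi x); [exists x|exact: (cls_mapK hp)].
Qed.

Lemma keeps_src_inv phi psi E : inverse_homeos phi psi ->
  keeps_src psi (edge_map phi E) = keeps_src phi E.
Proof.
move=> hp; rewrite /keeps_src (edge_mapK hp); apply/asboolP/asboolP => h.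
  by rewrite h (cls_mapK (inverse_homeosC hp)).
by rewrite h (cls_mapK hp).
Qed.

Lemma coord_tree_map phi psi E s : inverse_homeos phi psi ->
  coord (edge_map phi E) (tree_map phi s) = flip (keeps_src phi E) (coord E s).
Proof.
move=> hp; have V x : vcoord (edge_map phi E) (cls_map phi x) =
    flip (keeps_src phi E) (vcoord E x).
  have inj := cls_map_inj hp; have st := edge_src_tgt (E := E).
  have [[e1 e2]|[e1 e2]] := edge_ext (edge_map_val2 E hp); rewrite /keeps_src e1.
    rewrite asboolT //= /vcoord e1 e2; congr (_%:R); congr nat_of_bool.
    by apply: asbool_equiv_eq; exact: P_cc_mapE hp.
  rewrite asboolF //=; last by move/inj/esym.
  have := vcoordP contX E x; case=> -[-> hx]; rewrite /vcoord e1 e2.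
    by rewrite subr0 asboolT //; apply/(P_cc_mapE _ _ _ hp).
  rewrite subrr asboolF // => /(P_cc_mapE _ _ _ hp) h; apply: st.
  exact: (bt_anti btP (bt_sym btP h) (bt_sym btP hx)).
case: s => [x|[F r]]; first exact: V.
have [EF|EF] := pselect (E = F); first by subst F; rewrite coord_edge_pt coord_edge.
have EF' : edge_map phi E <> edge_map phi F by move=> /(can_inj (edge_mapK hp)).
have Fs : val F (edge_src F) by rewrite edge_val; left.
rewrite (coord_other contX r EF Fs) -V; apply: (coord_other contX) => //.
by rewrite (edge_map_val _ hp); exists (edge_src F).
Qed.

Lemma flipK (b : bool) : involutive (flip b).
Proof. by case: b => r //=; rewrite opprB addrC subrK. Qed.

Lemma tree_mapK phi psi : inverse_homeos phi psi -> cancel (tree_map phi) (tree_map psi).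
Proof.
move=> hp [x|[E r]]; first by rewrite /= (cls_mapK hp).
set s := inr _ : T.
have e : coord E (tree_map psi (tree_map phi s)) = coord E s.
  rewrite -{1}(edge_mapK hp E) (coord_tree_map _ _ (inverse_homeosC hp)).
  by rewrite (coord_tree_map _ _ hp) (keeps_src_inv _ hp) flipK.
by apply: (coord_inj contX _ e); rewrite e coord_edge; case: (r).
Qed.

Lemma ends_tree_map phi psi s x : inverse_homeos phi psi ->
  ends s x -> ends (tree_map phi s) (cls_map phi x).
Proof.
move=> hp; case: s => [y /= -> //|[E r] /= Ex].
by rewrite (edge_map_val _ hp); exists x.
Qed.

Lemma T_cc_map phi psi s t u : inverse_homeos phi psi ->
  T_cc s t u -> T_cc (tree_map phi s) (tree_map phi t) (tree_map phi u).
Proof.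
move=> hp; case: u => [z /(T_cc_vtxE contX) h|[E r] /(T_cc_edge contX) h].
  apply/(T_cc_vtxE contX); case: h => [<-|<-|[x [y [sx ty h]]]].
  - by constructor 1.
  - by constructor 2.
  - constructor 3; exists (cls_map phi x), (cls_map phi y).
    by split; [exact: ends_tree_map hp sx|exact: ends_tree_map hp ty|apply/(P_oo_mapE _ _ _ hp)].
apply/(T_cc_edge contX); rewrite !(coord_tree_map _ _ hp) /= between_flip.
exact: h.
Qed.

Lemma leaf_base_map phi psi E : inverse_homeos phi psi -> leaf_edge E ->
  leaf_edge (edge_map phi E) /\ leaf_base (edge_map phi E) = cls_map phi (leaf_base E).
Proof.
move=> hp lE; have LE := leaf_map hp (leaf_edgeP lE).
have e : val (edge_map phi E) = [set cls_map phi (leaf_base E); cls_map phi (leaf_tip E)].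
  by rewrite (edge_map_val _ hp) leaf_edge_val image_setU !image_set1.
have lF : leaf_edge (edge_map phi E).
  by rewrite /leaf_edge; have [[-> ->]|[-> ->]] := edge_ext e; [left|right].
split => //; have [cb _ _] := leaf_edgeP lF.
have : val (edge_map phi E) (leaf_base (edge_map phi E)) by rewrite leaf_edge_val; left.
rewrite e => -[//|/= h]; case: (leaf_noncut contX LE); rewrite -h //.
Qed.

(** Both sides are the coordinate of s over E or 1 minus it, and they agree at
    the base. *)
Lemma height_tree_map phi psi E s : inverse_homeos phi psi -> leaf_edge E ->
  height (edge_map phi E) (tree_map phi s) = height E s.
Proof.
move=> hp lE; have [lF bF] := leaf_base_map hp lE.
have hE : exists b : bool, forall t, height E t = flip b (coord E t).
  by rewrite /height; case: asboolP => _; [exists true|exists false].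
have hF : exists b : bool, forall t, height (edge_map phi E) (tree_map phi t) = flip b (coord E t).
  rewrite /height; case: asboolP => _.
    by exists (keeps_src phi E) => t; rewrite (coord_tree_map _ _ hp).
  exists (~~ keeps_src phi E) => t; rewrite (coord_tree_map _ _ hp).
  by case: keeps_src => //=; rewrite opprB addrC subrK.
case: hE => b hb; case: hF => b' hb'; rewrite hb hb'; congr flip.
have := hb' (vtx R (leaf_base E)); rewrite /= -bF (height_base contX).
have := hb (vtx R (leaf_base E)); rewrite (height_base contX).
by case: b {hb}; case: b' {hb'} => //= h1 h2; exfalso; clear -h1 h2; lra.
Qed.

Variable d : metric_on R T.
Hypothesis td : tree_metric (@T_cc R X) d.
Hypothesis d_local : forall s (e : R), 0 < e -> exists (A : set T) (c : R),
  [/\ finite_set A, ~ A s, 0 < c &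
   forall t, (forall u, A u -> ~ T_cc s t u) ->
     (forall E, leaf_edge E -> vtx R (leaf_base E) = s -> height E t < c) -> d s t < e].
Hypothesis d_leaf : exists l : T -> R, (forall u, 0 < l u) /\
    forall E s t, leaf_edge E ->
      l (vtx R (leaf_base E)) * `|height E s - height E t| <= d s t.

(** Pull back along the inverse map the finite set A and the bound c that
    describe a ball around the image of s.  A small distance d s t keeps t from
    lying beyond the preimages of A, and keeps t low on the leaf edges at s. *)
Lemma tree_map_continuous phi psi : inverse_homeos phi psi ->
  continuous (tree_map phi : metrized d -> metrized d).
Proof.
move=> hp s U /nbhs_metrizedP[e e0 hU]; apply/nbhs_metrizedP.
have hq := inverse_homeosC hp.
have [A [c [fA As c0 hA]]] := d_local (tree_map phi s) e0.
have [l [l0 hl]] := d_leaf.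
have [|e1 e10 he1] := finite_lower_bound (f := fun u : T => d s (tree_map psi u)) fA.
  move=> a Aa; rewrite lt_neqAle metrized_ge0 andbT eq_sym; apply/eqP => /(dist_eq0 (m := d)) sa.
  by apply: As; rewrite sa (tree_mapK hq).
exists (Num.min e1 (l s * c)); first by rewrite lt_min e10 mulr_gt0.
move=> t; rewrite lt_min => /andP[st1 st2]; apply: hU; apply: hA.
  move=> a Aa /(T_cc_map hq); rewrite !(tree_mapK hp) => /(segment_dist_le td).
  by rewrite leNgt => /negP; apply; exact: lt_le_trans st1 (he1 a Aa).
move=> F lF bF; have [lE bE] := leaf_base_map hq lF.
have bs : vtx R (leaf_base (edge_map psi F)) = s.
  by rewrite bE -(tree_mapK hp s) -bF.
rewrite -(edge_mapK hq F) (height_tree_map _ hp lE).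
have hs : height (edge_map psi F) s = 0 by rewrite -bs (height_base contX).
have := hl _ s t lE; rewrite bs hs sub0r normrN.
have /andP[h0 _] := height01 contX (edge_map psi F) t.
rewrite ger0_norm // => h; have := le_lt_trans h st2.
by rewrite ltr_pM2l.
Qed.

Lemma homeomorphism_induced phi : homeomorphism phi -> induces_homeomorphism d phi.
Proof.
move=> [cp [psi [pK qK cq]]].
have hp : inverse_homeos phi psi by []; have hq := inverse_homeosC hp.
exists (cls_map phi), (tree_map phi); split => //; last first.
  split; first exact: tree_map_continuous hp.
  exists (tree_map psi); split; [exact: tree_mapK hp|exact: tree_mapK hq|].
  exact: tree_map_continuous hq.
split=> [x||x y z]; [exact: pts_cls_map hp| |exact: P_oo_mapE hp].
by exists (cls_map psi); [exact: cls_mapK hp|exact: cls_mapK hq].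
Qed.

End InducedMap.

(** * A fan with uncountably many branches at its apex *)
Section ThinSet.
Variable R : realType.

(** An interval of length 2^-(n+2) around the rational number with code n; all
    these intervals together have measure at most 1/2. *)
Definition rational_gap (n : nat) : set R :=
  if choice.unpickle n is Some q then ball (ratr q : R) (2^-1 / (2 ^ n.+1)%:R / 2) else set0.

Definition thin_set : set R := `[0, 1] `\` \bigcup_n rational_gap n.

Lemma rational_gap_radius n : 0 < 2^-1 / (2 ^ n.+1)%:R / 2 :> R.
Proof. by rewrite !divr_gt0 // ltr0n expn_gt0. Qed.

Lemma open_rational_gaps : open (\bigcup_n rational_gap n).
Proof.
apply: bigcup_open => n _; rewrite /rational_gap.
case: choice.unpickle => [q|]; last exact: open0.
exact: ball_open.
Qed.

Lemma thin_set_compact : compact thin_set.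
Proof.
apply: compact_closedI; first exact: segment_compact.
by rewrite closedC; exact: open_rational_gaps.
Qed.

Lemma thin_set_irrational (q : rat) : ~ thin_set (ratr q).
Proof.
move=> [_]; apply; exists (choice.pickle q); first exact: I.
by rewrite /rational_gap choice.pickleK; exact/ballxx/rational_gap_radius.
Qed.

(** Its Lebesgue measure is at least 1/2. *)
Lemma thin_set_uncountable : ~ countable thin_set.
Proof.
move=> cC; pose mu := @lebesgue_measure R.
have mgap n : measurable (rational_gap n).
  by rewrite /rational_gap; case: choice.unpickle => // q; exact: measurable_realfun.measurable_ball.
have mU := bigcup_measurable (fun n (_ : [set: nat] n) => mgap n).
have mC : measurable thin_set.
  exact: measurable_realfun.compact_measurable thin_set_compact.
have le_gaps : (mu (\bigcup_n rational_gap n) <= (2^-1)%:E)%E.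
  have := @measure_sigma_subadditive _ R _ mu _ _ mgap mU (@subset_refl _ _).
  move=> /le_trans; apply.
  apply: (@le_trans _ _ (\sum_(n <oo) (2^-1 / (2 ^ n.+1)%:R)%:E)%E); last first.
    by apply: epsilon_trick0; rewrite invr_ge0.
  apply: lee_nneseries => // n _; rewrite /rational_gap.
  case: choice.unpickle => [q|]; last first.
    by rewrite measure0 lee_fin divr_ge0.
  rewrite /= lebesgue_measure_ball; last exact/ltW/rational_gap_radius.
  by rewrite lee_fin mulr2n -splitr.
have leU : (mu (thin_set `|` \bigcup_n rational_gap n) <=
    mu thin_set + mu (\bigcup_n rational_gap n))%E := @measureU2 _ _ R mu _ _ mC mU.
have : (mu `[0%R, 1%R]%classic <= mu (thin_set `|` \bigcup_n rational_gap n))%E.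
  apply: le_measure; first by rewrite inE.
  - by rewrite inE; exact: measurableU mC mU.
  - by move=> x h; have [u|u] := pselect ((\bigcup_n rational_gap n) x); [right|left].
have C0 : mu thin_set = 0%E := countable_lebesgue_measure0 cC.
rewrite C0 add0e in leU; move=> /le_trans /(_ (le_trans leU le_gaps)).
rewrite /mu lebesgue_measure_itv /= lte_fin ltr01 EFinN sube0 lee_fin.
by rewrite leNgt invf_lt1 // ltr1n.
Qed.

End ThinSet.

Definition in_fan (R : realType) (p : R * R) : bool :=
  `[< exists t a, [/\ 0 <= t <= 1, thin_set a & p = (t, t * a)] >].

(** The union of the segments from the origin to (1, a) with a in the thin
    set. *)
Definition fan (R : realType) : Type := {p : R * R | in_fan p}.

Section Fan.
Variable R : realType.
HB.instance Definition _ := gen_eqMixin (fan R).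
HB.instance Definition _ := gen_choiceMixin (fan R).

Definition fan_dist (x y : fan R) : R :=
  `|(sval x).1 - (sval y).1| + `|(sval x).2 - (sval y).2|.

Let fan_distxx x : fan_dist x x = 0.
Proof. by rewrite /fan_dist !subrr !normr0 addr0. Qed.

Let fan_dist_eq0 x y : fan_dist x y = 0 -> x = y.
Proof.
move=> /eqP; rewrite paddr_eq0 // !normr_eq0 !subr_eq0 => /andP[/eqP h1 /eqP h2].
by apply: val_inj; rewrite /= [LHS]surjective_pairing h1 h2 -surjective_pairing.
Qed.

Let fan_dist_sym x y : fan_dist x y = fan_dist y x.
Proof. by rewrite /fan_dist distrC [X in _ + X]distrC. Qed.

Let fan_dist_triangle y x z : fan_dist x z <= fan_dist x y + fan_dist y z.
Proof. by rewrite /fan_dist addrACA; apply: lerD; exact: ler_distD. Qed.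

HB.instance Definition _ := @isMetric.Build R (fan R) fan_dist fan_distxx fan_dist_eq0
  fan_dist_sym fan_dist_triangle.

Lemma fan_lipschitz (f : fan R -> R) (k : R) : 0 < k ->
  (forall x y, `|f x - f y| <= k * fan_dist x y) -> continuous f.
Proof.
move=> k0 h x U /nbhs_ballP[e e0 hU]; apply/nbhs_ballP.
exists (e / k); first exact: divr_gt0.
move=> y; rewrite ballEmdist => xy; apply: hU; apply: le_lt_trans (h x y) _.
by rewrite -lter_pdivlMl // mulrC.
Qed.

(** The position of x relative to the line of slope q through the apex. *)
Definition fan_side (q : R) (x : fan R) : R := (sval x).2 - q * (sval x).1.

Lemma fan_side_continuous q : continuous (fan_side q).
Proof.
apply: (@fan_lipschitz _ (1 + `|q|)) => [|x y]; first by rewrite ltr_pwDl.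
rewrite /fan_side /fan_dist.
have -> : (sval x).2 - q * (sval x).1 - ((sval y).2 - q * (sval y).1) =
  ((sval x).2 - (sval y).2) - q * ((sval x).1 - (sval y).1) by rewrite mulrBr; lra.
apply: le_trans (ler_normB _ _) _; rewrite normrM.
set A := `|_ - (sval y).2|; set B := `|_ - (sval y).1|.
have A0 : 0 <= A := normr_ge0 _; have B0 : 0 <= B := normr_ge0 _; have q0 := normr_ge0 q.
have := mulr_ge0 q0 A0; rewrite mulrDl mul1r mulrDr; lra.
Qed.

Lemma thin_set_nonempty : exists a : R, thin_set a.
Proof.
apply: contrapT => h; apply: (@thin_set_uncountable R).
suff -> : @thin_set R = set0 by exact: countable0.
by apply/seteqP; split => // a ta; apply: h; exists a.
Qed.

Let base := projT1 (cid thin_set_nonempty).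

Lemma fan_pt_subproof (p : R * R) :
  in_fan (if `[< (`[0, 1] `*` @thin_set R) p >] then (p.1, p.1 * p.2) else (0, 0)).
Proof.
apply/asboolP; case: asboolP => [[h1 h2]|_].
  by exists p.1, p.2; split => //; move: h1; rewrite /= in_itv.
by exists 0, base; rewrite lexx ler01 mul0r; split => //; exact: projT2 (cid _).
Qed.

(** The point of abscissa t on the branch of slope a. *)
Definition fan_pt (t a : R) : fan R :=
  exist (fun p => is_true (in_fan p)) _ (fan_pt_subproof (t, a)).

Lemma fan_ptE t a : 0 <= t <= 1 -> thin_set a -> sval (fan_pt t a) = (t, t * a).
Proof. by move=> t01 ha; rewrite /= asboolT //; split => //=; rewrite in_itv. Qed.

Lemma fan_ptP x : exists t a, [/\ 0 <= t <= 1, thin_set a & x = fan_pt t a].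
Proof.
have /asboolP[t [a [t01 ha e]]] := svalP x.
by exists t, a; split => //; apply: val_inj; rewrite [RHS]fan_ptE.
Qed.

Lemma fan_pt_continuous :
  {within `[0, 1] `*` @thin_set R, continuous (fun p => fan_pt p.1 p.2)}.
Proof.
have unitP (t : R) : `[0, 1]%classic t -> 0 <= t <= 1 by rewrite /= in_itv.
apply/subspace_continuousP => -[t a] [/unitP /= t01 /= ha] U /nbhs_ballP[e e0 hU].
rewrite nbhs_simpl /=; apply/nbhs_ballP; have e3 : 0 < e / 3 by rewrite divr_gt0.
exists (e / 3) => // -[t' a'] [/= tt aa] [/unitP /= t01' /= ha']; apply: hU.
rewrite ballEmdist /= /mdist /= /fan_dist !fan_ptE //=.
(* |t a - t' a'| <= |t - t'| + |a - a'| on the unit square *)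
have -> : t * a - t' * a' = (t - t') * a + t' * (a - a') by rewrite mulrBl mulrBr; lra.
  have a1 : `|a| <= 1.
    by case: ha => + _; rewrite /= in_itv /= ler_norml => /andP[? ?]; apply/andP; split; lra.
  have t1 : `|t'| <= 1.
    by move: t01'; rewrite ler_norml => /andP[? ?]; apply/andP; split; lra.
  have h := ler_normD ((t - t') * a) (t' * (a - a')); rewrite !normrM in h.
  have h1 := ler_wpM2l (normr_ge0 (t - t')) a1.
  have h2 := ler_wpM2r (normr_ge0 (a - a')) t1.
  have tt' : `|t - t'| < e / 3 by exact: tt.
  have aa' : `|a - a'| < e / 3 by exact: aa.
by lra.
Qed.

Lemma fan_continuum : continuum (fan R).
Proof.
have fanE : (fun p => fan_pt p.1 p.2) @` (`[0, 1] `*` @thin_set R) = [set: fan R].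
  apply/seteqP; split => // x _; have [t [a [t01 ha ->]]] := fan_ptP x.
  by exists (t, a) => //; split => //=; rewrite in_itv.
split.
  rewrite -fanE; apply: continuous_compact; first exact: fan_pt_continuous.
  by apply: compact_setX; [exact: segment_compact|exact: thin_set_compact].
have -> : [set: fan R] = \bigcup_(a in @thin_set R) [set fan_pt t a | t in `[0, 1]].
  apply/seteqP; split => // x _; have [t [a [t01 ha ->]]] := fan_ptP x.
  by exists a => //; exists t => //=; rewrite in_itv.
apply: bigcup_connected.
  exists (fan_pt 0 base) => a ha; exists 0; first by rewrite /= in_itv /= lexx ler01.
  have h0 : 0 <= (0 : R) <= 1 by rewrite lexx ler01.
  apply: val_inj; rewrite [LHS]fan_ptE // [RHS]fan_ptE ?mul0r //.
  exact: projT2 (cid _).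
move=> a ha; apply: connected_continuous_connected; first exact: segment_connected.
apply/subspace_continuousP => t t01.
have /subspace_continuousP/(_ (t, a) (conj t01 ha)) := fan_pt_continuous.
move=> h U /h; rewrite !nbhs_simpl /= => /nbhs_ballP[e e0 hU]; apply/nbhs_ballP.
by exists e => // t' tt' t01'; apply: (hU (t', a)); split => //=; exact: ballxx.
Qed.

Definition apex := fan_pt 0 base.

(** A line of rational slope between a and b meets the fan only in the apex. *)
Lemma fan_sep a b : thin_set a -> thin_set b -> a < b ->
  sep apex (fan_pt 1 a) (fan_pt 1 b).
Proof.
move=> ha hb /rat_in_itvoo[q]; rewrite in_itv /= => /andP[aq qb].
have h0 : 0 <= (0 : R) <= 1 by rewrite lexx ler01.
have h1 : 0 <= (1 : R) <= 1 by rewrite lexx ler01.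
have hbase : thin_set base by exact: projT2 (cid _).
have side t c : 0 <= t <= 1 -> thin_set c ->
    fan_side (ratr q) (fan_pt t c) = t * (c - ratr q).
  by move=> ht hc; rewrite /fan_side fan_ptE //= mulrBr [ratr q * t]mulrC.
exists (fan_side (ratr q) @^-1` [set r | r < 0]); split.
- split.
  + by apply: open_comp; [move=> x _; exact: fan_side_continuous|exact: open_lt].
  + by rewrite /preimage /= side // mul0r ltxx.
  + have -> : fan_side (ratr q) @^-1` [set r | r < 0] `|` [set apex] =
        fan_side (ratr q) @^-1` [set r | r <= 0].
      apply/seteqP; split => x /=.
        by case=> [/ltW //|->]; rewrite side // mul0r.
      have [t [c [ht hc ->]]] := fan_ptP x; rewrite side //.
      have [-> _|t0] := eqVneq t 0; last first.
        rewrite le_eqVlt mulf_eq0 (negPf t0) subr_eq0 => /orP[/eqP cq|]; last by left.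
        by case: (@thin_set_irrational R q); rewrite -cq.
      by right; apply: val_inj; rewrite [LHS]fan_ptE // [RHS]fan_ptE // !mul0r.
    apply: closed_comp; last exact: closed_le.
    by move=> x _; exact: fan_side_continuous.
- by rewrite /preimage /= side // mul1r subr_lt0.
- by rewrite /preimage /= side // mul1r subr_lt0 => /(lt_trans qb); rewrite ltxx.
- move=> /(congr1 sval); rewrite fan_ptE // fan_ptE // => -[/eqP].
  by rewrite oner_eq0.
Qed.

(** Suppose a ball around the apex class c contains some U(s, A) that contains
    c.  For each branch whose tip is outside the ball, [s, tip] contains a point
    of A.  As [s, c] contains none, this point lies on the branch, so different
    branches have different points, and finitely many tips are outside the ball.
    With the radius going to 0 this would leave countably many branches. *)
Lemma fan_metric_topology (d : metric_on R (cp_tree R (fan R))) :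
  metric_topology_differs d.
Proof.
have bt := T_betweenness (R := R) fan_continuum.
pose c : cp_tree R (fan R) := vtx R (cls apex).
pose v (a : R) : cp_tree R (fan R) := vtx R (cls (fan_pt 1 a)).
have vP a b : thin_set a -> thin_set b -> a <> b ->
    P_oo (cls (fan_pt 1 a)) (cls (fan_pt 1 b)) (cls apex).
  have main x y : thin_set x -> thin_set y -> x < y ->
      P_oo (cls (fan_pt 1 x)) (cls (fan_pt 1 y)) (cls apex).
    move=> hx hy xy; exists (fan_pt 1 x), (fan_pt 1 y), apex.
    have h := fan_sep hx hy xy; have ce : cut_point apex.
      by apply/cut_pointE; exists (fan_pt 1 x), (fan_pt 1 y).
    by split; try (by rewrite pts_cls; left); left; split => //; apply/pt_ooE.
  move=> ha hb /eqP; case: ltgtP => // h _; first exact: main.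
  by apply: P_oo_sym; exact: main.
have vc a b : thin_set a -> thin_set b -> a <> b -> T_cc (v a) (v b) c.
  by move=> ha hb ab; apply/(T_cc_vtx_P_cc fan_continuum); left; exact: vP.
move=> top; apply: (@thin_set_uncountable R).
pose far n : set R := [set a | thin_set a /\ n.+1%:R^-1 <= d c (v a)].
have cfar n : countable (far n).
  have /open_metrizedP oO : forall x : metrized d, d c x < n.+1%:R^-1 ->
      exists2 e, 0 < e & forall t, d x t < e -> d c t < n.+1%:R^-1.
    move=> x h; exists (n.+1%:R^-1 - d c x); first by rewrite subr_gt0.
    by move=> t xt; apply: le_lt_trans (dist_triangle d x c t) _; rewrite addrC -ltrBrDr.
  have /(_ c)[|s [A [fA sAc sub]]] := (top [set t | d c t < n.+1%:R^-1]).1 oO.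
    by rewrite /= dist_xx invr_gt0 ltr0n.
  have nA a : A a -> ~ T_cc s c a.
    by move=> Aa sca; have : (T_cc s c `&` A) a by []; rewrite sAc.
  have /countable_injP[f finj] := finite_set_countable fA.
  apply: (@countable_code R (far n) nat (fun a m => exists u, [/\ A u, T_cc s (v a) u & f u = m])).
    move=> a [ha da]; apply: contrapT => h; move: da; rewrite leNgt => /negP; apply.
    apply: sub; apply/seteqP; split => // u [su Au]; apply: h; exists (f u), u.
    by split.
  move=> a b m [ha _] [hb _] [u [Au su fu]] [w [Aw sw fw]].
  have uw : u = w by apply: finj; rewrite ?inE // fu fw.
  subst w; apply: contrapT => ab; apply: (nA u Au).
  have [//|ua] := bt_tri bt c su; have [//|ub] := bt_tri bt c sw.
  have uc : u = c by exact: (bt_meet bt (vc _ _ ha hb ab) (bt_sym bt ua) ub).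
  by rewrite uc; exact: (bt_r bt).
have : countable (\bigcup_(n in [set: nat]) far n).
  by apply: bigcup_countable => // n _; exact: cfar.
apply: sub_countable; apply: subset_card_le => a ha.
have [b hb ab] : exists2 b, thin_set b & a <> b.
  apply: contrapT => h; apply: (@thin_set_uncountable R).
  suff -> : @thin_set R = [set a] by exact: countable1.
  apply/seteqP; split => [b hb|_ -> //]; apply: contrapT => ba; apply: h.
  by exists b => //; exact: nesym.
have da : 0 < d c (v a).
  rewrite lt_neqAle metrized_ge0 andbT eq_sym; apply/eqP => /(dist_eq0 (m := d)) [] ca.
  by have [h _ _] := P_oo_neq (vP a b ha hb ab); apply: h; exact: val_inj.
exists (Num.truncn (d c (v a))^-1) => //; split => //.
by rewrite invf_ple ?posrE ?ltr0n //; exact/ltW/truncnS_gt.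
Qed.

End Fan.

(** * The cut point tree as a metric tree *)
Theorem theorem14 (R : realType) :
  exists D : forall X : metricType R, continuum X -> metric_on R (cp_tree R X),
    (forall (X : metricType R) (cX : continuum X),
       [/\ path_metric (metrized (D X cX)),
           preserves_pretree (D X cX),
           R_tree (metrized (D X cX)) R &
           forall phi : X -> X, homeomorphism phi ->
             induces_homeomorphism (D X cX) phi])
    /\ (exists (X : metricType R) (cX : continuum X),
          metric_topology_differs (D X cX)).
Proof.
exists (fun X cX => projT1 (cid (cp_tree_metric cX))); split; last first.
  by exists (fan R), (fan_continuum R); exact: fan_metric_topology.
move=> X cX; case: cid => /= d [td d_local d_leaf].
have bt := T_betweenness (R := R) cX; split.
- exact: tree_path_metric bt td.
- by move=> s t st A; exact: (tree_is_arc bt td A st).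
- exact: tree_R_tree bt td.
- by move=> phi hphi; exact: (homeomorphism_induced cX td d_local d_leaf hphi).
Qed.
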